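(* Let $H\in(\tfrac12,1)$, $T>0$, and let $D$, $\mathcal H$, $\mathbb D^{k,p}$ denote the Malliavin derivative, the Hilbert space and the Malliavin--Sobolev spaces associated with a fractional Brownian motion $W_H$ of Hurst index $H$ on $[0,T]$. Let $\{F_n\}_{n\ge 1}$ be a sequence in $\mathbb D^{1,2}$ and let $F_\infty\in\mathbb D^{2,4}$ satisfy $\|DF_\infty\|_{\mathcal H}\ge c$ almost surely for some constant $c>0$. If the laws of all $F_n$ ($n\ge1$) and of $F_\infty$ are absolutely continuous with respect to the Lebesgue measure on $\mathbb R$, then there exists a constant $C>0$ independent of $n$ such that the total variation distance between the laws of $F_n$ and $F_\infty$ satisfies $$d_{\mathrm{TV}}(F_n,F_\infty)\le C\,\|F_n-F_\infty\|_{\mathbb D^{1,2}}\qquad\text{for all } n\ge1 .$$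
   Context: Let $W_H=\{W_H(t)\}_{t\in[0,T]}$ be a fractional Brownian motion with Hurst index $H\in(\frac12,1)$ on a complete filtered probability space $(\Omega,\mathscr F,\{\mathscr F_t\}_{t\in[0,T]},\mathbb P)$ satisfying the usual conditions, i.e. a centered Gaussian process with covariance $\mathrm{Cov}(t,s)=H(2H-1)\int_0^t\int_0^s|u-v|^{2H-2}\,\mathrm du\,\mathrm dv$. Let $\mathcal H$ be the Hilbert space obtained as the closure of the real-valued step functions on $[0,T]$ with respect to the scalar product determined by $\langle \mathbf 1_{[0,t]},\mathbf 1_{[0,s]}\rangle_{\mathcal H}=\mathrm{Cov}(t,s)$; the map $\mathbf 1_{[0,t]}\mapsto W_H(t)$ extends to an isometry $\varphi\mapsto W_H(\varphi)$ from $\mathcal H$ onto a closed subspace of $L^2(\Omega;\mathbb R)$. Let $\mathcal S$ be the class of random variables $F=g(W_H(\varphi_1),\dots,W_H(\varphi_n))$ with $n\ge1$, $\varphi_i\in\mathcal H$, and $g:\mathbb R^n\to\mathbb R$ smooth with all partial derivatives of polynomial growth. For such $F$, $DF=\sum_{i=1}^n\partial_i g(W_H(\varphi_1),\dots,W_H(\varphi_n))\varphi_i$, and $D^kF$ is the iterated derivative, with values in $\mathcal H^{\otimes k}$. For $k\ge1$, $p\ge1$, $\mathbb D^{k,p}$ is the completion of $\mathcal S$ under $\|F\|_{\mathbb D^{k,p}}=\big(\mathbb E[|F|^p+\sum_{j=1}^k\|D^jF\|_{\mathcal H^{\otimes j}}^p]\big)^{1/p}$. The total variation distance is $d_{\mathrm{TV}}(F,G)=\sup_{A\in\mathcal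 B(\mathbb R)}|\mathbb P(F\in A)-\mathbb P(G\in A)|$. *)

(* Defs.v *)
From HB Require Import structures.
From mathcomp Require Import all_boot all_order all_algebra sesquilinear.
From mathcomp Require Import all_classical all_reals all_analysis.
Set Implicit Arguments.
Unset Strict Implicit.
Unset Printing Implicit Defensive.
Import Order.TTheory GRing.Theory Num.Theory.
Import numFieldNormedType.Exports.
Local Open Scope classical_set_scope.
Local Open Scope ring_scope.

(** * Hilbert spaces and their tensor products *)

Record hilbertType (R : realType) := Hilbert {
  hilbert_carrier :> completeNormedModType R;
  hdot : {dot hilbert_carrier for idfun};
  hdot_norm : forall x : hilbert_carrier, hdot x x = `|x| ^+ 2 }.
Arguments hdot {R h}.

(* The Hilbert tensor product of [V] and [W], given by the data that determine
   it up to a unique isometric isomorphism. *)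
Record hilbert_tensor (R : realType) (V W : hilbertType R) := HilbertTensor {
  tensor_space :> hilbertType R;
  tensor : {bilinear V -> W -> tensor_space | *:%R & *:%R};
  tensor_dot : forall v v' w w',
    hdot (tensor v w) (tensor v' w') = hdot v v' * hdot w w';
  tensor_dense : closure [set z : tensor_space |
    exists (n : nat) (v : 'I_n -> V) (w : 'I_n -> W),
      z = \sum_(i < n) tensor (v i) (w i)] = setT }.

(* [tpow ten V j] is the (j+1)-st tensor power of [V]; in particular
   [tpow ten V 0] is [V] itself. *)
Fixpoint tpow (R : realType)
    (ten : forall V W : hilbertType R, hilbert_tensor V W)
    (V : hilbertType R) (j : nat) : hilbertType R :=
  if j is j'.+1 then ten (tpow ten V j') V else V.

(** * Fractional Brownian motion and its Hilbert space *)

Section FractionalBrownianMotion.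
Context (R : realType).

Definition fbm_cov (H t s : R) : R :=
  H * (2 * H - 1) *
  \int[@lebesgue_measure R]_(u in `[0, t])
    \int[@lebesgue_measure R]_(v in `[0, s]) (`|u - v| `^ (2 * H - 2)).

Definition step_function (T : R) (f : R -> R) : Prop :=
  exists (n : nat) (a t : 'I_n -> R), (forall i, t i \in `[0, T]) /\
    f = fun x => \sum_(i < n) a i * \1_(`[0, t i]) x.

(* The completion of the step functions for the scalar product with
   <1_[0,t], 1_[0,s]> = fbm_cov H t s; [step_class] is the canonical map into
   it, and its values outside the step functions are irrelevant. *)
Record fbm_hilbert (H T : R) := FbmHilbert {
  fbm_space :> hilbertType R;
  step_class : (R -> R) -> fbm_space;
  step_class_linear : forall (a : R) (f g : R -> R),
    step_function T f -> step_function T g ->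
    step_class (fun x => a * f x + g x) = a *: step_class f + step_class g;
  step_class_dot : forall t s : R, t \in `[0, T] -> s \in `[0, T] ->
    hdot (step_class \1_(`[0, t])) (step_class \1_(`[0, s])) = fbm_cov H t s;
  step_class_dense : closure (step_class @` step_function T) = setT }.

Context d (Omega : measurableType d) (P : probability Omega R).

(* Complete filtered probability space under the usual conditions. *)
Definition usual_conditions (T : R) (Fil : R -> set (set Omega)) : Prop :=
  [/\ measure_is_complete P,
      forall t, t \in `[0, T] ->
        sigma_algebra setT (Fil t) /\ Fil t `<=` measurable,
      forall s t, 0 <= s -> s <= t -> t <= T -> Fil s `<=` Fil t,
      forall t, t \in `[0, T[ ->
        \bigcap_(s in [set` `]t, T]]) Fil s `<=` Fil t &
      P.-negligible `<=` Fil 0].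

(* Degenerate (almost surely zero) variables are Gaussian. *)
Definition centered_gaussian (X : Omega -> R) : Prop :=
  {ae P, forall w, X w = 0} \/
  exists2 sigma : R, sigma != 0 &
    forall A : set R, measurable A -> P (X @^-1` A) = normal_prob 0 sigma A.

Definition is_fbm (H T : R) (W : R -> {RV P >-> R}) : Prop :=
  (forall (n : nat) (a t : 'I_n -> R), (forall i, t i \in `[0, T]) ->
     centered_gaussian (fun w => \sum_(i < n) a i * W (t i) w)) /\
  (forall t s, t \in `[0, T] -> s \in `[0, T] ->
     covariance P (W t) (W s) = (fbm_cov H t s)%:E).

(* [I] is (a choice of representatives of) the isometry from [V] into
   L^2(Omega) extending 1_[0,t] |-> W t. *)
Definition is_wiener_isometry (H T : R) (V : fbm_hilbert H T)
    (W : R -> {RV P >-> R}) (I : V -> {RV P >-> R}) : Prop :=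
  [/\ forall t, t \in `[0, T] ->
        {ae P, forall w, I (step_class V \1_(`[0, t])) w = W t w},
      forall (a : R) (phi psi : V),
        {ae P, forall w, I (a *: phi + psi) w = a * I phi w + I psi w} &
      forall phi psi : V,
        ('E_P[(I phi \* I psi)%R] = (hdot phi psi)%:E)%E].

Definition dTV (F G : Omega -> R) : \bar R :=
  ereal_sup [set `|P (F @^-1` A) - P (G @^-1` A)|%E
            | A in (measurable : set (set R))].

End FractionalBrownianMotion.

(** * Malliavin derivative and Sobolev spaces *)

Section SmoothFunctions.
Context (R : realType) (n : nat).

Definition partial (E : normedModType R) (i : 'I_n) (g : 'rV[R]_n -> E)
    (x : 'rV[R]_n) : E := 'D_(delta_mx 0 i) g x.

Definition iter_partial (s : seq 'I_n) (g : 'rV[R]_n -> R) : 'rV[R]_n -> R :=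
  foldr (@partial R) g s.

Definition poly_growth (g : 'rV[R]_n -> R) : Prop :=
  exists (C : R) (N : nat), forall x, `|g x| <= C * (1 + `|x|) ^+ N.

(* C^infinity, expressed by existence and continuity of all iterated partial
   derivatives, each of them (g included) having polynomial growth. *)
Definition smooth_poly_growth (g : 'rV[R]_n -> R) : Prop :=
  forall s : seq 'I_n,
    [/\ forall i x, derivable (iter_partial s g) x (delta_mx 0 i),
        continuous (iter_partial s g) & poly_growth (iter_partial s g)].

End SmoothFunctions.

Section Malliavin.
Context (R : realType).
Variable ten : forall V W : hilbertType R, hilbert_tensor V W.
Variable V : hilbertType R.

(* For F = g(I(phi_1), ..., I(phi_n)), the (j+1)-st derivative of F is
   [smooth_derivative g phi j] evaluated at (I(phi_1), ..., I(phi_n)):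
   D(h(I(phi)) v) = \sum_i (partial_i h)(I(phi)) (v (x) phi_i). *)
Fixpoint smooth_derivative (n : nat) (g : 'rV[R]_n -> R) (phi : 'I_n -> V)
    (j : nat) : 'rV[R]_n -> tpow ten V j :=
  match j return 'rV[R]_n -> tpow ten V j with
  | 0%N => fun x => \sum_(i < n) partial i g x *: phi i
  | j'.+1 => fun x => \sum_(i < n)
      tensor (ten (tpow ten V j') V)
        (partial i (smooth_derivative g phi j') x) (phi i)
  end.

Context d (Omega : measurableType d) (P : probability Omega R).

(* A random variable together with its Malliavin derivatives: [jder F j]
   stands for D^(j+1) F, so [jder F 0] is the [V]-valued variable DF. *)
Record jet := Jet {
  jval : Omega -> R;
  jder : forall j : nat, Omega -> tpow ten V j }.

Definition jet_sub (F G : jet) : jet :=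
  Jet (jval F \- jval G) (fun j w => jder F j w - jder G j w).

(* The norm of D^{k,p}. *)
Definition sobolev_norm (k : nat) (p : R) (F : jet) : \bar R :=
  ((\int[P]_w (`|jval F w| `^ p + \sum_(j < k) `|jder F j w| `^ p)%:E)
     `^ p^-1)%E.

(* The class S of smooth random variables. *)
Definition smooth_jet (I : V -> {RV P >-> R}) (F : jet) : Prop :=
  exists (n : nat) (g : 'rV[R]_n -> R) (phi : 'I_n -> V),
    let X w := \row_(i < n) I (phi i) w in
    [/\ (0 < n)%N, smooth_poly_growth g,
        forall w, jval F w = g (X w) &
        forall j w, jder F j w = smooth_derivative g phi j (X w)].

(* The completion D^{k,p} of S, realised inside
   L^p(Omega) x L^p(Omega; V) x ... x L^p(Omega; V^{(x) k}):
   the norm of S is the product norm of (F, DF, ..., D^k F), so its completion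
   is the closure of the set of such tuples. The derivatives of order greater
   than k are unconstrained. [V] is separable, so Borel measurability is strong
   measurability; the integral in [sobolev_norm] is only meaningful for
   measurable functions. *)
Definition sobolev (I : V -> {RV P >-> R}) (k : nat) (p : R) (F : jet) : Prop :=
  [/\ measurable_fun setT (jval F),
      forall j, (j < k)%N -> forall A : set (tpow ten V j),
        open A -> measurable (jder F j @^-1` A) &
      exists S : nat -> jet, (forall m, smooth_jet I (S m)) /\
        sobolev_norm k p (jet_sub F (S m)) @[m --> \oo] --> 0%E].

End Malliavin.

(* Main.v *)
Require Import Defs.
From HB Require Import structures.
From mathcomp Require Import all_boot all_order all_algebra sesquilinear.
From mathcomp Require Import all_classical all_reals all_analysis.
From mathcomp Require Import measurable_realfun lra ring.
Set Implicit Arguments.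
Unset Strict Implicit.
Unset Printing Implicit Defensive.
Import Order.TTheory GRing.Theory Num.Theory.
Import numFieldNormedType.Exports.
Local Open Scope classical_set_scope.
Local Open Scope ring_scope.

(* For [h] with values in [0, 1], with primitive [r], and for cylindrical [F]
   and [G], the chain rule gives
     <D(r(F) - r(G)), DG> = (h(F) - h(G)) |DG|^2 + h(F) <DF - DG, DG>.
   Multiplying by a C^1 cutoff of 1 / |DG|^2 and integrating by parts bounds
   |E h(F) - E h(G)|, up to the effect of the cutoff, by the D^{1,2} norm of
   F - G times L^2 norms of DG and D^2 G: the divergence delta(DG) satisfies
   E[delta(DG)^2] = E|DG|^2 + E|D^2 G|^2, and the smoothness of [h] plays no
   role. The cutoff makes the bound pass to L^2 limits without any lower bound
   on the derivatives of the approximations, and in the limit it is invisible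
   because |DF_oo| >= c. Finally Lipschitz functions with values in [0, 1]
   approximate the indicator of a Borel set in L^1 of two given laws.
   Gaussian integration by parts itself reduces to the normal density in one
   direction, since Wiener integrals of orthogonal vectors are independent;
   this is read off from integrals of cosines. *)

(** * Integration of real functions *)

(** Only one derivative of [F] is controlled, so every second derivative must fall on [G]: the test
    field is [cutinv (|DG|^2) DG], built from [G] alone, and [F] enters through
    [|r(F) - r(G)| <= |F - G|] and [DF - DG]. The divergence of the field is [cutinv (|DG|^2)
    delta(DG) - cutinv' (|DG|^2) <D|DG|^2, DG>]; the second term is at most
    [2 |cutinv'| |DG|^2 |D^2 G|], hence a multiple of [|D^2 G|]. This is why [1 / x] is continued by
    its tangent: the factor must be C^1, with [cutinv x], [y cutinv (y^2)] and [x cutinv' x] bounded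
    on the half-line. Young's inequality with a weight [lam] keeps every bound an integral of
    squares, and [lam] is chosen last. Independence is used without product measures: a signed
    weight with vanishing integral against all cosines has vanishing integral on boxes, and then, by
    rounding to a grid, against functions measurable in one argument and continuous in the other.
    The part of a Gaussian vector orthogonal to a direction can thus be frozen during a
    one-dimensional integration by parts. *)

Section RealIntegral.
Context d (T : measurableType d) (R : realType).
Variable mu : {measure set T -> \bar R}.
Implicit Types f g : T -> R.

Definition L1 f := mu.-integrable setT (EFin \o f).

Lemma L1_measurable f : L1 f -> measurable_fun setT f.
Proof. by move=> /measurable_int /measurable_EFinP. Qed.

Lemma L1_le f g : measurable_fun setT f -> (forall x, `|f x| <= g x) ->
  L1 g -> L1 f.
Proof.
move=> mf fg; apply: le_integrable => //; first exact/measurable_EFinP.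
by move=> x _ /=; rewrite lee_fin (le_trans (fg x))// ler_norm.
Qed.

Lemma L1D f g : L1 f -> L1 g -> L1 (fun x => f x + g x).
Proof. by move=> lf lg; have := integrableD measurableT lf lg. Qed.

Lemma L1Z a f : L1 f -> L1 (fun x => a * f x).
Proof. by move=> lf; have := integrableZl measurableT a lf. Qed.

Lemma L1B f g : L1 f -> L1 g -> L1 (fun x => f x - g x).
Proof. by move=> lf lg; have := integrableB measurableT lf lg. Qed.

Lemma L1_0 : L1 (fun=> 0).
Proof. exact: integrable0. Qed.

Lemma L1_sum I (s : seq I) (Q : pred I) (f : I -> T -> R) :
  (forall i, Q i -> L1 (f i)) -> L1 (fun x => \sum_(i <- s | Q i) f i x).
Proof.
move=> lf; elim: s => [|i s IH].
  by rewrite (_ : (fun x => _) = fun=> 0); [exact: L1_0|];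
    apply/funext => x; rewrite big_nil.
rewrite (_ : (fun x => _) = (fun x => (if Q i then f i x else 0) +
    \sum_(i <- s | Q i) f i x)); last first.
  by apply/funext => x; rewrite big_cons; case: ifP => // _; rewrite add0r.
by apply: L1D => //; case: (boolP (Q i)) => Qi; [exact: (lf i Qi)|exact: L1_0].
Qed.

Lemma L1_norm f : L1 f -> L1 (fun x => `|f x|).
Proof. by move=> /integrable_norm. Qed.

Lemma L1M_bounded f g (M : R) : measurable_fun setT f ->
  (forall x, `|f x| <= M) -> L1 g -> L1 (fun x => f x * g x).
Proof.
move=> mf fM lg; apply: (@L1_le _ (fun x => M * `|g x|)).
- by apply: measurable_funM => //; exact: L1_measurable.
- by move=> x; rewrite normrM ler_wpM2r.
- exact/L1Z/L1_norm.
Qed.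

Lemma RintD f g : L1 f -> L1 g ->
  \int[mu]_x (f x + g x) = \int[mu]_x f x + \int[mu]_x g x.
Proof. exact: RintegralD. Qed.

Lemma RintB f g : L1 f -> L1 g ->
  \int[mu]_x (f x - g x) = \int[mu]_x f x - \int[mu]_x g x.
Proof. exact: RintegralB. Qed.

Lemma RintZ a f : L1 f -> \int[mu]_x (a * f x) = a * \int[mu]_x f x.
Proof. exact: RintegralZl. Qed.

Lemma Rint0 : \int[mu]_x (0 : R) = 0 :> R.
Proof. by rewrite /Rintegral integral0. Qed.

Lemma Rint_sum I (s : seq I) (Q : pred I) (f : I -> T -> R) :
  (forall i, Q i -> L1 (f i)) ->
  \int[mu]_x (\sum_(i <- s | Q i) f i x) = \sum_(i <- s | Q i) \int[mu]_x f i x.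
Proof.
move=> lf; elim: s => [|i s IH].
  by rewrite big_nil -[RHS]Rint0; apply: eq_Rintegral => x _; rewrite big_nil.
rewrite big_cons; under eq_Rintegral do rewrite big_cons.
case: ifP => // Qi; rewrite RintD ?IH//; [exact: lf|exact: L1_sum].
Qed.

Lemma le_Rint f g : L1 f -> L1 g -> (forall x, f x <= g x) ->
  \int[mu]_x f x <= \int[mu]_x g x.
Proof. by move=> lf lg fg; apply: le_Rintegral. Qed.

Lemma le_norm_Rint f : L1 f -> `|\int[mu]_x f x| <= \int[mu]_x `|f x|.
Proof. exact: le_normr_Rintegral. Qed.

Lemma Rint_ae f g : measurable_fun setT f -> measurable_fun setT g ->
  {ae mu, forall x, f x = g x} -> \int[mu]_x f x = \int[mu]_x g x.
Proof.
move=> mf mg fg; congr fine; apply: ae_eq_integral => //.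
- exact/measurable_EFinP.
- exact/measurable_EFinP.
- by apply: filterS fg => x + _ => ->.
Qed.

Lemma L1_ae f g : measurable_fun setT f -> measurable_fun setT g ->
  {ae mu, forall x, f x = g x} -> L1 f -> L1 g.
Proof.
move=> mf mg fg /integrableP[_ lf]; apply/integrableP; split.
  exact/measurable_EFinP.
rewrite (_ : (\int[mu]_x _)%E = (\int[mu]_x `|(EFin \o f) x|)%E)//.
apply: ae_eq_integral => //.
- by apply/measurableT_comp/measurable_EFinP.
- by apply/measurableT_comp/measurable_EFinP.
- by apply: filterS fg => x + _ /= => ->.
Qed.

Lemma L1_Efin f : L1 f -> (\int[mu]_x (f x)%:E)%E = (\int[mu]_x f x)%:E.
Proof. by move=> lf; rewrite /Rintegral fineK//; exact: integrable_fin_num. Qed.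

Lemma L1_ge0 f : measurable_fun setT f -> (forall x, 0 <= f x) ->
  (\int[mu]_x (f x)%:E < +oo)%E -> L1 f.
Proof.
move=> mf f0 fi; apply/integrableP; split; first exact/measurable_EFinP.
by under eq_integral do rewrite /= ger0_norm//.
Qed.

Lemma cvg_Rint (f_ : nat -> T -> R) f g : (forall n, measurable_fun setT (f_ n)) ->
  (forall x, f_ n x @[n --> \oo] --> f x) -> L1 g ->
  (forall n x, `|f_ n x| <= g x) ->
  L1 f /\ \int[mu]_x f_ n x @[n --> \oo] --> \int[mu]_x f x.
Proof.
move=> mf cf lg fg.
have mF : measurable_fun setT f by apply: measurable_fun_cvg => // x _; exact: cf.
have [] := @dominated_convergence _ _ _ mu setT measurableT
  (fun n x => (f_ n x)%:E) (EFin \o f) (EFin \o g).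
- by move=> n; exact/measurable_EFinP.
- exact/measurable_EFinP.
- by apply: aeW => x _; apply/cvg_EFin; [exact: nearW | exact: cf].
- by [].
- by apply: aeW => x n _; rewrite lee_fin.
move=> lf _ cv; split => //.
apply: fine_cvg; rewrite -/(Rintegral _ _ _) [X in _ --> X]fineK.
  exact: cv.
exact: integrable_fin_num.
Qed.

Lemma Rint_lim_cst (f_ : nat -> T -> R) f g c :
  (forall n, measurable_fun setT (f_ n)) ->
  (forall x, f_ n x @[n --> \oo] --> f x) -> L1 g ->
  (forall n x, `|f_ n x| <= g x) ->
  (forall n, \int[mu]_x f_ n x = c) -> \int[mu]_x f x = c.
Proof.
move=> mf cf lg fg fc; have [_] := cvg_Rint mf cf lg fg.
under eq_fun do rewrite fc.
by move=> /cvg_lim <-//; rewrite lim_cst.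
Qed.

End RealIntegral.

Lemma L1_bounded d (T : measurableType d) (R : realType)
    (P : probability T R) (f : T -> R) (M : R) : measurable_fun setT f ->
  (forall x, `|f x| <= M) -> L1 P f.
Proof.
move=> mf fM; apply: (@L1_le _ _ _ P _ (fun=> M)) => //.
exact: finite_measure_integrable_cst.
Qed.

Lemma L1_cst d (T : measurableType d) (R : realType)
  (P : probability T R) (M : R) : L1 P (fun=> M).
Proof. exact: finite_measure_integrable_cst. Qed.

Lemma Rint_cst d (T : measurableType d) (R : realType)
    (P : probability T R) (M : R) : \int[P]_x M = M.
Proof.
rewrite Rintegral_cst// -[RHS]mulr1; congr (_ * _).
exact: (congr1 fine (probability_setT P)).
Qed.

(** * Derivatives *)

Section RealDerivative.
Variable R : realType.
Implicit Types f df : R -> R.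

Lemma lipschitz_bound_continuous f L :
  (forall x y, `|f x - f y| <= L * `|x - y|) -> continuous f.
Proof.
move=> fL x; apply/cvgrPdist_le => e e0; near=> y.
have L1 : 0 < `|L| + 1 by rewrite ltr_wpDl.
apply: (le_trans (fL x y)); apply: (le_trans (y := (`|L| + 1) * `|x - y|)).
  by rewrite ler_wpM2r// (le_trans (ler_norm L))// lerDl.
rewrite -ler_pdivlMl// mulrC; near: y.
have /cvgrPdist_le/(_ (e / (`|L| + 1))) := (@cvg_id _ (nbhs x)).
by apply; exact: divr_gt0.
Unshelve. all: by end_near. Qed.

Lemma max_lipschitz a (x y : R) : `|Num.max x a - Num.max y a| <= 1 * `|x - y|.
Proof.
rewrite mul1r /Num.max; case: ltP => h1; case: ltP => h2; rewrite ?subrr ?normr0//.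
- by rewrite !ler0_norm; lra.
- by rewrite !ger0_norm; lra.
Qed.

Lemma min_lipschitz a (x y : R) : `|Num.min x a - Num.min y a| <= 1 * `|x - y|.
Proof.
rewrite mul1r /Num.min; case: ltP => h1; case: ltP => h2; rewrite ?subrr ?normr0//.
- by rewrite !ler0_norm; lra.
- by rewrite !ger0_norm; lra.
Qed.

Lemma is_derive_continuous f df :
  (forall x, is_derive x (1 : R) f (df x)) -> continuous f.
Proof.
move=> fd x; apply: differentiable_continuous.
by apply/derivable1_diffP; case: (fd x).
Qed.

Lemma mvt_ex f df : (forall x, is_derive x (1 : R) f (df x)) ->
  forall x y, exists2 z, `|z - x| <= `|y - x| & f y - f x = df z * (y - x).
Proof.
move=> fd.
have W x y : x <= y -> exists2 z, x <= z <= y & f y - f x = df z * (y - x).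
  move=> xy; have cf : {within `[x, y], continuous f}.
    by apply: continuous_subspaceT; apply: is_derive_continuous fd.
  have [z] := MVT_segment xy (fun z _ => fd z) cf.
  by rewrite in_itv/=; exists z.
move=> x y; have [xy|yx] := leP x y.
  have [z /andP[a b] e] := W _ _ xy; exists z => //.
  by rewrite !ger0_norm ?subr_ge0// lerD2r.
have [z /andP[a b] e] := W _ _ (ltW yx); exists z.
  by rewrite !ler0_norm ?subr_le0 ?(ltW yx)// lerN2 lerD2r.
by rewrite -opprB e -mulrN opprB.
Qed.

(** Dividing by [h] leaves an error of at most [|K| |h|]. One remainder bound replaces limit
    arguments for functions glued from two formulas or given by an integral: it serves [cutinv] and
    the characteristic function in [normal_cos]. *)
Lemma is_derive_quad f x D K :
  (forall h, `|f (h + x) - f x - D * h| <= K * h ^+ 2) -> is_derive x (1 : R) f D.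
Proof.
move=> fK.
have c : h^-1 *: ((f \o shift x) (h *: (1 : R)) - f x) @[h --> 0^'] --> D.
  apply/cvgrPdist_le => e e0; near=> h.
  have h0 : h != 0 by near: h; exact: nbhs_dnbhs_neq.
  have hK : `|h| * (`|K| + 1) <= e.
    rewrite -ler_pdivlMr ?ltr_wpDl//; near: h.
    apply: dnbhs0_le; rewrite divr_gt0// ltr_wpDl//.
  rewrite /= [h *: 1]mulr1 distrC.
  rewrite (_ : _ - D = h^-1 * (f (h + x) - f x - D * h)); last first.
    by rewrite [RHS]mulrBr [_^-1 * (D * h)]mulrCA mulVf// mulr1.
  rewrite normrM normfV ler_pdivrMl ?normr_gt0//.
  apply: (le_trans (fK h)); apply: (le_trans (y := `|h| * (`|h| * (`|K| + 1)))).
    rewrite mulrA -expr2 real_normK ?num_real// mulrC.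
    rewrite ler_wpM2l ?sqr_ge0// (le_trans (ler_norm K))//; lra.
  by rewrite ler_wpM2l.
split; first by apply/cvg_ex; exists D.
exact: cvg_lim c.
Unshelve. all: by end_near. Qed.

Lemma taylor1_le f df L : (forall x, is_derive x (1 : R) f (df x)) ->
  (forall x y, `|df y - df x| <= L * `|y - x|) ->
  forall x h, `|f (h + x) - f x - df x * h| <= L * h ^+ 2.
Proof.
move=> fd lip x h.
have [z zx ->] := mvt_ex fd x (h + x).
rewrite addrK in zx *; rewrite -mulrBl normrM -[h ^+ 2]real_normK ?num_real// expr2 mulrA.
rewrite ler_wpM2r// (le_trans (lip _ _))// ler_wpM2l//.
by have := lip 0 1; rewrite subr0 normr1 mulr1; apply: le_trans.
Qed.

Lemma derive_bounded_lipschitz f df L : (forall x, is_derive x (1 : R) f (df x)) ->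
  (forall x, `|df x| <= L) -> forall x y, `|f y - f x| <= L * `|y - x|.
Proof.
move=> fd dL x y; have [z _ ->] := mvt_ex fd x y.
by rewrite normrM ler_wpM2r.
Qed.

Lemma derive0_cst f : (forall x, is_derive x (1 : R) f 0) -> forall x y, f x = f y.
Proof.
move=> fd x y; have [z _] := @mvt_ex f (fun=> 0) fd y x.
by rewrite mul0r => /eqP; rewrite subr_eq0 => /eqP.
Qed.

Lemma sin_lipschitz (x y : R) : `|sin y - sin x| <= 1 * `|y - x|.
Proof. by apply: derive_bounded_lipschitz => z; exact: cos_max. Qed.

Lemma cos_lipschitz (x y : R) : `|cos y - cos x| <= 1 * `|y - x|.
Proof.
apply: (derive_bounded_lipschitz (df := fun x => - sin x)) => z.
by rewrite normrN sin_max.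
Qed.

Lemma cos_taylor1 (x h : R) : `|cos (h + x) - cos x - - sin x * h| <= 1 * h ^+ 2.
Proof.
apply: (taylor1_le (f := cos) (df := fun x => - sin x)) => y z.
by rewrite -opprD normrN sin_lipschitz.
Qed.

End RealDerivative.

Section DirectionalDerivative.
Variables (R : realType) (V : normedModType R).

(** The two difference quotients are the same function of [h]. This carries the one-variable chain
    rule and mean value theorem over to arbitrary directions. *)
Lemma is_derive_line (W : normedModType R) (f : V -> W) x v t d :
  is_derive (x + t *: v) v f d <-> is_derive t 1 (fun h : R => f (x + h *: v)) d.
Proof.
have E : (fun h => h^-1 *: ((f \o shift (x + t *: v)) (h *: v) - f (x + t *: v))) =
    (fun h => h^-1 *: (((fun h : R => f (x + h *: v)) \o shift t) (h *: 1)
      - f (x + t *: v))).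
  apply/funext => h /=; congr (_ *: (f _ - _)).
  by rewrite [h *: 1]mulr1 scalerDl addrCA addrA.
split=> -[dx <-].
  by split; [rewrite /derivable -E|rewrite /derive -E].
by split; [rewrite /derivable E|rewrite /derive E].
Qed.

Lemma is_derive_comp (f : V -> R) (g : R -> R) x v df dg :
  is_derive x v f df -> is_derive (f x) (1 : R) g dg ->
  is_derive x v (fun y => g (f y)) (dg * df).
Proof.
have x0 : x = x + 0 *: v by rewrite scale0r addr0.
move=> fd gd; rewrite x0; apply/is_derive_line.
apply: (@is_derive1_comp _ g (fun h => f (x + h *: v))); first by rewrite -x0.
by apply/is_derive_line; rewrite -x0.
Qed.

Lemma is_derive_scale_dir (f : V -> R) x v c df :
  is_derive x v f df -> is_derive x (c *: v) f (c * df).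
Proof.
have x0 : x = x + 0 *: (c *: v) by rewrite scale0r addr0.
move=> fd; rewrite x0; apply/is_derive_line.
have -> : (fun h : R => f (x + h *: (c *: v))) =
    (fun h : R => f (x + h *: v)) \o (fun h => c * h).
  by apply/funext => h /=; rewrite scalerA mulrC.
rewrite mulrC; apply: is_derive1_comp.
  by rewrite mulr0; apply/is_derive_line; rewrite scale0r addr0.
have -> : (fun h => c * h) = c \*: (id : R -> R) by [].
by apply: is_derive_eq; rewrite /GRing.scale/= mulr1.
Qed.

End DirectionalDerivative.

(** * Scalar products and the Cauchy-Schwarz inequality *)

Section Hilbert.
Variables (R : realType) (h : hilbertType R).
Implicit Types u v w : h.

Lemma hdotDl u v w : hdot (u + v) w = hdot u w + hdot v w.
Proof. by rewrite linearDl. Qed.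
Lemma hdotDr u v w : hdot w (u + v) = hdot w u + hdot w v.
Proof. by rewrite linearDr. Qed.
Lemma hdotZl a u w : hdot (a *: u) w = a * hdot u w.
Proof. by rewrite linearZl_LR. Qed.
Lemma hdotZr a u w : hdot w (a *: u) = a * hdot w u.
Proof. by rewrite linearZr. Qed.
Lemma hdotC u v : hdot u v = hdot v u.
Proof. by rewrite hermC expr0 mul1r. Qed.

Lemma hdot_suml I (r : seq I) (Q : pred I) (f : I -> h) w :
  hdot (\sum_(i <- r | Q i) f i) w = \sum_(i <- r | Q i) hdot (f i) w.
Proof. by rewrite linear_sumlz. Qed.

Lemma hdot_sumr I (r : seq I) (Q : pred I) (f : I -> h) w :
  hdot w (\sum_(i <- r | Q i) f i) = \sum_(i <- r | Q i) hdot w (f i).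
Proof. by rewrite linear_sumr. Qed.

Lemma cauchy_schwarz u v : `|hdot u v| <= `|u| * `|v|.
Proof.
have [->|v0] := eqVneq v 0; first by rewrite linear0r normr0 normr0 mulr0.
have vv : 0 < hdot v v by rewrite hdot_norm exprn_gt0 ?normr_gt0.
(* The component of [u] orthogonal to [v], scaled by [hdot v v] to avoid a division; its square norm
   is [hdot v v] times the gap between the two squares to compare. *)
have : 0 <= hdot (hdot v v *: u - hdot u v *: v) (hdot v v *: u - hdot u v *: v).
  by rewrite hdot_norm sqr_ge0.
rewrite -scaleNr !(hdotDl, hdotDr, hdotZl, hdotZr) [hdot v u]hdotC => k.
have {k} : 0 <= hdot v v * (hdot v v * hdot u u - hdot u v ^+ 2).
  by apply: le_trans k _; rewrite le_eqVlt; apply/orP; left; apply/eqP; ring.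
rewrite pmulr_rge0// subr_ge0 !hdot_norm -exprMn [`|v| * _]mulrC => k.
by rewrite -ler_sqr ?nnegrE ?mulr_ge0// real_normK ?num_real.
Qed.

End Hilbert.

(** * Laws and integrals of cosines *)

Lemma measurable_lt_natr d (T : measurableType d) (R : realType)
    (f g : T -> R) : measurable_fun setT f -> measurable_fun setT g ->
  measurable_fun setT (fun w => (f w < g w)%R%:R : R).
Proof.
move=> mf mg; rewrite (_ : (fun w => _) = fun w => if f w < g w then 1 else 0).
  by apply: measurable_fun_ifT => //; exact: measurable_fun_ltr.
by apply/funext => w; case: ifP.
Qed.

(** * Polynomials converging to a threshold function *)

Section PowerThreshold.
Variable R : realType.
Implicit Types x u q r : R.

Lemma bernoulli_le x n : -1 <= x -> 1 + n%:R * x <= (1 + x) ^+ n.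
Proof.
move=> x1; elim: n => [|n IH]; first by rewrite expr0 mul0r addr0.
rewrite exprS; apply: (le_trans (y := (1 + x) * (1 + n%:R * x))).
  have : 0 <= n%:R * (x * x) by rewrite mulr_ge0// -expr2 sqr_ge0.
  rewrite -natr1; nra.
by rewrite ler_wpM2l//; lra.
Qed.

(** With [q = (1 + r) / 2] one has [r <= q^2], hence [n r^n <= (n q^n) q^n]. Bernoulli's inequality
    for [1 / q = 1 + h] bounds [n q^n] by [1 / h], and the other factor [q^n] tends to 0. *)
Lemma cvg_mulrn_expr r : 0 <= r < 1 -> n%:R * r ^+ n @[n --> \oo] --> 0.
Proof.
move=> /andP[r0 r1]; pose q := (1 + r) / 2.
have q0 : 0 < q by rewrite /q; lra.
have q1 : q < 1 by rewrite /q; lra.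
have rq : r <= q ^+ 2 by rewrite /q expr2; nra.
pose h := q^-1 - 1.
have h0 : 0 < h by rewrite /h subr_gt0 invf_gt1.
apply: (@squeeze_cvgr _ _ _ _ (fun=> 0) (fun n => h^-1 * q ^+ n)).
- apply: nearW => n; rewrite mulr_ge0 ?exprn_ge0//=.
  apply: (le_trans (y := n%:R * (q ^+ n * q ^+ n))).
    by rewrite ler_wpM2l// -exprD addnn -mul2n exprM lerXn2r ?nnegrE ?sqr_ge0.
  rewrite mulrA; apply: ler_wpM2r; first by rewrite exprn_ge0// ltW.
  rewrite -ler_pdivlMr ?exprn_gt0//.
  rewrite mulrC -exprVn ler_pdivlMr//.
  have -> : q^-1 = 1 + h by rewrite /h addrCA subrr addr0.
  apply: le_trans (bernoulli_le n _); first by rewrite lerDr.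
  by lra.
- exact: cvg_cst.
- rewrite -[X in _ --> X](mulr0 h^-1); apply: cvgMr; apply: cvg_expr.
  by rewrite ger0_norm ?ltW.
Qed.

(** The exponent times [u^n] is [n (2 u)^n]. For [u < 1/2] it tends to 0 and Bernoulli's inequality
    forces the limit 1; for [u >= 1/2] it is at least [n], and [(1 - x)^N <= 1 / (1 + x)^N <= 1 / (1
    + n)] with [x = u^n]. The factor [n] decides the boundary [u = 1/2], where the exponent [2^n]
    alone would give the limit [1 / e]. *)
Lemma cvg_power_threshold u : 0 <= u <= 1 ->
  (1 - u ^+ n) ^+ (n * 2 ^ n) @[n --> \oo] --> ((u < 1 / 2)%R%:R : R).
Proof.
move=> /andP[u0 u1].
have x01 n : 0 <= 1 - u ^+ n <= 1.
  by rewrite subr_ge0 exprn_ile1//= lerBlDr lerDl exprn_ge0.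
have NxE n : (n * 2 ^ n)%:R * u ^+ n = n%:R * (2 * u) ^+ n.
  by rewrite natrM natrX exprMn mulrA.
have [ult|uge] := ltP.
  have r01 : 0 <= 2 * u < 1 by lra.
  apply: (@squeeze_cvgr _ _ _ _ (fun n => 1 - n%:R * (2 * u) ^+ n) (fun=> 1)).
  - apply: nearW => n; have /andP[a b] := x01 n.
    rewrite exprn_ile1// andbT -NxE -mulrN; apply: bernoulli_le.
    by rewrite lerN2 exprn_ile1.
  - rewrite -[X in _ --> X]subr0; apply: cvgB; [exact: cvg_cst|].
    exact: cvg_mulrn_expr.
  - exact: cvg_cst.
apply: (@squeeze_cvgr _ _ _ _ (fun=> 0) harmonic).
- apply: nearW => n; have /andP[a b] := x01 n; rewrite exprn_ge0//=.
  set N := (n * 2 ^ n)%N; set x := u ^+ n.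
  have x0 : 0 <= x by rewrite /x exprn_ge0.
  have Nx : n%:R <= N%:R * x.
    by rewrite NxE ler_peMr// exprn_ege1//; lra.
  have B : 1 + n%:R <= (1 + x) ^+ N.
    have xN1 : -1 <= x by apply: le_trans x0; rewrite lerN10.
    by apply: le_trans (bernoulli_le N xN1); rewrite lerD2l.
  rewrite -natr1 [n%:R + 1]addrC -div1r ler_pdivlMr; last by rewrite addrC natr1 ltr0n.
  apply: (le_trans (y := (1 - x) ^+ N * (1 + x) ^+ N)).
    by rewrite ler_wpM2l// exprn_ge0.
  rewrite -exprMn exprn_ile1//; rewrite -/x in a b; nra.
- exact: cvg_cst.
- exact: cvg_harmonic.
Qed.

End PowerThreshold.

(** * Signed laws are determined by their cosines *)

Section RayFromCharacteristicFunction.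
Context d1 d2 (T1 : measurableType d1) (T2 : measurableType d2) (R : realType).
Variables (mu1 : {measure set T1 -> \bar R}) (mu2 : {measure set T2 -> \bar R}).
Variables (A1 Y1 : T1 -> R) (A2 Y2 : T2 -> R).
Hypotheses (iA1 : L1 mu1 A1) (iA2 : L1 mu2 A2).
Hypotheses (mY1 : measurable_fun setT Y1) (mY2 : measurable_fun setT Y2).

(** The signed law of [Y1] with density [A1] minus that of [Y2] with density [A2], tested on [h].
    The weights may change sign, so the argument runs on integrals of bounded functions and not on
    uniqueness of positive measures. *)
Let J (h : R -> R) :=
  \int[mu1]_w (A1 w * h (Y1 w)) - \int[mu2]_w (A2 w * h (Y2 w)).
Let bm (h : R -> R) :=
  measurable_fun setT h /\ exists M, forall x, `|h x| <= M.

Let iAh1 h : bm h -> L1 mu1 (fun w => A1 w * h (Y1 w)).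
Proof.
move=> [mh [M hM]]; rewrite (_ : (fun w => _) = fun w => h (Y1 w) * A1 w).
  by apply: (@L1M_bounded _ _ _ _ _ _ M) => //; exact: measurableT_comp.
by apply/funext => w; rewrite mulrC.
Qed.

Let iAh2 h : bm h -> L1 mu2 (fun w => A2 w * h (Y2 w)).
Proof.
move=> [mh [M hM]]; rewrite (_ : (fun w => _) = fun w => h (Y2 w) * A2 w).
  by apply: (@L1M_bounded _ _ _ _ _ _ M) => //; exact: measurableT_comp.
by apply/funext => w; rewrite mulrC.
Qed.

Let bmZD a h g : bm h -> bm g -> bm (fun x => a * h x + g x).
Proof.
move=> [mh [M hM]] [mg [N gN]]; split.
  by apply: measurable_funD => //; exact: measurable_funM.
exists (`|a| * M + N) => x; rewrite (le_trans (ler_normD _ _))// lerD// normrM.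
by rewrite ler_wpM2l.
Qed.

Let bmM h g : bm h -> bm g -> bm (fun x => h x * g x).
Proof.
move=> [mh [M hM]] [mg [N gN]]; split; first exact: measurable_funM.
by exists (M * N) => x; rewrite normrM ler_pM.
Qed.

Let JZD a h g : bm h -> bm g -> J (fun x => a * h x + g x) = a * J h + J g.
Proof.
move=> bh bg; rewrite /J.
rewrite (@eq_Rintegral _ _ _ mu1 _
  (fun w => a * (A1 w * h (Y1 w)) + A1 w * g (Y1 w))); last first.
  by move=> w _; ring.
rewrite (@eq_Rintegral _ _ _ mu2 _
  (fun w => a * (A2 w * h (Y2 w)) + A2 w * g (Y2 w))); last first.
  by move=> w _; ring.
rewrite !RintD ?RintZ//; try by [exact: iAh1|exact: iAh2|
  apply: L1Z; exact: iAh1|apply: L1Z; exact: iAh2].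
ring.
Qed.

Let J_lim (h_ : nat -> R -> R) h : (forall n, measurable_fun setT (h_ n)) ->
  (forall n x, `|h_ n x| <= 1) -> (forall x, h_ n x @[n --> \oo] --> h x) ->
  (forall n, J (h_ n) = 0) -> J h = 0.
Proof.
move=> mh h1 ch Jh.
have [] := @cvg_Rint _ _ _ mu1 (fun n w => A1 w * h_ n (Y1 w))
    (fun w => A1 w * h (Y1 w)) (fun w => `|A1 w|).
- by move=> n; apply/L1_measurable/iAh1; split => //; exists 1.
- by move=> w; apply: cvgMr; exact: ch.
- exact: L1_norm.
- by move=> n w; rewrite normrM ler_piMr.
move=> _ c1.
have [] := @cvg_Rint _ _ _ mu2 (fun n w => A2 w * h_ n (Y2 w))
    (fun w => A2 w * h (Y2 w)) (fun w => `|A2 w|).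
- by move=> n; apply/L1_measurable/iAh2; split => //; exists 1.
- by move=> w; apply: cvgMr; exact: ch.
- exact: L1_norm.
- by move=> n w; rewrite normrM ler_piMr.
move=> _ c2.
have : J (h_ n) @[n --> \oo] --> J h by apply: cvgB.
by under eq_fun do rewrite Jh; move=> /cvg_lim <-//; rewrite lim_cst.
Qed.

Let bm_cos t b : bm (fun x => cos (t * x + b)).
Proof.
split; last by exists 1 => x; exact: cos_max.
apply: continuous_measurable_fun => x; apply: continuous_comp.
  by apply: cvgD; [apply: cvgMr; exact: cvg_id|exact: cvg_cst].
exact: continuous_cos.
Qed.

Let bm_cosX k t b : bm (fun x => cos (t * x + b) ^+ k).
Proof.
elim: k => [|k IH].
  by under eq_fun do rewrite expr0; split => //; exists 1 => x; rewrite normr1.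
by under eq_fun do rewrite exprS; exact: bmM.
Qed.

Hypothesis J_cos : forall t b : R,
  \int[mu1]_w (A1 w * cos (t * Y1 w + b)) =
  \int[mu2]_w (A2 w * cos (t * Y2 w + b)).

Let J0 : J (fun=> 0) = 0.
Proof.
rewrite /J -[RHS](subrr 0); congr (_ - _).
  by rewrite -[RHS](Rint0 mu1); apply: eq_Rintegral => w _; rewrite mulr0.
by rewrite -[RHS](Rint0 mu2); apply: eq_Rintegral => w _; rewrite mulr0.
Qed.

(** The product formula turns one factor [cos (t x + b)] times [cos (s x + c)] into a mean of two
    cosines with new frequency and phase, so the induction on [k] must quantify over [s] and [c]. *)
Let J_cosX k t b s c : J (fun x => cos (t * x + b) ^+ k * cos (s * x + c)) = 0.
Proof.
elim: k s c => [|k IH] s c.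
  by under eq_fun do rewrite expr0 mul1r; rewrite /J J_cos subrr.
rewrite (_ : (fun x => _) = (fun x =>
    2^-1 * (cos (t * x + b) ^+ k * cos ((t + s) * x + (b + c))) +
   (2^-1 * (cos (t * x + b) ^+ k * cos ((t - s) * x + (b - c))) + 0))).
  have bp r e : bm (fun x => cos (t * x + b) ^+ k * cos (r * x + e)).
    by apply: bmM.
  have bz : bm (fun=> 0) by split => //; exists 0 => x; rewrite normr0.
  by rewrite JZD//; [rewrite JZD// !IH J0; ring|exact: bmZD].
apply/funext => x; rewrite exprS addr0.
have -> : (t + s) * x + (b + c) = (t * x + b) + (s * x + c) by ring.
have -> : (t - s) * x + (b - c) = (t * x + b) - (s * x + c) by ring.
move: (t * x + b) (s * x + c) => y z.
by rewrite cosD cosB; field.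
Qed.

Let J_poly (p : {poly R}) t b : J (fun x => p.[cos (t * x + b)]) = 0.
Proof.
under eq_fun do rewrite horner_coef.
have J1 k : J (fun x => cos (t * x + b) ^+ k) = 0.
  rewrite -[RHS](J_cosX k t b 0 0); congr J; apply/funext => x.
  by rewrite mul0r add0r cos0 mulr1.
elim: (size p) => [|n IH].
  by under eq_fun do rewrite big_ord0; exact: J0.
under eq_fun do rewrite big_ord_recr/= addrC.
rewrite JZD ?IH ?J1 ?mulr0 ?addr0// {IH}.
elim: n => [|n IH].
  by under eq_fun do rewrite big_ord0; split => //; exists 0 => x; rewrite normr0.
under eq_fun do rewrite big_ord_recr/= addrC.
exact: bmZD.
Qed.

(* Polynomials of [cos] converge to indicators of arcs by [cvg_power_threshold]. *)
Let J_arc t b : J (fun x => (0 < cos (t * x + b))%R%:R) = 0.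
Proof.
pose u x := (1 - cos (t * x + b)) / 2.
have u01 x : 0 <= u x <= 1.
  by have := cos_le1 (t * x + b); have := cos_geN1 (t * x + b); rewrite /u; lra.
pose h n x := (1 - u x ^+ n) ^+ (n * 2 ^ n).
have hE n x : h n x = ((1 - (2^-1 *: (1 - 'X)) ^+ n) ^+ (n * 2 ^ n)).[cos (t * x + b)].
  by rewrite !hornerE/= /h/u mulrC.
apply: (@J_lim h).
- move=> n; apply/(measurable_funX (n * 2 ^ n))/measurable_funB => //.
  apply/measurable_funX/measurable_funM => //; apply: measurable_funB => //.
  by case: (bm_cos t b).
- move=> n x; have /andP[a c] := u01 x.
  rewrite ger0_norm; first by rewrite exprn_ile1// ?subr_ge0 ?exprn_ile1//;
    rewrite lerBlDr lerDl exprn_ge0.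
  by rewrite exprn_ge0// subr_ge0 exprn_ile1.
- move=> x; have := cvg_power_threshold (u01 x).
  rewrite (_ : (u x < 1 / 2) = (0 < cos (t * x + b)))//.
  by rewrite /u ltr_pM2r// ltrBlDl ltrDr.
- by move=> n; rewrite (funext (hE n)); exact: J_poly.
Qed.

(* As L grows, the arc {0 < sin ((a - x) / L)} exhausts the ray {x < a}. *)
Lemma ray_of_cos (a : R) :
  \int[mu1]_w (A1 w * (Y1 w < a)%R%:R) = \int[mu2]_w (A2 w * (Y2 w < a)%R%:R).
Proof.
apply/eqP; rewrite -subr_eq0; apply/eqP.
pose h n (x : R) : R := (0 < sin ((a - x) / n.+1%:R))%R%:R.
have hE n : h n = (fun x => (0 < cos (- n.+1%:R^-1 * x + (a / n.+1%:R - pi / 2)))%R%:R).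
  apply/funext => x; rewrite /h addrA cosBpihalf.
  by congr (0 < sin _)%R%:R; rewrite mulrBl; ring.
apply: (@J_lim h (fun x => (x < a)%R%:R)).
- move=> n; apply: measurable_lt_natr => //; apply: continuous_measurable_fun.
  move=> x; apply: continuous_comp; last exact: continuous_sin.
  by apply: cvgMl; apply: cvgB; [exact: cvg_cst|exact: cvg_id].
- by move=> n x; rewrite /h; case: (_ < _); rewrite ?normr1 ?normr0.
- move=> x; apply: cvg_near_cst; near=> n.
  have n1 : `|a - x| < n.+1%:R.
    near: n; have := nbhs_infty_ger `|a - x|; apply: filterS => n /=.
    by move=> /le_lt_trans; apply; rewrite ltr_nat.
  have ltpi : `|a - x| / n.+1%:R < pi.
    by rewrite (@lt_trans _ _ 1) ?ltr_pdivrMr ?mul1r// (lt_le_trans _ (pi_ge2 _))//; lra.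
  rewrite /h -(subr_gt0 x a); congr (nat_of_bool _)%:R.
  have [xa|xa|xa] := ltrgtP (a - x) 0; last by rewrite xa mul0r sin0 ltxx.
  - apply/negbTE; rewrite -leNgt -[_ / _]opprK sinN oppr_le0 -mulNr.
    apply: sin_ge0_pi; rewrite divr_ge0 ?oppr_ge0 ?(ltW xa)//=.
    by rewrite ltW// -(ltr0_norm xa).
  - apply: sin_gt0_pi; rewrite divr_gt0//=.
    by rewrite -(gtr0_norm xa).
- by move=> n; rewrite hE; exact: J_arc.
Unshelve. all: by end_near. Qed.

End RayFromCharacteristicFunction.

(** * Primitives on the whole line *)

Section Primitive.
Variable R : realType.
Local Notation leb := (@lebesgue_measure R).

(** Since [h] vanishes on the negative half-line, it is integrable on each []-oo, u]], the integral
    being one over a segment. Integrating from [-oo] gives one formula whose derivative is known at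
    every point. *)
Let primitive_left (h : R -> R) : continuous h -> (forall x, x <= 0 -> h x = 0) ->
  exists r : R -> R, forall x, is_derive x (1 : R) r (h x).
Proof.
move=> ch h0.
have ih u : leb.-integrable `]-oo, u] (EFin \o h).
  apply/integrable_mkcond => //.
  rewrite (_ : _ \_ _ = (EFin \o h) \_ `[0, u]).
    have := (@integrable_mkcond _ _ _ leb `[0, u]%classic (EFin \o h)
      (measurable_itv _)).1; apply.
    apply: continuous_compact_integrable; first exact: segment_compact.
    exact: continuous_subspaceT.
  apply/funext => x; rewrite !patchE.
  have [x0|x0] := ltP x 0; first by rewrite /= h0 ?(ltW x0)//; do 2 case: ifP.
  by congr (if _ then _ else _); apply/idP/idP; rewrite !inE/= !in_itv/= x0.
pose r x := (\int[leb]_(t in `]-oo, x]) h t)%R.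
exists r => x.
have x1 : x < x + 1 by rewrite ltrDl.
have [dr re] : derivable r x (1 : R) /\ derive1 r x = h x.
  by apply: (@continuous_FTC1 R h -oo%O x (x + 1) x1) => //; [rewrite /= ltNyr|exact: ch].
split; first exact: dr.
by rewrite -derive1E.
Qed.

(** The ramp [k] splits [h] into [k h], which vanishes for [x <= 0], and [(1 - k) h], which vanishes
    for [x >= 1]. The second piece is brought to the first situation by the reflection
    [x |-> 1 - x]. *)
Lemma primitive_ex (h : R -> R) : continuous h ->
  exists r : R -> R, forall x, is_derive x (1 : R) r (h x).
Proof.
move=> ch.
pose k (x : R) : R := Num.max (Num.min x 1) 0.
have ck : continuous k.
  apply: (@lipschitz_bound_continuous _ _ 1) => x y.
  by rewrite (le_trans (max_lipschitz 0 _ _))// mul1r min_lipschitz.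
have [r1 d1] : exists r : R -> R, forall x, is_derive x (1 : R) r (k x * h x).
  apply: primitive_left => [x|x x0]; first by apply: cvgM; [exact: ck|exact: ch].
  rewrite /k max_r ?mul0r//; apply: le_trans x0.
  by rewrite ge_min lexx.
have [r2 d2] : exists r : R -> R,
    forall x, is_derive x (1 : R) r ((1 - k (1 - x)) * h (1 - x)).
  have c1 : continuous (fun x : R => 1 - x).
    by move=> x; apply: cvgB; [exact: cvg_cst|exact: cvg_id].
  apply: primitive_left => [x|x x0].
    apply: cvgM.
      apply: cvgB; first exact: cvg_cst.
      by apply: (@continuous_comp _ _ _ (fun x : R => 1 - x) k); [exact: c1|exact: ck].
    by apply: (@continuous_comp _ _ _ (fun x : R => 1 - x) h); [exact: c1|exact: ch].
  rewrite /k (min_r (_ : 1 <= 1 - x)); last by lra.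
  by rewrite max_l ?subrr ?mul0r.
exists (fun x => r1 x - r2 (1 - x)) => x.
have d3 : is_derive x (1 : R) (fun x => r2 (1 - x)) (((1 - k x) * h x) * -1).
  have e : 1 - (1 - x) = x by ring.
  have := d2 (1 - x); rewrite e => d2'.
  apply: (@is_derive_comp _ _ (fun x : R => 1 - x) r2) => //.
  have -> : (fun x : R => 1 - x) = cst 1 - id by [].
  by apply: is_derive_eq; rewrite sub0r.
have := is_deriveB (d1 x) d3.
by rewrite mulrN1 opprK -mulrDl [k x + _]addrC subrK mul1r.
Qed.

End Primitive.

(** * The cutoff of the inverse *)

Section InverseCutoff.
Variables (R : realType) (c : R).
Hypothesis c0 : 0 < c.
Let a := c ^+ 2.
Let a0 : 0 < a. Proof. by rewrite /a exprn_gt0. Qed.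

(* The C^1 extension of x |-> 1 / x from [c ^ 2, +oo[ by its tangent at c ^ 2. *)
Definition cutinv (x : R) : R := if x < c ^+ 2 then (2 * c ^+ 2 - x) / (c ^+ 2) ^+ 2 else x^-1.
Definition cutinv' (x : R) : R := - (Num.max x (c ^+ 2)) ^- 2.

Let sq_pos (x : R) : 0 <= x * x. Proof. by rewrite -expr2 sqr_ge0. Qed.

Lemma is_derive_cutinv (x : R) : is_derive x (1 : R) cutinv (cutinv' x).
Proof.
(* The remainder vanishes when both points lie below [a], and is at most [(y - x)^2 / a^3] when
   [y >= a]. The factor 2 comes from the remaining case [y < a <= x]. *)
apply: (@is_derive_quad _ _ _ _ (2 / a ^+ 3)) => h.
have [y ->] : exists y, h = y - x by exists (h + x); rewrite addrK.
rewrite subrK /cutinv /cutinv' -/a.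
have [xa|ax] := ltP x a; have [ya|ay] := ltP y a.
- rewrite [X in `|X| <= _](_ : _ = 0); first by rewrite normr0 mulr_ge0 ?sqr_ge0// divr_ge0// exprn_ge0// ltW.
  by field; rewrite gt_eqF.
- have y0 := lt_le_trans a0 ay.
  rewrite [X in `|X| <= _](_ : _ = (y - a) ^+ 2 / (a ^+ 2 * y)); last first.
    by field; rewrite !gt_eqF.
  rewrite ger0_norm; last by rewrite divr_ge0 ?sqr_ge0// mulr_ge0 ?sqr_ge0// ltW.
  rewrite mulrC; apply: ler_pM.
  + by rewrite invr_ge0 mulr_ge0 ?sqr_ge0// ltW.
  + exact: sqr_ge0.
  + apply: (le_trans (y := (a ^+ 3)^-1)).
      by rewrite lef_pV2 ?posrE ?mulr_gt0 ?exprn_gt0// exprSr ler_pM2l// exprn_gt0.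
    by rewrite ler_peMl ?invr_ge0 ?exprn_ge0 ?ltW// ltr1n.
  + by rewrite lerXn2r ?nnegrE; lra.
- have x0 := lt_le_trans a0 ax.
  rewrite [X in `|X| <= _](_ : _ = (x - a) * (x * (a - y) + a * (x - y)) / (a ^+ 2 * x ^+ 2)); last first.
    by field; rewrite !gt_eqF.
  have s1 : 0 <= x - a by lra.
  have s2 : 0 < a - y by lra.
  have s3 : 0 <= x * (a - y) + a * (x - y).
    by apply: addr_ge0; apply: mulr_ge0; have := a0; lra.
  rewrite ger0_norm; last by apply: divr_ge0; apply: mulr_ge0; rewrite ?sqr_ge0.
  have -> : (y - x) ^+ 2 = (x - y) * (x - y) by ring.
  apply: (le_trans (y := (x - y) * (2 * x * (x - y)) / (a ^+ 2 * x ^+ 2))).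
    apply: ler_wpM2r; first by rewrite invr_ge0 mulr_ge0 ?sqr_ge0.
    apply: ler_pM => //; first by lra.
    have -> : 2 * x * (x - y) = x * (x - y) + x * (x - y) by ring.
    by apply: lerD; [rewrite ler_wpM2l ?(ltW x0)//; lra|rewrite ler_wpM2r//; lra].
  rewrite [leLHS](_ : _ = 2 / (a ^+ 2 * x) * ((x - y) * (x - y))); last first.
    by field; rewrite !gt_eqF.
  rewrite ler_wpM2r// ler_wpM2l// lef_pV2 ?posrE ?mulr_gt0 ?exprn_gt0//.
  by rewrite exprSr ler_pM2l// exprn_gt0.
- have x0 := lt_le_trans a0 ax; have y0 := lt_le_trans a0 ay.
  rewrite [X in `|X| <= _](_ : _ = (y - x) ^+ 2 / (x ^+ 2 * y)); last first.
    by field; rewrite !gt_eqF.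
  rewrite ger0_norm; last by rewrite divr_ge0 ?sqr_ge0// mulr_ge0 ?sqr_ge0// ltW.
  rewrite mulrC ler_wpM2r ?sqr_ge0//.
  apply: (le_trans (y := (a ^+ 3)^-1)).
    rewrite lef_pV2 ?posrE ?mulr_gt0 ?exprn_gt0// exprSr.
    apply: ler_pM => //; [exact: sqr_ge0|exact: ltW|].
    by apply: lerXn2r => //; rewrite nnegrE ltW.
  by rewrite ler_peMl ?invr_ge0 ?exprn_ge0 ?ltW// ltr1n.
Qed.

Lemma continuous_cutinv' : continuous cutinv'.
Proof.
move=> x; apply: cvgN.
have m0 : Num.max x (c ^+ 2) != 0 by rewrite gt_eqF// lt_max a0 orbT.
apply: cvgV; first by rewrite expf_neq0.
apply: (@continuous_comp _ _ _ (fun x => Num.max x (c ^+ 2)) (fun y => y ^+ 2)).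
  by apply: lipschitz_bound_continuous; exact: max_lipschitz.
exact: exprn_continuous.
Qed.

Lemma cutinv'_le x : `|cutinv' x| <= a ^- 2.
Proof.
have m0 : 0 < Num.max x a by rewrite lt_max a0 orbT.
rewrite /cutinv' -/a normrN ger0_norm ?invr_ge0 ?sqr_ge0//.
rewrite lef_pV2 ?posrE ?exprn_gt0//; apply: lerXn2r; rewrite ?nnegrE ?(ltW a0) ?(ltW m0)//.
by rewrite le_max lexx orbT.
Qed.

Lemma cutinv_ge0 x : 0 <= x -> 0 <= cutinv x.
Proof.
move=> x0; rewrite /cutinv -/a; case: ltP => xa; last by rewrite invr_ge0.
by rewrite divr_ge0 ?sqr_ge0//; lra.
Qed.

Lemma cutinv_le x : 0 <= x -> cutinv x <= 2 / a.
Proof.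
move=> x0; rewrite /cutinv -/a; case: ltP => xa.
  rewrite ler_pdivrMr ?exprn_gt0// (_ : 2 / a * a ^+ 2 = 2 * a); first lra.
  by field; rewrite gt_eqF.
apply: (le_trans (y := a^-1)); first by rewrite lef_pV2 ?posrE// (lt_le_trans a0).
by rewrite ler_peMl ?invr_ge0 ?ltW// ltr1n.
Qed.

(** The tangent makes the growth linear on the negative half-line. The constant is shared with
    [cutinv'_growth] because [c1_comp] takes a single bound for a function and its derivative. *)
Lemma cutinv_growth x : `|cutinv x| <= (2 / a + a ^- 2) * (1 + `|x|).
Proof.
have a2 : 0 <= a ^- 2 by rewrite invr_ge0 sqr_ge0.
have a1 : 0 <= 2 / a by rewrite divr_ge0// ltW.
rewrite /cutinv -/a; case: ltP => xa.
  have h : `|2 * a - x| <= 2 * a + `|x|.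
    by rewrite (le_trans (ler_normB _ _))// ger0_norm// mulr_ge0// ltW.
  rewrite normrM [`|(a ^+ 2)^-1|]ger0_norm//.
  apply: (le_trans (ler_wpM2r a2 h)).
  rewrite (_ : (2 * a + `|x|) / a ^+ 2 = 2 / a + `|x| * a ^- 2).
    by have := normr_ge0 x; nra.
  by field; rewrite gt_eqF.
have x0 := lt_le_trans a0 xa.
rewrite ger0_norm ?invr_ge0 ?(ltW x0)//.
apply: (le_trans (y := 2 / a)); last by have := normr_ge0 x; nra.
apply: (le_trans (y := a^-1)); first by rewrite lef_pV2.
by rewrite ler_peMl ?invr_ge0 ?ltW// ltr1n.
Qed.

Lemma cutinv'_growth x : `|cutinv' x| <= (2 / a + a ^- 2) * (1 + `|x|).
Proof.
have a2 : 0 <= a ^- 2 by rewrite invr_ge0 sqr_ge0.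
have a1 : 0 <= 2 / a by rewrite divr_ge0// ltW.
by rewrite (le_trans (cutinv'_le x))//; have := normr_ge0 x; nra.
Qed.

(** This absorbs the factor [|DG|^2] of [<D|DG|^2, DG>], so that only [|D^2 G|] remains to be
    controlled. *)
Lemma mul_cutinv'_le x : 0 <= x -> x * `|cutinv' x| <= a^-1.
Proof.
move=> x0; rewrite /cutinv' -/a.
have m0 : 0 < Num.max x a by rewrite lt_max a0 orbT.
rewrite normrN ger0_norm ?invr_ge0 ?sqr_ge0// ler_pdivrMr ?exprn_gt0//.
rewrite expr2 mulrA; apply: (le_trans (y := 1 * Num.max x a)).
  by rewrite mul1r le_max lexx.
rewrite ler_wpM2r ?(ltW m0)// ler_pdivlMl// mulr1.
by rewrite le_max lexx orbT.
Qed.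

(** Meant for [y = |DG|]: it makes [cutinv (|DG|^2) <DF - DG, DG>] a bounded multiple of
    [|DF - DG|]. *)
Lemma norm_mul_cutinv_le y : 0 <= y -> y * cutinv (y ^+ 2) <= 2 / c.
Proof.
move=> y0; have [yc|cy] := ltP y c.
  apply: (le_trans (y := c * (2 / a))).
    by rewrite ler_pM ?cutinv_ge0 ?sqr_ge0 ?(ltW yc)// cutinv_le ?sqr_ge0.
  by rewrite /a le_eqVlt; apply/orP; left; apply/eqP; field; rewrite gt_eqF.
have y1 := lt_le_trans c0 cy.
rewrite /cutinv ltNge lerXn2r ?nnegrE ?(ltW c0) ?(ltW y1)//=.
rewrite (_ : y * _ = y^-1); last by field; rewrite gt_eqF.
apply: (le_trans (y := c^-1)); first by rewrite lef_pV2.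
by rewrite ler_peMl ?invr_ge0 ?ltW// ltr1n.
Qed.

(** The factor that the cutoff leaves in front of [h(F) - h(G)], with [y = |DG|]. It equals 1 as
    soon as [y >= c], so inserting it changes nothing for the limit variable, and it is Lipschitz on
    the half-line, so it passes to approximations in L^1. *)
Definition cutweight (y : R) : R := y ^+ 2 * cutinv (y ^+ 2).

Lemma cutweight1 y : c <= y -> cutweight y = 1.
Proof.
move=> cy; have y1 := lt_le_trans c0 cy.
rewrite /cutweight /cutinv ltNge lerXn2r ?nnegrE ?(ltW c0) ?(ltW y1)//=.
by rewrite divff// expf_neq0// gt_eqF.
Qed.

(** Below [c] the definition reads [2 s^2 - s^4] with [s = y / c], and [s = 1] gives the constant
    value above [c]. The bounds that follow then concern a polynomial on [0, 1]. *)
Let cutweightE y : 0 <= y -> cutweight y = 1 - (1 - (Num.min y c / c) ^+ 2) ^+ 2.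
Proof.
move=> y0; have [yc|cy] := leP c y.
  by rewrite cutweight1// divff ?gt_eqF// expr1n subrr expr0n subr0.
have c2 : y ^+ 2 < c ^+ 2 by rewrite ltrXn2r// ?nnegrE ltW.
rewrite /cutweight /cutinv c2;
by field; rewrite gt_eqF.
Qed.

Let min_ratio y : 0 <= y -> 0 <= Num.min y c / c <= 1.
Proof.
move=> y0; rewrite divr_ge0 ?le_min ?y0 ?(ltW c0)//=.
by rewrite ler_pdivrMr// mul1r ge_min lexx orbT.
Qed.

Lemma cutweight_norm_le1 y : 0 <= y -> `|cutweight y| <= 1.
Proof.
move=> y0; rewrite cutweightE//; have := min_ratio y0; move: (_ / c) => s s01.
have s2 : 0 <= 1 - s ^+ 2 <= 1 by rewrite expr2; nra.
rewrite ger0_norm; move: s2; move: (1 - s ^+ 2) => u u01; rewrite expr2; nra.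
Qed.

(** In the variables [s], [t] of [cutweightE] the difference is [(s - t) (s + t) (2 - s^2 - t^2)].
    Each of the last two factors is at most 2, and [s] is a [1 / c]-Lipschitz function of [y]. *)
Lemma cutweight_lipschitz y z : 0 <= y -> 0 <= z ->
  `|cutweight y - cutweight z| <= 4 / c * `|y - z|.
Proof.
move=> y0 z0; rewrite !cutweightE//.
have my := min_ratio y0; have mz := min_ratio z0.
have : `|Num.min y c / c - Num.min z c / c| <= c^-1 * `|y - z|.
  rewrite -mulrBl normrM [`|c^-1|]ger0_norm ?invr_ge0 ?(ltW c0)// mulrC.
  rewrite ler_wpM2l ?invr_ge0 ?(ltW c0)//.
  by rewrite -[leRHS]mul1r min_lipschitz.
rewrite -[4 / c * _]mulrA.
move: (Num.min y c / c) (Num.min z c / c) (c^-1 * `|y - z|) my mz => s t u s01 t01 stu.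
rewrite [X in `|X| <= _](_ : _ = (s - t) * ((s + t) * (2 - s ^+ 2 - t ^+ 2))); last by ring.
rewrite normrM [4 * u]mulrC ler_pM//.
have st0 : 0 <= s * s by exact: sq_pos.
have tt0 : 0 <= t * t by exact: sq_pos.
rewrite ger0_norm !expr2; nra.
Qed.

End InverseCutoff.

(** Induction on the number of coordinates: the indicator of the last interval is moved into the
    weight. That the new weight still kills the cosines of the first [n] coordinates is the
    one-variable statement [ray_of_cos] for the weight [cos (S w) * A w], compared with the zero
    weight; an interval is then a difference of two rays. *)
Lemma box_of_cos d (T : measurableType d) (R : realType)
    (mu : {measure set T -> \bar R}) n (A : T -> R) (Y : 'I_n -> T -> R) :
  L1 mu A -> (forall i, measurable_fun setT (Y i)) ->
  (forall (t : nat -> R) b,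
    \int[mu]_w (A w * cos (\sum_(i < n) t i * Y i w + b)) = 0) ->
  forall a b : 'I_n -> R,
    \int[mu]_w (A w * \prod_(i < n) (a i <= Y i w < b i)%R%:R) = 0.
Proof.
elim: n A Y => [|n IH] A Y iA mY Acos a b.
  rewrite -[RHS](Acos (fun=> 0) 0); apply: eq_Rintegral => w _.
  by rewrite !big_ord0 addr0 cos0.
have mi : measurable_fun setT
    (fun w => (a ord_max <= Y ord_max w < b ord_max)%R%:R : R).
  rewrite (_ : (fun w => _) = fun w => (Y ord_max w < b ord_max)%R%:R *
      (1 - (Y ord_max w < a ord_max)%R%:R)).
    apply: measurable_funM; first exact: measurable_lt_natr.
    by apply: measurable_funB => //; exact: measurable_lt_natr.
  apply/funext => w; rewrite leNgt; do 2 case: (_ < _) => /=; lra.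
transitivity (\int[mu]_w ((A w * (a ord_max <= Y ord_max w < b ord_max)%R%:R) *
    \prod_(i < n) (a (widen_ord (leqnSn n) i) <= Y (widen_ord (leqnSn n) i) w
       < b (widen_ord (leqnSn n) i))%R%:R)).
  by apply: eq_Rintegral => w _; rewrite big_ord_recr/=; ring.
apply: (IH _ (fun i => Y (widen_ord (leqnSn n) i))) => //.
  rewrite (_ : (fun w => _) = fun w =>
      (a ord_max <= Y ord_max w < b ord_max)%R%:R * A w).
    apply: (@L1M_bounded _ _ _ _ _ _ 1) => // w.
    by case: (_ && _); rewrite ?normr1 ?normr0.
  by apply/funext => w; rewrite mulrC.
move=> t c.
pose S w := \sum_(i < n) t i * Y (widen_ord (leqnSn n) i) w + c.
have mS : measurable_fun setT S.
  apply: measurable_funD => //; apply: measurable_sum => i.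
  exact: measurable_funM.
have mcos : measurable_fun setT (fun w => cos (S w)).
  apply: measurableT_comp => //; apply: continuous_measurable_fun.
  exact: continuous_cos.
have iB : L1 mu (fun w => cos (S w) * A w).
  by apply: (@L1M_bounded _ _ _ _ _ _ 1) => // w; exact: cos_max.
(* Frequencies are indexed by [nat], so that appending [s] for the last coordinate leaves the
   earlier ones in place. *)
pose e s k := if (k < n)%N then t k else s.
have eE s w : \sum_(i < n.+1) e s i * Y i w = S w - c + s * Y ord_max w.
  rewrite big_ord_recr/= /e ltnn /S addrK; congr (_ + _).
  by apply: eq_bigr => i _; rewrite /= ltn_ord.
have Bcos s g : \int[mu]_w ((cos (S w) * A w) * cos (s * Y ord_max w + g)) =
    \int[mu]_w (0 * cos (s * Y ord_max w + g)).
  transitivity (\int[mu]_w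
    (2^-1 * (A w * cos (\sum_(i < n.+1) e s i * Y i w + (c + g))) +
     2^-1 * (A w * cos (\sum_(i < n.+1) e (- s) i * Y i w + (c - g))))).
    apply: eq_Rintegral => w _; rewrite !eE.
    have -> : S w - c + s * Y ord_max w + (c + g) = S w + (s * Y ord_max w + g).
      by ring.
    have -> : S w - c + - s * Y ord_max w + (c - g) =
        S w - (s * Y ord_max w + g) by ring.
    by move: (S w) (s * _ + g) => x y; rewrite cosD cosB; field.
  have iC s' g' : L1 mu
      (fun w => A w * cos (\sum_(i < n.+1) e s' i * Y i w + g')).
    rewrite (_ : (fun w => _) = fun w =>
      cos (\sum_(i < n.+1) e s' i * Y i w + g') * A w); last first.
      by apply/funext => w; rewrite mulrC.
    apply: (@L1M_bounded _ _ _ _ _ _ 1) => //; last by move=> w; exact: cos_max.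
    apply: measurableT_comp.
      by apply: continuous_measurable_fun; exact: continuous_cos.
    apply: measurable_funD => //; apply: measurable_sum => i.
    exact: measurable_funM.
  rewrite (RintD (L1Z 2^-1 (iC s (c + g))) (L1Z 2^-1 (iC (- s) (c - g)))).
  rewrite !(RintZ _ (iC _ _)) !Acos.
  rewrite mulr0 addr0 -[LHS](Rint0 mu); apply: eq_Rintegral => w _.
  by rewrite mul0r.
have ray x : \int[mu]_w ((cos (S w) * A w) * (Y ord_max w < x)%R%:R) = 0.
  rewrite (@ray_of_cos _ _ _ _ _ mu mu _ _ (fun=> 0) _ iB (L1_0 mu)
    (mY ord_max) (mY ord_max))//.
  by rewrite -[RHS](Rint0 mu); apply: eq_Rintegral => w _; rewrite mul0r.
have iD x : L1 mu (fun w => (cos (S w) * A w) * (Y ord_max w < x)%R%:R).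
  rewrite (_ : (fun w => _) = fun w =>
      (Y ord_max w < x)%R%:R * (cos (S w) * A w)).
    apply: (@L1M_bounded _ _ _ _ _ _ 1) => //.
      by apply: measurable_lt_natr.
    by move=> w; case: (_ < _); rewrite ?normr1 ?normr0.
  by apply/funext => w; rewrite mulrC.
have [ab|ba] := leP (a ord_max) (b ord_max).
  transitivity (\int[mu]_w (
     (cos (S w) * A w) * (Y ord_max w < b ord_max)%R%:R -
     (cos (S w) * A w) * (Y ord_max w < a ord_max)%R%:R)).
    apply: eq_Rintegral => w _; rewrite -/(S w).
    have [ya|ya] := ltP (Y ord_max w) (a ord_max).
      by rewrite (lt_le_trans ya ab)/=; ring.
    by rewrite /=; ring.
  by rewrite RintB// !ray subrr.
rewrite -[RHS](Rint0 mu); apply: eq_Rintegral => w _.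
have -> : (a ord_max <= Y ord_max w < b ord_max) = false.
  by apply/negbTE/negP => /andP[h /(le_lt_trans h)]; rewrite ltNge ltW.
by rewrite mulr0 mul0r.
Qed.

(** * Grid discretization of functions measurable in one argument and continuous in the other *)

Section Discretization.
Context d (T : measurableType d) (R : realType) (n : nat).
Variables (Y : 'I_n -> T -> R) (Q : T -> ('I_n -> R) -> R).
Hypothesis mY : forall i, measurable_fun setT (Y i).
Hypothesis mQ : forall y, measurable_fun setT (Q ^~ y).
Hypothesis cQ : forall w (z : nat -> 'I_n -> R),
  (forall i, z m i @[m --> \oo] --> Y i w) ->
  Q w (z m) @[m --> \oo] --> Q w (Y ^~ w).

Let grid m (k : nat) : R := k%:R / m.+1%:R - m.+1%:R.
Let box m (k : {ffun 'I_n -> 'I_(m.+1 * m.+1 * 2)}) w : R := \prod_(i < n)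
  (grid m (k i) <= Y i w < grid m (k i) + m.+1%:R^-1)%R%:R.
Let pt m (k : {ffun 'I_n -> 'I_(m.+1 * m.+1 * 2)}) i : R := grid m (k i).
(* [Q w] at [Y w] rounded down to the grid of step 1 / (m + 1); it is 0 where [Y]
   leaves the cube [-m - 1, m + 1[ ^ n. *)
Let disc m w :=
  \sum_(k : {ffun 'I_n -> 'I_(m.+1 * m.+1 * 2)}) Q w (pt k) * box k w.

Let in_box m (k : {ffun 'I_n -> 'I_(m.+1 * m.+1 * 2)}) w := [forall i,
  grid m (k i) <= Y i w < grid m (k i) + m.+1%:R^-1].

Let boxE m (k : {ffun 'I_n -> 'I_(m.+1 * m.+1 * 2)}) w :
  box k w = (in_box k w)%:R.
Proof.
rewrite /box /in_box; case: forallP => h.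
  by apply: big1 => i _; rewrite h.
have [i hi] : exists i, ~~ (grid m (k i) <= Y i w < grid m (k i) + m.+1%:R^-1).
  by apply/existsP; rewrite -negb_forall; apply/forallP.
by rewrite (bigD1 i)//= (negbTE hi) mul0r.
Qed.

Let in_box_inj m (k l : {ffun 'I_n -> 'I_(m.+1 * m.+1 * 2)}) w :
  in_box k w -> in_box l w -> k = l.
Proof.
move=> /forallP hk /forallP hl; apply/ffunP => i.
have := hk i; have := hl i; rewrite /grid => /andP[a b] /andP[e f].
have m0 : 0 < m.+1%:R :> R by rewrite ltr0n.
have lt1 (p q : nat) : p%:R / m.+1%:R - m.+1%:R <= Y i w ->
    Y i w < q%:R / m.+1%:R - m.+1%:R + m.+1%:R^-1 -> (p <= q)%N.
  move=> h /(le_lt_trans h); rewrite -addrA [- _ + _]addrC addrA ltrD2r.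
  rewrite -[X in _ + X]mul1r -mulrDl ltr_pM2r ?invr_gt0//.
  by rewrite natr1 ltr_nat ltnS.
by apply/val_inj/eqP; rewrite eqn_leq (lt1 _ _ a f) (lt1 _ _ e b).
Qed.

(** Half-open boxes are disjoint, so at most one term of the sum survives. This holds for every [m],
    also where [Y] leaves the cube, and provides the domination. *)
Let disc_cases m w : disc m w = 0 \/
  exists y : 'I_n -> R, (forall i, `|y i - Y i w| <= m.+1%:R^-1) /\
    disc m w = Q w y.
Proof.
have [k hk|none] := pickP (fun k : {ffun 'I_n -> 'I_(m.+1 * m.+1 * 2)} =>
  in_box k w).
  right; exists (pt k); split.
    move=> i; have /forallP/(_ i)/andP[a b] := hk.
    by rewrite /= distrC ger0_norm ?subr_ge0// lerBlDl ltW.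
  rewrite /disc (bigD1 k)//= boxE hk mulr1 big1 ?addr0// => l lk.
  rewrite boxE; case: (boolP (in_box l w)) => [hl|]; last by rewrite mulr0.
  by rewrite (in_box_inj hl hk) eqxx in lk.
by left; rewrite /disc big1// => k _; rewrite boxE none mulr0.
Qed.

(** The index of the cell is the integer part of [(Y + m + 1) (m + 1)], which stays below
    [2 (m + 1)^2] because [|Y| < m + 1]. *)
Let disc_good m w : (forall i, `|Y i w| < m.+1%:R) ->
  exists y : 'I_n -> R, (forall i, `|y i - Y i w| <= m.+1%:R^-1) /\
    disc m w = Q w y.
Proof.
move=> Ym; have m0 : 0 < m.+1%:R :> R by rewrite ltr0n.
have kP i : (Num.truncn ((Y i w + m.+1%:R) * m.+1%:R) < m.+1 * m.+1 * 2)%N.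
  have := Ym i; rewrite ltr_norml => /andP[a b].
  rewrite -(ltr_nat R); apply: (@le_lt_trans _ _ ((Y i w + m.+1%:R) * m.+1%:R)).
    by rewrite Num.Theory.truncn_le mulr_ge0//; lra.
  by rewrite !natrM mulrAC; rewrite ltr_pM2r//; lra.
pose k := [ffun i => Ordinal (kP i)].
have hk : in_box k w.
  apply/forallP => i; rewrite ffunE /grid /=.
  have := Ym i; rewrite ltr_norml => /andP[a b].
  have h0 : 0 <= (Y i w + m.+1%:R) * m.+1%:R by rewrite mulr_ge0//; lra.
  have /andP[] := Num.Theory.truncn_itv h0.
  set t := Num.truncn _; rewrite -[t.+1%:R]natr1 => t1 t2.
  rewrite lerBlDr ler_pdivrMr// t1/=.
  rewrite -addrA [- _ + _]addrC addrA ltrBrDr.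
  rewrite -[X in _ < _ + X]mul1r -mulrDl.
  by rewrite ltr_pdivlMr.
exists (pt k); split.
  move=> i; have /forallP/(_ i)/andP[a b] := hk.
  by rewrite /= distrC ger0_norm ?subr_ge0// lerBlDl ltW.
rewrite /disc (bigD1 k)//= boxE hk mulr1 big1 ?addr0// => l lk.
rewrite boxE; case: (boolP (in_box l w)) => [hl|]; last by rewrite mulr0.
by rewrite (in_box_inj hl hk) eqxx in lk.
Qed.

Let measurable_box m (k : {ffun 'I_n -> 'I_(m.+1 * m.+1 * 2)}) :
  measurable_fun setT (box k).
Proof.
apply: measurable_prod => i _.
rewrite (_ : (fun w => _) = fun w => (Y i w < grid m (k i) + m.+1%:R^-1)%R%:R *
    (1 - (Y i w < grid m (k i))%R%:R)).
  apply: measurable_funM; first exact: measurable_lt_natr.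
  by apply: measurable_funB => //; exact: measurable_lt_natr.
apply/funext => w; rewrite leNgt; do 2 case: (_ < _) => /=; lra.
Qed.

Let measurable_disc m : measurable_fun setT (disc m).
Proof.
by apply: measurable_sum => k; apply: measurable_funM.
Qed.

Let disc_cvg w : disc m w @[m --> \oo] --> Q w (Y ^~ w).
Proof.
(* A grid point that realizes [disc m w], with [Y] itself as default value; either way it is within
   [1 / (m + 1)] of [Y]. For large [m] the default does not occur, so [disc m w] is the value of
   [Q w] along a sequence tending to [Y]. *)
pose z m := if pselect (exists y : 'I_n -> R,
    (forall i, `|y i - Y i w| <= m.+1%:R^-1) /\ disc m w = Q w y) is left h
  then projT1 (cid h) else Y ^~ w.
have zP m i : `|z m i - Y i w| <= m.+1%:R^-1.
  rewrite /z; case: pselect => [h|_]; last by rewrite subrr normr0 invr_ge0.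
  by case: (projT2 (cid h)).
apply: cvg_trans (@cQ w z _); last first.
  move=> i; apply/cvgrPdist_le => e e0.
  have := near_infty_natSinv_lt (PosNum e0); apply: filterS => m /= me.
  by rewrite distrC (le_trans (zP m i))// ltW.
apply: near_eq_cvg; near=> m.
rewrite /z; case: pselect => [h|]; first by case: (projT2 (cid h)).
case; apply: disc_good => i.
have : (\sum_(j < n) `|Y j w|) < m.+1%:R.
  near: m; have := nbhs_infty_ger (\sum_(j < n) `|Y j w|).
  by apply: filterS => m /= /le_lt_trans; apply; rewrite ltr_nat.
by apply: le_lt_trans; rewrite (bigD1 i)//= lerDl sumr_ge0.
Unshelve. all: by end_near. Qed.

Lemma measurable_caratheodory : measurable_fun setT (fun w => Q w (Y ^~ w)).
Proof. by apply: measurable_fun_cvg measurable_disc _ => w _; exact: disc_cvg. Qed.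

Variables (mu : {measure set T -> \bar R}) (D : T -> R).
Hypothesis iD : L1 mu D.
Hypothesis QD : forall w y, (forall i, `|y i - Y i w| <= 1) -> `|Q w y| <= D w.
Hypothesis Qbox : forall (y a b : 'I_n -> R),
  \int[mu]_w (Q w y * \prod_(i < n) (a i <= Y i w < b i)%R%:R) = 0.
Hypothesis iQ : forall y, L1 mu (Q ^~ y).

(** Each discretization is a finite sum whose terms integrate to 0 by [Qbox]. Its points are within
    1 of [Y], so [D] dominates the whole sequence. *)
Lemma caratheodory_integral0 : \int[mu]_w Q w (Y ^~ w) = 0.
Proof.
apply: (Rint_lim_cst measurable_disc disc_cvg iD).
  move=> m w; have D0 : 0 <= D w.
    apply: (le_trans (normr_ge0 (Q w (Y ^~ w)))); apply: QD => i.
    by rewrite subrr normr0.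
  have [->|[y [yY ->]]] := disc_cases m w; first by rewrite normr0.
  by apply: QD => i; rewrite (le_trans (yY i))// invf_le1// ler1n.
move=> m; rewrite Rint_sum; first by apply: big1 => k _; exact: Qbox.
move=> k _; rewrite (_ : (fun w => _) = fun w => box k w * Q w (pt k)).
  apply: (@L1M_bounded _ _ _ _ _ _ 1) => //.
  by move=> w; rewrite boxE; case: (in_box _ _); rewrite ?normr1 ?normr0.
by apply/funext => w; rewrite mulrC.
Qed.

End Discretization.

(** * Gaussian variables *)

Section NormalDistribution.
Variables (R : realType) (s : R).
Hypothesis s0 : s != 0.
Local Notation leb := (@lebesgue_measure R).
Local Notation pdf := (normal_pdf 0 s).
Local Notation N := (normal_prob 0 s).

(** The Radon-Nikodym derivative of the normal law and [normal_pdf] have the same integral over each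
    measurable set, hence agree almost everywhere. *)
Let ge0_integral_normal (f : R -> \bar R) : (forall x, (0 <= f x)%E) ->
  measurable_fun setT f ->
  (\int[N]_x f x = \int[leb]_x (f x * (pdf x)%:E))%E.
Proof.
move=> f0 mf.
have dom := normal_prob_dominates 0 s.
rewrite -(Radon_Nikodym_SigmaFinite.change_of_variables dom f0)//.
apply: ae_eq_integral => //.
- apply: emeasurable_funM => //; apply: (measurable_int leb).
  exact: Radon_Nikodym_SigmaFinite.f_integrable.
- apply: emeasurable_funM => //; apply/measurable_EFinP.
  exact: measurable_normal_pdf.
- apply: ae_eqe_mul2l => /=; apply: integral_ae_eq => //=.
  + exact: Radon_Nikodym_SigmaFinite.f_integrable.
  + by apply/measurable_EFinP; exact: measurable_normal_pdf.
  + by move=> E _ mE; rewrite -Radon_Nikodym_SigmaFinite.f_integral.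
Qed.

Lemma L1_normal (f : R -> R) : measurable_fun setT f ->
  L1 leb (fun x => f x * pdf x) -> L1 N f.
Proof.
move=> mf /integrableP[_ lf]; apply/integrableP; split.
  exact/measurable_EFinP.
rewrite ge0_integral_normal//; last first.
  by apply: measurableT_comp => //; exact/measurable_EFinP.
rewrite (_ : (\int[leb]_x _)%E = (\int[leb]_x `|(f x * pdf x)%:E|)%E)//.
by apply: eq_integral => x _; rewrite /= normrM EFinM (ger0_norm (normal_pdf_ge0 _ _ _)).
Qed.

Lemma Rint_normal (f : R -> R) : measurable_fun setT f ->
  L1 leb (fun x => f x * pdf x) ->
  \int[N]_x f x = \int[leb]_x (f x * pdf x).
Proof.
move=> mf lf; have lN := L1_normal mf lf.
rewrite /Rintegral integralE [in RHS]integralE; congr (fine (_ - _)%E).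
  rewrite ge0_integral_normal//; last first.
    by apply: measurable_funepos; exact/measurable_EFinP.
  apply: eq_integral => x _; rewrite !funeposE/= -!EFin_max -EFinM.
  by rewrite maxr_pMl ?mul0r// normal_pdf_ge0.
rewrite ge0_integral_normal//; last first.
  by apply: measurable_funeneg; exact/measurable_EFinP.
apply: eq_integral => x _; rewrite !funenegE/= -!EFin_max -EFinM.
by rewrite maxr_pMl ?mul0r ?mulNr// normal_pdf_ge0.
Qed.

Lemma is_derive_normal_pdf (x : R) :
  is_derive x (1 : R) pdf (- x / s ^+ 2 * pdf x).
Proof.
have -> : pdf = (fun y => normal_peak s * expR (- (2 * s ^+ 2)^-1 * (y * y))).
  apply/funext => y; rewrite normal_pdfE// /normal_fun subr0 -mulr_natl expr2.
  by congr (_ * expR _); rewrite [RHS]mulrC !mulNr mulrN.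
set k := - (2 * s ^+ 2)^-1.
have d1 : is_derive x (1 : R) (fun y : R => k * (y * y)) (k * (x + x)).
  have -> : (fun y : R => k * (y * y)) = k \*: ((id : R -> R) * id) by [].
  by apply: is_derive_eq; rewrite /GRing.scale/= !mulr1.
have d2 := is_derive_comp d1 (is_derive_expR _).
have -> : (fun x0 => normal_peak s * expR (k * (x0 * x0))) =
  normal_peak s \*: (fun x0 => expR (k * (x0 * x0))) by [].
apply: is_derive_eq; rewrite /GRing.scale/= /k.
by field.
Qed.

(* The Gaussian density absorbs polynomials at the cost of a larger variance:
   1 + b x^2 <= exp (b x^2) with b = 1 / (4 k s^2). *)
Lemma normal_pdf_growth k : exists2 K, 0 <= K &
  forall x, (1 + `|x|) ^+ k * pdf x <= K * normal_pdf 0 (Num.sqrt 2 * s) x.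
Proof.
have s2 : 0 < s ^+ 2 by rewrite exprn_even_gt0.
pose b := (4 * k.+1%:R * s ^+ 2)^-1.
have b0 : 0 < b by rewrite invr_gt0 mulr_gt0// mulr_gt0// ltr0n.
have t0 : Num.sqrt 2 * s != 0 by rewrite mulf_neq0// sqrtr_eq0 -ltNge.
pose C := (2 * (1 + b^-1)) ^+ k.+1.
have C0 : 0 <= C by rewrite exprn_ge0// mulr_ge0// addr_ge0// invr_ge0 ltW.
exists (C * normal_peak s / normal_peak (Num.sqrt 2 * s)).
  by rewrite mulr_ge0 ?invr_ge0 ?normal_peak_ge0// mulr_ge0 ?normal_peak_ge0.
move=> x; rewrite !normal_pdfE// mulrA [leRHS]mulrA divfK; last first.
  by rewrite gt_eqF// normal_peak_gt0.
rewrite -![_ * normal_peak s]mulrC -!mulrA ler_wpM2l ?normal_peak_ge0//.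
have A : (1 + `|x|) ^+ k <= C * expR (k.+1%:R * (b * x ^+ 2)).
  rewrite /C expRM_natl -exprMn.
  apply: (le_trans (y := ((1 + `|x|) ^+ 2) ^+ k.+1)).
    by rewrite -exprM ler_weXn2l ?lerDl// mulSn mul1n addSn leqW// leq_addr.
  apply: lerXn2r; rewrite ?nnegrE ?sqr_ge0//.
    by rewrite mulr_ge0 ?expR_ge0// mulr_ge0// addr_ge0// invr_ge0 ltW.
  apply: (le_trans (y := 2 * (1 + x ^+ 2))).
    rewrite -[x ^+ 2]real_normK ?num_real//; have := sqr_ge0 (1 - `|x|).
    rewrite !expr2; nra.
  rewrite -mulrA ler_wpM2l//.
  apply: (le_trans (y := (1 + b^-1) * (1 + b * x ^+ 2))).
    have bb : b^-1 * b = 1 by rewrite mulVf// gt_eqF.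
    have : 0 <= b * x ^+ 2 by rewrite mulr_ge0 ?sqr_ge0// ltW.
    have : 0 <= b^-1 by rewrite invr_ge0 ltW.
    rewrite mulrDl mul1r mulrDr mulr1 mulrA bb mul1r; lra.
  rewrite ler_wpM2l ?expR_ge1Dx// addr_ge0// invr_ge0 ltW//.
apply: (le_trans (ler_wpM2r (normal_fun_ge0 _ _ _) A)).
rewrite -mulrA ler_wpM2l// /normal_fun -expRD subr0 ler_expR.
(* The polynomial costs half of the exponent [x^2 / (2 s^2)]; what is left is the exponent of the
   density of standard deviation [sqrt 2 * s]. *)
have kb : k.+1%:R * b = (4 * s ^+ 2)^-1.
  by rewrite /b mulrAC invfM mulrCA divff ?mulr1// pnatr_eq0.
rewrite mulrA kb exprMn sqr_sqrtr// !mulr2n.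
move: (s ^+ 2) (x ^+ 2) s2 => t y t0'.
rewrite le_eqVlt; apply/orP; left; apply/eqP.
by field; apply/and3P; split; rewrite gt_eqF//; lra.
Qed.

Lemma L1_normal_growth (f : R -> R) C k : measurable_fun setT f ->
  (forall x, `|f x| <= C * (1 + `|x|) ^+ k) -> L1 leb (fun x => f x * pdf x).
Proof.
move=> mf fC; have [K K0 KP] := normal_pdf_growth k.
have C0 : 0 <= C.
  by have := fC 0; rewrite normr0 addr0 expr1n mulr1; apply: le_trans.
apply: (@L1_le _ _ _ leb (fun x => f x * pdf x) (fun x => (C * K) * normal_pdf 0 (Num.sqrt 2 * s) x)).
- by apply: measurable_funM => //; exact: measurable_normal_pdf.
- move=> x; rewrite normrM (ger0_norm (normal_pdf_ge0 _ _ _)).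
  apply: (le_trans (ler_wpM2r (normal_pdf_ge0 _ _ _) (fC x))).
  by rewrite -!mulrA ler_wpM2l.
- by apply: L1Z; exact: integrable_normal_pdf.
Qed.

(** The product [F] of [f] and the density has derivative [f' pdf - s^-2 x f pdf]. The fundamental
    theorem on [[- n - 1, n + 1]] passes to the line by dominated convergence, and the boundary
    terms vanish because [(1 + |x|) |F x|] is bounded. *)
Lemma normal_ibp (f f' : R -> R) (C : R) k : (forall x, is_derive x (1 : R) f (f' x)) ->
  continuous f' ->
  (forall x, `|f x| <= C * (1 + `|x|) ^+ k) ->
  (forall x, `|f' x| <= C * (1 + `|x|) ^+ k) ->
  \int[N]_x (x * f x) = s ^+ 2 * \int[N]_x f' x.
Proof.
move=> fd cf' fC f'C.
have C0 : 0 <= C.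
  by have := fC 0; rewrite normr0 addr0 expr1n mulr1; apply: le_trans.
have cf := is_derive_continuous fd.
have mf := continuous_measurable_fun cf.
have mf' := continuous_measurable_fun cf'.
have mxf : measurable_fun setT (fun x : R => x * f x) by apply: measurable_funM.
have i' := L1_normal_growth mf' f'C.
have xfC (x : R) : `|x * f x| <= C * (1 + `|x|) ^+ k.+1.
  rewrite normrM exprS mulrCA; apply: ler_pM => //.
  by rewrite lerDr.
have ixf := L1_normal_growth mxf xfC.
rewrite !Rint_normal//.
pose F (x : R) := f x * pdf x.
pose F' (x : R) := f' x * pdf x - s ^- 2 * (x * f x * pdf x).
have dF (x : R) : is_derive x (1 : R) F (F' x).
  rewrite /F (_ : (fun x => f x * pdf x) = f * pdf)//.
  have := fd x; have := is_derive_normal_pdf x => dp df.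
  by apply: is_derive_eq; rewrite /GRing.scale/= /F'; field.
have cF := is_derive_continuous dF.
have cpdf := is_derive_continuous is_derive_normal_pdf.
have cF' : continuous F'.
  move=> x; apply: cvgB; first by apply: cvgM; [exact: cf'|exact: cpdf].
  apply: cvgMr; apply: cvgM; last exact: cpdf.
  by apply: cvgM; [exact: cvg_id|exact: cf].
have iF' : L1 leb F' by apply: L1B => //; exact: L1Z.
have [] := @cvg_Rint _ _ _ leb (fun n => F' \_ `[- n.+1%:R, n.+1%:R]) F'
    (fun x => `|F' x|).
- move=> n; apply/(measurable_restrictT F' (measurable_itv _)).
  by apply: measurable_funTS; exact: (L1_measurable iF').
- move=> x; apply: cvg_near_cst; near=> n; rewrite patchE ifT// inE/= in_itv/=.
  rewrite -ler_norml; near: n; have := nbhs_infty_ger `|x|.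
  by apply: filterS => n /= /le_trans; apply; rewrite ler_nat.
- exact: L1_norm.
- by move=> n x; rewrite patchE; case: ifP => //; rewrite normr0.
move=> _ c1.
have FTC n : \int[leb]_x (F' \_ `[- n.+1%:R, n.+1%:R]) x = F n.+1%:R - F (- n.+1%:R).
  rewrite -Rintegral_mkcond /Rintegral (@continuous_FTC2 _ F' F)//.
  - by rewrite (@lt_trans _ _ 0)// ?oppr_lt0 ltr0n.
  - exact: continuous_subspaceT.
  - split; first by move=> x _; case: (dF x).
      by apply: cvg_at_right_filter; exact: cF.
    by apply: cvg_at_left_filter; exact: cF.
  - by move=> x _; rewrite derive1E; case: (dF x).
have [K K0 KP] := normal_pdf_growth k.+1.
pose B := C * (K * normal_peak (Num.sqrt 2 * s)).
have t0 : Num.sqrt 2 * s != 0 by rewrite mulf_neq0// sqrtr_eq0 -ltNge.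
have FB x : (1 + `|x|) * `|F x| <= B.
  rewrite /F normrM (ger0_norm (normal_pdf_ge0 _ _ _)).
  apply: (le_trans (y := (1 + `|x|) * (C * (1 + `|x|) ^+ k * pdf x))).
    by rewrite ler_wpM2l ?addr_ge0// ler_wpM2r// normal_pdf_ge0.
  rewrite [leLHS](_ : _ = C * ((1 + `|x|) ^+ k.+1 * pdf x)); last first.
    by rewrite exprS; ring.
  rewrite /B ler_wpM2l//; apply: (le_trans (KP x)).
  by rewrite ler_wpM2l// normal_pdf_ub.
have F0 (u : nat -> R) : (forall n, `|u n| = n.+1%:R) -> F (u n) @[n --> \oo] --> 0.
  move=> uE; apply/norm_cvg0P.
  apply: (@squeeze_cvgr _ _ _ _ (fun=> 0) (fun n => B * harmonic n)).
  - apply: nearW => n; rewrite normr_ge0/= /harmonic/= ler_pdivlMr ?ltr0n//.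
    rewrite mulrC; apply: le_trans (FB (u n)).
    by rewrite ler_wpM2r// uE lerDr.
  - exact: cvg_cst.
  - by rewrite -[X in _ --> X](mulr0 B); apply: cvgMr; exact: cvg_harmonic.
have c2 : F n.+1%:R - F (- n.+1%:R) @[n --> \oo] --> (0 : R).
  rewrite -[X in _ --> X](subrr 0); apply: cvgB; apply: F0 => n.
    by rewrite ger0_norm.
  by rewrite normrN ger0_norm.
have : \int[leb]_x F' x = 0.
  rewrite -(cvg_lim _ c1)//; apply: cvg_lim => //.
  by under eq_fun do rewrite FTC.
rewrite /F' RintB//; last exact: L1Z.
rewrite RintZ// => /eqP; rewrite subr_eq0 => /eqP ->.
by rewrite mulrA divff ?mul1r// expf_neq0.
Unshelve. all: by end_near. Qed.

(** As a function of the frequency, the integral [phi] satisfies [phi' = - s^2 u phi] by integration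
    by parts, so [phi u exp (s^2 u^2 / 2)] is constant. The phase [b] covers sines as well. *)
Lemma normal_cos (t b : R) :
  \int[N]_x cos (t * x + b) = expR (- (s * t) ^+ 2 / 2) * cos b.
Proof.
have mcos u c : measurable_fun setT (fun x : R => cos (u * x + c)).
  apply: continuous_measurable_fun => x; apply: continuous_comp.
    by apply: cvgD; [apply: cvgMr; exact: cvg_id|exact: cvg_cst].
  exact: continuous_cos.
have msin u c : measurable_fun setT (fun x : R => sin (u * x + c)).
  apply: continuous_measurable_fun => x; apply: continuous_comp.
    by apply: cvgD; [apply: cvgMr; exact: cvg_id|exact: cvg_cst].
  exact: continuous_sin.
have icos u c : L1 N (fun x => cos (u * x + c)).
  by apply: (@L1_bounded _ _ _ N _ 1); [exact: mcos|move=> x; exact: cos_max].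
have i2 : L1 N (fun x => x ^+ 2).
  apply: L1_normal; first exact: measurable_funX.
  apply: (@L1_normal_growth _ 1 2); first exact: measurable_funX.
  by move=> x; rewrite mul1r normrX lerXn2r ?nnegrE// ?addr_ge0// lerDr.
have ixsin u c : L1 N (fun x => x * sin (u * x + c)).
  have mx : measurable_fun setT (fun x : R => x * sin (u * x + c)).
    exact: measurable_funM.
  apply: L1_normal => //; apply: (@L1_normal_growth _ 1 1) => // x.
  rewrite mul1r expr1 normrM (le_trans (ler_piMr _ (sin_max _)))//.
  by rewrite lerDr.
pose phi u := \int[N]_x cos (u * x + b).
have daff u (x : R) : is_derive x (1 : R) (fun x => u * x + b) u.
  rewrite (_ : (fun x => u * x + b) = u \*: (id : R -> R) + cst b)//.
  by apply: is_derive_eq; rewrite /GRing.scale/= mulr1 addr0.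
have ibp u : \int[N]_x (x * sin (u * x + b)) = s ^+ 2 * (u * phi u).
  rewrite (@normal_ibp _ (fun x => cos (u * x + b) * u) (`|u| + 1) 0).
  - congr (_ * _); rewrite -RintZ//; apply: eq_Rintegral => x _; exact: mulrC.
  - move=> x; apply: cvgMl; apply: continuous_comp; last exact: continuous_cos.
    by apply: cvgD; [apply: cvgMr; exact: cvg_id|exact: cvg_cst].
  - by move=> x; rewrite expr0 mulr1 (le_trans (sin_max _))// lerDr.
  - move=> x; rewrite expr0 mulr1 normrM (le_trans (ler_piMl _ (cos_max _)))//.
    by rewrite lerDl.
have dphi u : is_derive u (1 : R) phi (- (s ^+ 2 * (u * phi u))).
  (* Differentiation under the integral: the pointwise Taylor remainder of the cosine is at most
     [(h x)^2], and [x^2] is integrable. *)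
  apply: (@is_derive_quad _ _ _ _ (\int[N]_x (x ^+ 2))) => h.
  rewrite -ibp /phi mulNr opprK -RintB// mulrC -RintZ// -RintD//; last 2 first.
  - exact: L1B.
  - exact: L1Z.
  apply: (le_trans (le_norm_Rint _)); first by apply: L1D; [exact: L1B|exact: L1Z].
  rewrite mulrC -RintZ//; apply: le_Rint.
  - by apply: L1_norm; apply: L1D; [exact: L1B|exact: L1Z].
  - exact: L1Z.
  move=> x; have := cos_taylor1 (u * x + b) (h * x).
  rewrite mul1r exprMn; apply: le_trans; rewrite le_eqVlt; apply/orP; left.
  apply/eqP; congr `| _ |; rewrite mulrDl -!addrA; congr (_ + _).
  ring.
pose g u := phi u * expR (s ^+ 2 / 2 * (u * u)).
have dg u : is_derive u (1 : R) g 0.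
  have d1 : is_derive u (1 : R) (fun y : R => s ^+ 2 / 2 * (y * y)) (s ^+ 2 * u).
    have -> : (fun y : R => s ^+ 2 / 2 * (y * y)) =
        (s ^+ 2 / 2) \*: ((id : R -> R) * id) by [].
    by apply: is_derive_eq; rewrite /GRing.scale/= !mulr1; field.
  have d2 := is_derive_comp d1 (is_derive_expR _).
  rewrite /g (_ : (fun u => _) = phi * (fun y => expR (s ^+ 2 / 2 * (y * y))))//.
  by apply: is_derive_eq; rewrite /GRing.scale/=; ring.
have phi0 : phi 0 = cos b.
  rewrite /phi; under eq_Rintegral do rewrite mul0r add0r.
  exact: Rint_cst.
have := derive0_cst dg t 0; rewrite /g phi0 !mulr0 expR0 mulr1 => gt.
pose A := s ^+ 2 / 2 * (t * t).
rewrite -/(phi t) (_ : phi t = phi t * expR A * expR (- A)); last first.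
  by rewrite -mulrA -expRD subrr expR0 mulr1.
rewrite gt mulrC; congr (expR _ * _); rewrite /A.
by rewrite exprMn expr2; field.
Qed.

End NormalDistribution.

Lemma measurable_cosD d (T : measurableType d) (R : realType) (Y : T -> R) b :
  measurable_fun setT Y -> measurable_fun setT (fun w => cos (Y w + b)).
Proof.
move=> mY; apply: measurableT_comp; last exact: measurable_funD.
by apply: continuous_measurable_fun; exact: continuous_cos.
Qed.

Section Law.
Context d (Omega : measurableType d) (R : realType) (P : probability Omega R).

Lemma exists_rv (X : Omega -> R) : measurable_fun setT X ->
  exists X' : {RV P >-> measurableTypeR R}, forall w, X' w = X w.
Proof.
move=> mX; pose c := isMeasurableFun.Build _ _ _ (measurableTypeR R) X mX.
by exists (HB.pack_for {mfun Omega >-> measurableTypeR R} X c).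
Qed.

Lemma law_integral (m : probability (measurableTypeR R) R) (X : Omega -> R) (f : R -> R) :
  measurable_fun setT X ->
  (forall A, measurable A -> P (X @^-1` A) = m A) ->
  measurable_fun setT f -> L1 m f ->
  L1 P (fun w => f (X w)) /\ \int[P]_w f (X w) = \int[m]_x f x.
Proof.
move=> mX Xm mf lf; have [X' /funext X'E] := exists_rv mX.
have eqm g : (\int[distribution P X']_x g x = \int[m]_x g x)%E.
  by apply: eq_measure_integral => A mA _; apply: etrans (Xm A mA); rewrite -X'E.
have lX : L1 P (f \o X').
  apply/integrableP; split.
    by apply/measurable_EFinP; rewrite X'E; exact: (measurableT_comp mf).
  have := @ge0_integral_distribution _ _ _ _ _ P X' (fun x => `|(f x)%:E|)%E.
  move=> <-//; last by apply: measurableT_comp => //; exact/measurable_EFinP.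
  by rewrite eqm; case/integrableP : lf.
rewrite -X'E; split => //.
rewrite /Rintegral -eqm; congr fine.
apply/esym; apply: (@integral_distribution _ _ _ _ _ P X' (EFin \o f)) => //.
exact/measurable_EFinP.
Qed.

Lemma law_of_rays (m : probability (measurableTypeR R) R) (X : Omega -> R) :
  measurable_fun setT X ->
  (forall a, P (X @^-1` `]-oo, a[) = m `]-oo, a[%classic) ->
  forall A, measurable A -> P (X @^-1` A) = m A.
Proof.
move=> mX Xm A mA; have [X' /funext X'E] := exists_rv mX.
rewrite -X'E; apply: (@measure_unique _ R (measurableTypeR R) (@RGenInftyO.G R)
  (fun n => `]-oo, n%:R[%classic) _ _ _ _ (distribution P X') m) => //.
- exact: RGenInftyO.measurableE.
- move=> _ _ [x ->] [y ->]; exists (Order.min x y).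
  by apply/seteqP; split=> z /=; rewrite !in_itv/= lt_min => /andP.
- by move=> n; exists n%:R.
- apply/seteqP; split => // x _; exists (Num.truncn `|x|).+1 => //=.
  by rewrite in_itv/= (le_lt_trans (ler_norm x))// Num.Theory.truncnS_gt.
- by move=> _ [x ->]; apply: etrans (Xm x); rewrite -X'E.
- by move=> k; rewrite (le_lt_trans (probability_le1 _ _))// ?ltry.
Qed.

Lemma Rint_lt (X : Omega -> R) a : measurable_fun setT X ->
  P (X @^-1` `]-oo, a[) = (\int[P]_w (X w < a)%R%:R)%:E.
Proof.
move=> mX; have mA : measurable (X @^-1` `]-oo, a[).
  by rewrite -[_ @^-1` _]setTI; exact: mX.
transitivity (\int[P]_w (\1_(X @^-1` `]-oo, a[) w)%:E)%E.
  by rewrite integral_indic// setIT.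
rewrite L1_Efin; last first.
  apply: (@L1_bounded _ _ _ _ _ 1) => //.
  by move=> w; rewrite indicE; case: (_ \in _); rewrite ?normr1 ?normr0.
congr EFin; apply: eq_Rintegral => w _; rewrite indicE; congr (nat_of_bool _)%:R.
by apply/idP/idP; rewrite inE/= in_itv.
Qed.

End Law.

(** * Laws and moments of Wiener integrals *)

Section Wiener.
Context (R : realType) (H T : R) d (Omega : measurableType d).
Variables (P : probability Omega R) (W : R -> {RV P >-> R}).
Variables (V : fbm_hilbert H T) (I : V -> {RV P >-> R}).
Hypotheses (W_fbm : is_fbm H T W) (I_isom : is_wiener_isometry W I).

Lemma wiener0 : {ae P, forall w, I 0 w = 0}.
Proof.
have [_ Ilin _] := I_isom; have := Ilin 1 0 0.
apply: filterS => w; rewrite scaler0 addr0 mul1r => /eqP.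
by rewrite -subr_eq0 opprD addrA subrr add0r oppr_eq0 => /eqP.
Qed.

Lemma wienerZD a phi psi :
  {ae P, forall w, I (a *: phi + psi) w = a * I phi w + I psi w}.
Proof. by case: I_isom. Qed.

Lemma wienerZ a phi : {ae P, forall w, I (a *: phi) w = a * I phi w}.
Proof.
have := wienerZD a phi 0; rewrite addr0; apply: filterS2 wiener0 => w ->.
by rewrite addr0.
Qed.

Lemma wienerB phi psi : {ae P, forall w, I (phi - psi) w = I phi w - I psi w}.
Proof.
have := wienerZD (-1) psi phi; rewrite scaleN1r addrC.
by apply: filterS => w ->; rewrite mulN1r addrC.
Qed.

Lemma wiener_sum n (c : 'I_n -> R) (phi : 'I_n -> V) :
  {ae P, forall w, I (\sum_(i < n) c i *: phi i) w = \sum_(i < n) c i * I (phi i) w}.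
Proof.
elim: n c phi => [|n IH] c phi.
  by apply: filterS wiener0 => w; rewrite !big_ord0.
have := wienerZD (c ord_max) (phi ord_max)
  (\sum_(i < n) c (widen_ord (leqnSn n) i) *: phi (widen_ord (leqnSn n) i)).
apply: filterS2 (IH (fun i => c (widen_ord (leqnSn n) i))
  (fun i => phi (widen_ord (leqnSn n) i))) => w e1.
by rewrite !big_ord_recr/= -e1 addrC => ->; rewrite addrC.
Qed.

Lemma measurable_wiener phi : measurable_fun setT (I phi).
Proof. exact: measurable_funPT. Qed.

Lemma wiener_sqr phi : L1 P (fun w => I phi w ^+ 2) /\
  \int[P]_w (I phi w ^+ 2) = `|phi| ^+ 2.
Proof.
have [_ _ /(_ phi phi)] := I_isom; rewrite unlock hdot_norm => E.
have E' : (\int[P]_w (I phi w ^+ 2)%:E)%E = (`|phi| ^+ 2)%:E.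
  by rewrite -E; apply: eq_integral => w _; rewrite expr2.
split; last by rewrite /Rintegral E'.
apply: L1_ge0; [exact/measurable_funX/measurable_wiener|by move=> w; exact: sqr_ge0|].
by rewrite E' ltry.
Qed.

(** Integrating [|y| <= e / 2 + y^2 / (2 e)] turns the isometry into an L^1 bound and gives
    integrability at the same time. *)
Lemma wiener_norm_le phi e : 0 < e -> `|phi| <= e ->
  L1 P (fun w => `|I phi w|) /\ \int[P]_w `|I phi w| <= e.
Proof.
move=> e0 phie; have [i2 E2] := wiener_sqr phi.
have b w : `|I phi w| <= e / 2 + (2 * e)^-1 * I phi w ^+ 2.
  rewrite -subr_ge0 (_ : _ - _ = (2 * e)^-1 * (`|I phi w| - e) ^+ 2).
    by rewrite mulr_ge0 ?sqr_ge0// invr_ge0 mulr_ge0// ltW.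
  rewrite -[I phi w ^+ 2]real_normK ?num_real//.
  by field; rewrite gt_eqF.
have ib : L1 P (fun w => e / 2 + (2 * e)^-1 * I phi w ^+ 2).
  by apply: L1D; [exact: L1_cst|exact: L1Z].
have iI : L1 P (fun w => `|I phi w|).
  apply: L1_le ib; first by apply: measurableT_comp => //; exact: measurable_wiener.
  by move=> w; rewrite normr_id.
split => //; apply: (le_trans (le_Rint iI ib b)).
rewrite (RintD (L1_cst P _) (L1Z _ i2)) RintZ// Rint_cst E2.
have eE : e / 2 + (2 * e)^-1 * e ^+ 2 = e by field; rewrite gt_eqF.
rewrite -[leRHS]eE lerD2l ler_wpM2l ?invr_ge0 ?mulr_ge0// ?(ltW e0)//.
by rewrite lerXn2r ?nnegrE// ltW.
Qed.

Lemma step_indic t : t \in `[0, T] -> step_function T (\1_(`[0, t]) : R -> R).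
Proof.
move=> tT; exists 1%N, (fun=> 1), (fun=> t); split => //.
by apply/funext => x; rewrite big_ord1 mul1r.
Qed.

Lemma step_class0 : step_class V (fun=> 0) = 0.
Proof.
have s0 : step_function T (fun=> 0 : R).
  exists 0%N, (fun=> 0), (fun=> 0); split; first by case.
  by apply/funext => x; rewrite big_ord0.
have := step_class_linear V 1 s0 s0; rewrite scale1r.
under [X in step_class V X]eq_fun do rewrite mulr0 addr0.
by move=> /eqP; rewrite -subr_eq0 opprD addrA subrr add0r oppr_eq0 => /eqP.
Qed.

Lemma step_class_sum n (a t : 'I_n -> R) : (forall i, t i \in `[0, T]) ->
  step_class V (fun x => \sum_(i < n) a i * \1_(`[0, t i]) x) =
  \sum_(i < n) a i *: step_class V (\1_(`[0, t i])).
Proof.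
elim: n a t => [|n IH] a t tT.
  rewrite big_ord0 -step_class0; congr step_class.
  by apply/funext => x; rewrite big_ord0.
rewrite big_ord_recr/= addrC -(IH (fun i => a (widen_ord (leqnSn n) i))
  (fun i => t (widen_ord (leqnSn n) i)))// -step_class_linear.
- congr step_class; apply/funext => x.
  by rewrite big_ord_recr/= addrC.
- exact: step_indic.
- by exists n, (fun i => a (widen_ord (leqnSn n) i)),
    (fun i => t (widen_ord (leqnSn n) i)).
Qed.

(** For a step function the Wiener integral is almost surely a linear combination of values of [W],
    hence Gaussian by [is_fbm]. Its variance is read off from the isometry, not from [fbm_cov]; in
    the degenerate case both the variable and the norm vanish. *)
Lemma step_cos f b : step_function T f ->
  \int[P]_w cos (I (step_class V f) w + b) =
    expR (- `|step_class V f| ^+ 2 / 2) * cos b.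
Proof.
move=> [n [a [t [tT ->]]]]; set phi := step_class V _.
have phiE : phi = \sum_(i < n) a i *: step_class V (\1_(`[0, t i])).
  exact: step_class_sum.
pose X w := \sum_(i < n) a i * W (t i) w.
have XI : {ae P, forall w, I phi w = X w}.
  rewrite phiE.
  have : {ae P, forall w (i : 'I_n), I (step_class V (\1_(`[0, t i]))) w = W (t i) w}.
    by have [h _ _] := I_isom; apply: filter_forall => i; exact: h.
  apply: filterS2 (wiener_sum a (fun i => step_class V (\1_(`[0, t i])))) => w -> h.
  by apply: eq_bigr => i _; rewrite h.
have mX : measurable_fun setT X.
  by apply: measurable_sum => i; apply: measurable_funM => //; exact: measurable_funPT.
have [i2 E2] := wiener_sqr phi.
rewrite -E2 (@Rint_ae _ _ _ _ _ (fun w => cos (X w + b))); last 3 first.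
- by apply: measurable_cosD; exact: measurable_wiener.
- exact: measurable_cosD.
- by apply: filterS XI => w ->.
rewrite (@Rint_ae _ _ _ _ (fun w => I phi w ^+ 2) (fun w => X w ^+ 2)); last 3 first.
- by apply: measurable_funX; exact: measurable_wiener.
- exact: measurable_funX.
- by apply: filterS XI => w ->.
have [X0|[sigma s0 XN]] := W_fbm.1 n a t tT.
  rewrite (@Rint_ae _ _ _ _ _ (fun w => cos b)); last 3 first.
  - exact: measurable_cosD.
  - by [].
  - by apply: filterS X0 => w; rewrite -/(X w) => ->; rewrite add0r.
  rewrite (@Rint_ae _ _ _ _ (fun w => X w ^+ 2) (fun w => 0)); last 3 first.
  - exact: measurable_funX.
  - by [].
  - by apply: filterS X0 => w; rewrite -/(X w) => ->; rewrite expr0n.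
  by rewrite Rint_cst Rint0 oppr0 mul0r expR0 mul1r.
have mc : measurable_fun setT (fun x : R => cos (x + b)) by exact: measurable_cosD.
have ic : L1 (normal_prob 0 sigma) (fun x => cos (x + b)).
  by apply: (@L1_bounded _ _ _ _ _ 1) => // x; exact: cos_max.
have m2 : measurable_fun setT (fun x : R => x ^+ 2) by exact: measurable_funX.
have is2 : L1 (normal_prob 0 sigma) (fun x => x ^+ 2).
  apply: L1_normal => //; apply: (@L1_normal_growth _ _ _ _ 1 2) => // x.
  by rewrite mul1r normrX lerXn2r ?nnegrE// ?addr_ge0// lerDr.
have [_ ->] := @law_integral _ _ _ P (normal_prob 0 sigma) X _ mX XN mc ic.
have [_ ->] := @law_integral _ _ _ P (normal_prob 0 sigma) X _ mX XN m2 is2.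
have -> : \int[normal_prob 0 sigma]_x (x ^+ 2) = sigma ^+ 2.
  have := @normal_ibp _ _ s0 id (fun=> 1) 1 1.
  under eq_Rintegral do rewrite -expr2.
  rewrite Rint_cst mulr1; apply.
  - by move=> x; exact: cvg_cst.
  - by move=> x; rewrite mul1r expr1 lerDr.
  - by move=> x; rewrite mul1r expr1 normr1 lerDl.
have := normal_cos s0 1 b; rewrite mulr1 => <-.
by apply: eq_Rintegral => x _; rewrite mul1r.
Qed.

Lemma exists_step phi e : 0 < e ->
  exists2 f, step_function T f & `|phi - step_class V f| < e.
Proof.
move=> e0; have : closure (step_class V @` step_function T) phi.
  by rewrite step_class_dense.
move=> /(_ _ (nbhsx_ballx phi e e0)) [psi [[f sf <-]]].
by rewrite -ball_normE /=; exists f.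
Qed.

(** Both sides are continuous in [phi]: the left one because the cosine is 1-Lipschitz and
    [wiener_norm_le] controls the L^1 distance. Step functions are dense. *)
Lemma wiener_cos phi b :
  \int[P]_w cos (I phi w + b) = expR (- `|phi| ^+ 2 / 2) * cos b.
Proof.
have /choice [f fP] : forall n : nat, exists f, step_function T f /\
    `|phi - step_class V f| < n.+1%:R^-1.
  move=> n; have n0 : 0 < n.+1%:R^-1 :> R by rewrite invr_gt0.
  by have [f sf fe] := exists_step phi n0; exists f.
pose psi n := step_class V (f n).
have icos th : L1 P (fun w => cos (I th w + b)).
  apply: (@L1_bounded _ _ _ _ _ 1); first by apply: measurable_cosD; exact: measurable_wiener.
  by move=> w; exact: cos_max.
have c1 : \int[P]_w cos (I (psi n) w + b) @[n --> \oo] -->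
    \int[P]_w cos (I phi w + b).
  apply/cvgrPdist_le => e e0; near=> n.
  rewrite -RintB//; apply: (le_trans (le_norm_Rint _)); first exact: L1B.
  have pe : `|phi - psi n| <= e.
    by rewrite (le_trans (ltW (fP n).2))// ltW//; near: n; exact: (near_infty_natSinv_lt (PosNum e0)).
  have [iI Ie] := wiener_norm_le e0 pe.
  have m1 : measurable_fun setT (fun w => `|I phi w - I (psi n) w|).
    by apply: measurableT_comp => //; apply: measurable_funB; exact: measurable_wiener.
  have m2 : measurable_fun setT (fun w => `|I (phi - psi n) w|).
    by apply: measurableT_comp => //; exact: measurable_wiener.
  have E := wienerB phi (psi n).
  apply: le_trans Ie.
  have ae2 : {ae P, forall w, `|I (phi - psi n) w| = `|I phi w - I (psi n) w|}.
    by apply: filterS E => w ->.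
  rewrite (Rint_ae m2 m1 ae2); apply: le_Rint.
  - by apply: L1_norm; exact: L1B.
  - exact: L1_ae ae2 iI.
  move=> w; apply: (le_trans (cos_lipschitz _ _)).
  by rewrite mul1r opprD addrACA subrr addr0.
have c2 : \int[P]_w cos (I (psi n) w + b) @[n --> \oo] -->
    expR (- `|phi| ^+ 2 / 2) * cos b.
  under eq_fun => m do rewrite (step_cos b (fP m).1) -/(psi m).
  have cpsi : psi n @[n --> \oo] --> phi.
    apply/cvgrPdist_le => e e0; near=> n.
    rewrite (le_trans (ltW (fP n).2))// ltW//; near: n.
    exact: (near_infty_natSinv_lt (PosNum e0)).
  apply: cvgMl; apply: continuous_cvg; first exact: continuous_expR.
  apply: cvgMl; apply: cvgN; rewrite expr2.
  under eq_fun do rewrite expr2.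
  by apply: cvgM; apply: cvg_norm.
exact: cvg_unique c1 c2.
Unshelve. all: by end_near. Qed.

(** [wiener_cos] at [t *: phi] gives the cosine of every frequency, and agreement on cosines gives
    agreement on rays. *)
Lemma wiener_law phi : `|phi| != 0 ->
  forall A, measurable A -> P (I phi @^-1` A) = normal_prob 0 `|phi| A.
Proof.
move=> p0; apply: law_of_rays; first exact: measurable_wiener.
move=> a; rewrite Rint_lt; last exact: measurable_wiener.
have := @Rint_lt _ _ _ (normal_prob 0 `|phi|) id a (@measurable_id _ _ _).
rewrite preimage_id => ->; congr EFin.
have E : \int[P]_w (1 * (I phi w < a)%R%:R) =
    \int[normal_prob 0 `|phi|]_x (1 * (x < a)%R%:R); last first.
  move: E; under eq_Rintegral do rewrite mul1r.
  by move=> ->; apply: eq_Rintegral => x _; rewrite mul1r.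
apply: (@ray_of_cos _ _ _ _ _ P (normal_prob 0 `|phi|) (fun=> 1) (I phi)
  (fun=> 1) id (L1_cst _ _) (L1_cst _ _) (measurable_wiener _) (@measurable_id _ _ _)) => t b.
under eq_Rintegral do rewrite mul1r.
under [RHS]eq_Rintegral do rewrite mul1r.
rewrite normal_cos// exprMn.
have := wiener_cos (t *: phi) b; rewrite normrZ exprMn real_normK ?num_real//.
rewrite [t ^+ 2 * _]mulrC => <-; apply: Rint_ae.
- apply: measurableT_comp.
    by apply: continuous_measurable_fun; exact: continuous_cos.
  by apply: measurable_funD => //; apply: measurable_funM => //; exact: measurable_wiener.
- apply: measurableT_comp.
    by apply: continuous_measurable_fun; exact: continuous_cos.
  by apply: measurable_funD => //; exact: measurable_wiener.
- by apply: filterS (wienerZ t phi) => w ->.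
Qed.

Lemma wiener_moment phi k : L1 P (fun w => (1 + `|I phi w|) ^+ k).
Proof.
have mk : measurable_fun setT (fun x : R => (1 + `|x|) ^+ k).
  by apply/measurable_funX/measurable_funD => //; exact: measurable_normr.
have [p0|p0] := eqVneq `|phi| 0.
  apply: (@L1_ae _ _ _ _ (fun=> 1)) => //; last exact: L1_cst.
    by apply: (measurableT_comp mk); exact: measurable_wiener.
  have := wiener0; rewrite (normr0_eq0 p0); apply: filterS => w ->.
  by rewrite normr0 addr0 expr1n.
have iN : L1 (normal_prob 0 `|phi|) (fun x => (1 + `|x|) ^+ k).
  apply: L1_normal => //; apply: (@L1_normal_growth _ _ _ _ 1 k) => // x.
  by rewrite mul1r ger0_norm// exprn_ge0// addr_ge0.
by have [] := @law_integral _ _ _ P (normal_prob 0 `|phi|) _ _ (measurable_wiener phi) (wiener_law p0) mk iN.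
Qed.

End Wiener.

(** * Gaussian integration by parts *)

Section RowVectors.
Variables (R : realType) (n : nat).
Implicit Types (x y : 'rV[R]_n) (f g : 'rV[R]_n -> R).

Lemma row_norm_le x e : 0 <= e -> (forall i, `|x 0 i| <= e) -> `|x| <= e.
Proof.
move=> e0 xe; rewrite (mx_normrE x : `|x| = _); apply: bigmax_le => // -[i j] _ /=.
by rewrite ord1.
Qed.

Lemma coord_norm_le x i : `|x 0 i| <= `|x|.
Proof.
by rewrite (mx_normrE x : `|x| = _); apply/bigmax_geP; right => /=; exists (0, i).
Qed.

Lemma cvg_row (z : nat -> 'I_n -> R) (y : 'I_n -> R) :
  (forall i, z m i @[m --> \oo] --> y i) ->
  (\row_(i < n) z m i) @[m --> \oo] --> (\row_(i < n) y i).
Proof.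
move=> zy; apply/cvgrPdist_le => e e0.
have : \forall m \near \oo, forall i, `|y i - z m i| <= e.
  by apply: filter_forall => i; move/cvgrPdist_le : (zy i); apply.
apply: filterS => m h; apply: row_norm_le; first exact: ltW.
by move=> i; rewrite !mxE.
Qed.

(** The norm is the largest coordinate in absolute value, so one term of the sum already dominates.
    The summand 1 covers the null vector, the case [n = 0] included. *)
Lemma row_norm_expn x k : (1 + `|x|) ^+ k <= 1 + \sum_(i < n) (1 + `|x 0 i|) ^+ k.
Proof.
have s0 : 0 <= \sum_(i < n) (1 + `|x 0 i|) ^+ k.
  by apply: sumr_ge0 => i _; rewrite exprn_ge0// addr_ge0.
have [x0|x0] := eqVneq (mx_norm x) 0.
  by rewrite (x0 : `|x| = 0) addr0 expr1n lerDl.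
have [[i j] /= xij] := mx_norm_neq0 x0.
rewrite (xij : `|x| = _) ord1 (bigD1 j)//= [leRHS]addrCA lerDl addr_ge0//.
by apply: sumr_ge0 => l _; rewrite exprn_ge0// addr_ge0.
Qed.

(** The class of test functions: it is stable under sums, products and composition with continuous
    functions of linear growth, and its members are integrable along Gaussian vectors. *)
Definition pc f := continuous f /\ poly_growth f.

Lemma poly_growth_ge0 f : poly_growth f ->
  exists (C : R) (N : nat), 0 <= C /\ forall x, `|f x| <= C * (1 + `|x|) ^+ N.
Proof.
move=> [C [N fC]]; exists C, N; split => //.
by have := fC 0; rewrite normr0 addr0 expr1n mulr1; apply: le_trans.
Qed.

Lemma expn1D_ge1 x k : 1 <= (1 + `|x|) ^+ k.
Proof. by rewrite exprn_ege1// lerDl. Qed.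

Lemma expn1D_ge0 x k : 0 <= (1 + `|x|) ^+ k.
Proof. by rewrite exprn_ge0// addr_ge0. Qed.

Lemma expn1D_mono x k l : (k <= l)%N -> (1 + `|x|) ^+ k <= (1 + `|x|) ^+ l.
Proof. by move=> kl; rewrite ler_weXn2l ?lerDl. Qed.

Lemma poly_growthD f g : poly_growth f -> poly_growth g ->
  poly_growth (fun x => f x + g x).
Proof.
move=> /poly_growth_ge0[C [N [C0 fC]]] /poly_growth_ge0[D [M [D0 gD]]].
exists (C + D), (N + M)%N => x; rewrite (le_trans (ler_normD _ _))// mulrDl lerD//.
  by rewrite (le_trans (fC x))// ler_wpM2l// expn1D_mono// leq_addr.
by rewrite (le_trans (gD x))// ler_wpM2l// expn1D_mono// leq_addl.
Qed.

Lemma poly_growthM f g : poly_growth f -> poly_growth g ->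
  poly_growth (fun x => f x * g x).
Proof.
move=> /poly_growth_ge0[C [N [C0 fC]]] /poly_growth_ge0[D [M [D0 gD]]].
exists (C * D), (N + M)%N => x; rewrite normrM exprD mulrACA ler_pM//.
Qed.

Lemma poly_growth_cst c : poly_growth (fun _ : 'rV[R]_n => c).
Proof. by exists `|c|, 0%N => x; rewrite expr0 mulr1. Qed.

Lemma pc_cst c : pc (fun=> c).
Proof. by split; [exact: cst_continuous|exact: poly_growth_cst]. Qed.

Lemma pcD f g : pc f -> pc g -> pc (fun x => f x + g x).
Proof.
by move=> [cf pf] [cg pg]; split; [move=> x; exact: (continuousD (cf x) (cg x))|
  exact: poly_growthD].
Qed.

Lemma pcM f g : pc f -> pc g -> pc (fun x => f x * g x).
Proof.
by move=> [cf pf] [cg pg]; split; [move=> x; exact: (continuousM (cf x) (cg x))|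
  exact: poly_growthM].
Qed.

Lemma pcZ a f : pc f -> pc (fun x => a * f x).
Proof. by move=> pf; apply: pcM => //; exact: pc_cst. Qed.

Lemma pcB f g : pc f -> pc g -> pc (fun x => f x - g x).
Proof.
move=> pf pg; rewrite (_ : (fun x => _) = fun x => f x + (-1) * g x).
  by apply: pcD => //; exact: pcZ.
by apply/funext => x; rewrite mulN1r.
Qed.

Lemma pc_sum I (r : seq I) (Q : pred I) (f : I -> 'rV[R]_n -> R) :
  (forall i, Q i -> pc (f i)) -> pc (fun x => \sum_(i <- r | Q i) f i x).
Proof.
move=> pf; elim: r => [|i r IH].
  by rewrite (_ : (fun x => _) = fun=> 0); [exact: pc_cst|];
    apply/funext => x; rewrite big_nil.
rewrite (_ : (fun x => _) = fun x => (if Q i then f i x else 0) +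
   \sum_(i <- r | Q i) f i x).
  by apply: pcD => //; case: (boolP (Q i)) => Qi; [exact: (pf i Qi)|exact: pc_cst].
by apply/funext => x; rewrite big_cons; case: ifP => // _; rewrite add0r.
Qed.

Lemma pc_coord i : pc (fun x => x 0 i).
Proof.
split; first exact: coord_continuous.
by exists 1, 1%N => x; rewrite mul1r expr1 (le_trans (coord_norm_le x i))// lerDr.
Qed.

Lemma pc_bounded_comp (h : R -> R) f M : continuous h -> (forall y : R, `|h y| <= M) ->
  pc f -> pc (fun x => h (f x)).
Proof.
move=> ch hM [cf _]; split.
  by move=> x; apply: continuous_comp; [exact: cf|exact: ch].
by exists M, 0%N => x; rewrite expr0 mulr1.
Qed.

Lemma pc_lin_comp (h : R -> R) f M : continuous h ->
  (forall y : R, `|h y| <= M * (1 + `|y|)) -> pc f -> pc (fun x => h (f x)).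
Proof.
move=> ch hM [cf pf]; split.
  by move=> x; apply: continuous_comp; [exact: cf|exact: ch].
have M0 : 0 <= M.
  by have := hM 0; rewrite normr0 addr0 mulr1; apply: le_trans.
have [C [N [C0 fC]]] := poly_growth_ge0 pf.
exists (M * (1 + C)), N => x; rewrite (le_trans (hM _))// -mulrA ler_wpM2l//.
rewrite mulrDl mul1r lerD//; exact: expn1D_ge1.
Qed.

End RowVectors.

Section GaussianIntegrationByParts.
Context (R : realType) (H T : R) d (Omega : measurableType d).
Variables (P : probability Omega R) (W : R -> {RV P >-> R}).
Variables (V : fbm_hilbert H T) (I : V -> {RV P >-> R}).
Hypotheses (W_fbm : is_fbm H T W) (I_isom : is_wiener_isometry W I).
Variables (n : nat) (phi : 'I_n -> V).
Let X w := \row_(i < n) I (phi i) w.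
Let measurable_wiener psi : measurable_fun setT (I psi) := measurable_wiener I psi.

(** A case of the discretization in which [Q] does not depend on its first argument; no
    sigma-algebra on row vectors is involved. *)
Lemma measurable_gauss (f : 'rV[R]_n -> R) : continuous f ->
  measurable_fun setT (fun w => f (X w)).
Proof.
move=> cf; apply: (@measurable_caratheodory _ _ _ _ (fun i => I (phi i))
   (fun w y => f (\row_i y i))) => //.
by move=> w z zy; apply: continuous_cvg; [exact: cf|exact: cvg_row].
Qed.

Lemma L1_gauss_norm C k : L1 P (fun w => C * (1 + `|X w|) ^+ k).
Proof.
apply: L1Z.
apply: (@L1_le _ _ _ _ _ (fun w => 1 + \sum_(i < n) (1 + `|I (phi i) w|) ^+ k)).
- apply: (@measurable_gauss (fun x => (1 + `|x|) ^+ k)) => x.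
  apply: (@continuous_comp _ _ _ (fun y : 'rV[R]_n => 1 + `|y|) (fun z => z ^+ k)).
    by apply: continuousD; [exact: cst_continuous|exact: norm_continuous].
  exact: exprn_continuous.
- move=> w; rewrite ger0_norm ?expn1D_ge0// (le_trans (row_norm_expn _ _))//.
  by rewrite lerD2l ler_sum// => i _; rewrite mxE.
- apply: L1D; first exact: L1_cst.
  by apply: L1_sum => i _; exact: (wiener_moment W_fbm I_isom).
Qed.

Lemma L1_gauss (f : 'rV[R]_n -> R) : pc f -> L1 P (fun w => f (X w)).
Proof.
move=> [cf [C [k fC]]].
by apply: L1_le (L1_gauss_norm C k); [exact: measurable_gauss|move=> w; exact: fC].
Qed.

Section OrthogonalDecomposition.
Variables (j : 'I_n).
Let v := phi j.
Hypothesis v0 : `|v| != 0.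
(* [I (phi i) = a i * I v + Y i], where [Y] is independent of [I v]. *)
Let a i := hdot (phi i) v / `|v| ^+ 2.
Let psi i := phi i - a i *: v.
Let Y i w := I (phi i) w - a i * I v w.

Let psi_orth i : hdot (psi i) v = 0.
Proof.
rewrite /psi -scaleNr hdotDl hdotZl hdot_norm /a mulNr divfK ?subrr//.
by rewrite expf_neq0.
Qed.

Let mY i : measurable_fun setT (Y i).
Proof. by apply: measurable_funB => //; exact: measurable_funM. Qed.

(** The decomposition of [X] along [I v] must hold at every point, so [Y] is defined from the values
    of [I]. It agrees with the Wiener integrals of the projections [psi] only almost surely. *)
Let YE : {ae P, forall w (i : 'I_n), I (psi i) w = Y i w}.
Proof.
apply: filter_forall => i; rewrite /psi -scaleNr addrC.
apply: filterS (wienerZD I_isom (- a i) v (phi i)) => w ->.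
by rewrite mulNr addrC.
Qed.

(** The product of cosines is a mean of cosines of the integrals of [p + s v] and [p - s v]. By
    orthogonality both vectors have square norm [|p|^2 + s^2 |v|^2], so the exponential factors out
    and [cos (b + c) + cos (b - c)] splits again. *)
Let cos_indep (t : nat -> R) b s c :
  \int[P]_w (cos (\sum_(i < n) t i * Y i w + b) * cos (s * I v w + c)) =
  \int[P]_w cos (\sum_(i < n) t i * Y i w + b) *
  \int[P]_w cos (s * I v w + c).
Proof.
pose p : V := \sum_(i < n) t i *: psi i.
have pv : hdot p v = 0.
  by rewrite hdot_suml big1// => i _; rewrite hdotZl psi_orth mulr0.
have pE : {ae P, forall w, I p w = \sum_(i < n) t i * Y i w}.
  apply: filterS2 (wiener_sum I_isom (fun i : 'I_n => t i) psi) YE => w -> h.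
  by apply: eq_bigr => i _; rewrite h.
have mS : measurable_fun setT (fun w => \sum_(i < n) t i * Y i w).
  by apply: measurable_sum => i; exact: measurable_funM.
have msv : measurable_fun setT (fun w => s * I v w) by exact: measurable_funM.
have C1 : \int[P]_w cos (\sum_(i < n) t i * Y i w + b) =
    expR (- `|p| ^+ 2 / 2) * cos b.
  rewrite -(wiener_cos W_fbm I_isom); apply: Rint_ae; try exact: measurable_cosD.
  by apply: filterS pE => w ->.
have C2 : \int[P]_w cos (s * I v w + c) = expR (- (s ^+ 2 * `|v| ^+ 2) / 2) * cos c.
  have := wiener_cos W_fbm I_isom (s *: v) c.
  rewrite normrZ exprMn real_normK ?num_real// => <-.
  apply: Rint_ae; try exact: measurable_cosD.
  by apply: filterS (wienerZ I_isom s v) => w ->.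
have C3 e g : e ^+ 2 = 1 ->
    \int[P]_w cos (\sum_(i < n) t i * Y i w + e * (s * I v w) + g) =
    expR (- (`|p| ^+ 2 + s ^+ 2 * `|v| ^+ 2) / 2) * cos g.
  move=> e1; have -> : `|p| ^+ 2 + s ^+ 2 * `|v| ^+ 2 = `|(e * s) *: v + p| ^+ 2.
    rewrite -!hdot_norm !(hdotDl, hdotDr, hdotZl, hdotZr) [hdot v p]hdotC pv.
    rewrite [RHS](_ : _ = hdot p p + e ^+ 2 * (s ^+ 2 * hdot v v)); last by ring.
    by rewrite e1 mul1r.
  rewrite -(wiener_cos W_fbm I_isom); apply: Rint_ae.
  - by apply: measurable_cosD; apply: measurable_funD => //; exact: measurable_funM.
  - exact: measurable_cosD.
  - apply: filterS2 pE (wienerZD I_isom (e * s) v p) => w e2 ->.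
    by rewrite e2; congr cos; ring.
rewrite C1 C2.
transitivity (\int[P]_w (
    2^-1 * cos (\sum_(i < n) t i * Y i w + 1 * (s * I v w) + (b + c)) +
    2^-1 * cos (\sum_(i < n) t i * Y i w + -1 * (s * I v w) + (b - c)))).
  apply: eq_Rintegral => w _.
  rewrite mul1r mulN1r addrACA [in X in _ + 2^-1 * X]addrACA -opprD.
  by move: (_ + b) (_ + c) => y z; rewrite cosD cosB; field.
have i1 e g : L1 P (fun w => cos (\sum_(i < n) t i * Y i w + e * (s * I v w) + g)).
  apply: (@L1_bounded _ _ _ _ _ 1); last by move=> w; exact: cos_max.
  by apply: measurable_cosD; apply: measurable_funD => //; exact: measurable_funM.
rewrite (RintD (L1Z _ (i1 _ _)) (L1Z _ (i1 _ _))) !(RintZ _ (i1 _ _)).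
rewrite !C3 ?expr1n ?sqrrN ?expr1n//.
by rewrite opprD mulrDl expRD cosD cosB; field.
Qed.

(** With [B] the centered cosine of [Y], the claim is that [B] is orthogonal to [q (I v)]. By
    [cos_indep] it is orthogonal to all cosines of [I v], hence to indicators of intervals, hence to
    continuous functions of polynomial growth. *)
Let cos_growth_indep (t : nat -> R) b (q : R -> R) C k : continuous q ->
  (forall z, `|q z| <= C * (1 + `|z|) ^+ k) ->
  \int[P]_w (q (I v w) * cos (\sum_(i < n) t i * Y i w + b)) =
  \int[P]_w q (I v w) * \int[P]_w cos (\sum_(i < n) t i * Y i w + b).
Proof.
move=> cq qC; have C0 : 0 <= C.
  by have := qC 0; rewrite normr0 addr0 expr1n mulr1; apply: le_trans.
have mq := continuous_measurable_fun cq.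
have mS : measurable_fun setT (fun w => \sum_(i < n) t i * Y i w).
  by apply: measurable_sum => i; exact: measurable_funM.
have mqI : measurable_fun setT (fun w => q (I v w)) by exact: (measurableT_comp mq).
have iq : L1 P (fun w => q (I v w)).
  apply: (@L1_le _ _ _ _ _ (fun w => C * (1 + `|I v w|) ^+ k)) => //.
  by apply: L1Z; exact: (wiener_moment W_fbm I_isom).
have mc := measurable_cosD b mS.
set c0 := \int[P]_w cos _.
have c01 : `|c0| <= 1.
  have ic : L1 P (fun w => cos (\sum_(i < n) t i * Y i w + b)).
    by apply: (@L1_bounded _ _ _ _ _ 1) => // w; exact: cos_max.
  apply: (le_trans (le_norm_Rint ic)); rewrite -[leRHS](Rint_cst P 1).
  apply: le_Rint; [exact: L1_norm|exact: L1_cst|].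
  by move=> w; exact: cos_max.
pose B w := cos (\sum_(i < n) t i * Y i w + b) - c0.
have mB : measurable_fun setT B by exact: measurable_funB.
have B2 w : `|B w| <= 2.
  by rewrite (le_trans (ler_normB _ _))// -[2]/(1 + 1) lerD// cos_max.
suff : \int[P]_w (B w * q (I v w)) = 0.
  rewrite /B => E0.
  have i1 : L1 P (fun w => q (I v w) * cos (\sum_(i < n) t i * Y i w + b)).
    rewrite (_ : (fun w => _) = fun w =>
      cos (\sum_(i < n) t i * Y i w + b) * q (I v w)).
      by apply: (@L1M_bounded _ _ _ _ _ _ 1) => // w; exact: cos_max.
    by apply/funext => w; rewrite mulrC.
  apply/eqP; rewrite -subr_eq0 [X in _ - X]mulrC -RintZ// -RintB//; last exact: L1Z.
  apply/eqP; rewrite -[RHS]E0; apply: eq_Rintegral => w _; ring.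
(* One coordinate, [I v]. The dominating function uses [|B| <= 2] and [1 + |y| <= 2 (1 + |I v|)] for
   [|y - I v| <= 1]. *)
apply: (@caratheodory_integral0 _ _ _ 1 (fun=> I v) (fun w y => B w * q (y ord0))
   _ _ _ P (fun w => (2 * C * 2 ^+ k) * (1 + `|I v w|) ^+ k)).
- by [].
- by move=> y; exact: measurable_funM.
- by move=> w z zy; apply: cvgMr; apply: (continuous_cvg _ (cq _)); exact: zy.
- by apply: L1Z; exact: (wiener_moment W_fbm I_isom).
- move=> w y /(_ ord0) y1; rewrite normrM -mulrA -mulrA ler_pM//.
  apply: (le_trans (qC _)); rewrite ler_wpM2l// -exprMn; apply: lerXn2r; rewrite ?nnegrE.
  + by rewrite addr_ge0.
  + by rewrite mulr_ge0// addr_ge0.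
  have := ler_normD (y ord0 - I v w) (I v w); rewrite subrK.
  by have := normr_ge0 (I v w); lra.
- move=> y al be.
  transitivity (\int[P]_w ((q (y ord0) * B w) * \prod_(i < 1)
      (al i <= I v w < be i)%R%:R)).
    by apply: eq_Rintegral => w _; rewrite [B w * _]mulrC.
  have iqB : L1 P (fun w => q (y ord0) * B w).
    by apply: L1Z; exact: (@L1_bounded _ _ _ _ _ 2).
  apply: (@box_of_cos _ _ _ _ 1 _ (fun=> I v) iqB) => // t' b'.
  under eq_Rintegral do rewrite big_ord1.
  set s := t' _.
  have ms : measurable_fun setT (fun w => s * I v w) by exact: measurable_funM.
  have ic' : L1 P (fun w => cos (s * I v w + b')).
    apply: (@L1_bounded _ _ _ _ _ 1); first exact: measurable_cosD.
    by move=> w; exact: cos_max.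
  have icc : L1 P (fun w => cos (\sum_(i < n) t i * Y i w + b) * cos (s * I v w + b')).
    by apply: (@L1M_bounded _ _ _ _ _ _ 1) => // w; exact: cos_max.
  transitivity (q (y ord0) * (\int[P]_w
     (cos (\sum_(i < n) t i * Y i w + b) * cos (s * I v w + b') -
      c0 * cos (s * I v w + b')))).
    rewrite -RintZ; last by apply: L1B => //; exact: L1Z.
    by apply: eq_Rintegral => w _; rewrite /B; ring.
  rewrite RintB//; last exact: L1Z.
  by rewrite RintZ// cos_indep subrr mulr0.
- by move=> y; exact: L1M_bounded B2 (L1_cst _ _).
Qed.

(** The difference of the integrands is [Q w (Y w)], where [Q w y] sees only [I v] once [y] is
    frozen. For fixed [y] its mean is 0 by [normal_ibp], and by independence it stays 0 on every box
    of [Y]; [caratheodory_integral0] then unfreezes [y]. *)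
Lemma gauss_ibp_nondeg (f f' : 'rV[R]_n -> R) :
  (forall x, is_derive x (\row_i hdot (phi i) v) f (f' x)) -> pc f -> pc f' ->
  \int[P]_w (I v w * f (X w)) = \int[P]_w f' (X w).
Proof.
move=> fd pf pf'.
pose av : 'rV[R]_n := \row_i a i.
pose Q w (y : 'I_n -> R) := I v w * f (I v w *: av + \row_i y i)
  - f' (I v w *: av + \row_i y i).
have QX w : Q w (Y ^~ w) = I v w * f (X w) - f' (X w).
  rewrite /Q (_ : I v w *: av + \row_i Y i w = X w)//.
  by apply/rowP => i; rewrite !mxE /Y mulrC addrC subrK.
have pxf : pc (fun x => x 0 j * f x) by apply: pcM => //; exact: pc_coord.
have ixf : L1 P (fun w => I v w * f (X w)).
  by have := L1_gauss pxf; rewrite /X; under eq_fun do rewrite mxE.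
apply/eqP; rewrite -subr_eq0 -RintB//; last exact: L1_gauss.
apply/eqP; transitivity (\int[P]_w Q w (Y ^~ w)).
  by apply: eq_Rintegral => w _; rewrite QX.
have [C [M [C0 [fC f'C]]]] : exists (C : R) (M : nat), 0 <= C /\
    (forall x, `|f x| <= C * (1 + `|x|) ^+ M) /\
    (forall x, `|f' x| <= C * (1 + `|x|) ^+ M).
  have [C [N [C0 fC]]] := poly_growth_ge0 pf.2.
  have [C' [N' [C'0 f'C]]] := poly_growth_ge0 pf'.2.
  exists (C + C'), (N + N')%N; rewrite addr_ge0//; split => //; split => x.
    rewrite (le_trans (fC x))// ler_pM ?expn1D_ge0//; first by rewrite lerDl.
    by rewrite expn1D_mono// leq_addr.
  rewrite (le_trans (f'C x))// ler_pM ?expn1D_ge0//; first by rewrite lerDr.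
  by rewrite expn1D_mono// leq_addl.
pose q (y : 'I_n -> R) z := z * f (z *: av + \row_i y i) - f' (z *: av + \row_i y i).
have caff (y : 'I_n -> R) : continuous (fun z : R => z *: av + \row_i y i).
  move=> z; apply: cvgD; last exact: cvg_cst.
  exact: scalel_continuous.
have cg (g : 'rV[R]_n -> R) (y : 'I_n -> R) : continuous g ->
    continuous (fun z : R => g (z *: av + \row_i y i)).
  by move=> c z; apply: (@continuous_comp _ _ _ (fun z : R => z *: av + \row_i y i) g);
    [exact: caff|exact: c].
have cq y : continuous (q y).
  move=> z; apply: cvgB; last exact: (cg _ y pf'.1).
  by apply: cvgM; [exact: cvg_id|exact: (cg _ y pf.1)].
pose B (y : 'I_n -> R) := 1 + `|av| + `|\row_i y i|.
have B1 y : 1 <= B y by rewrite /B -addrA lerDl addr_ge0.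
have gB (g : 'rV[R]_n -> R) y z : (forall x, `|g x| <= C * (1 + `|x|) ^+ M) ->
    `|g (z *: av + \row_i y i)| <= C * B y ^+ M * (1 + `|z|) ^+ M.
  move=> gC; rewrite (le_trans (gC _))// -mulrA ler_wpM2l// -exprMn.
  have h1 := ler_normD (z *: av) (\row_i y i); rewrite normrZ in h1.
  have a0 := normr_ge0 av; have z0 := normr_ge0 z.
  have y0 := normr_ge0 (\row_i y i); have x0 := normr_ge0 (z *: av + \row_i y i).
  apply: lerXn2r; rewrite ?nnegrE /B; nra.
have qB y z : `|q y z| <= C * B y ^+ M * (1 + `|z|) ^+ M.+1.
  rewrite /q (le_trans (ler_normB _ _))// normrM exprS mulrCA mulrDl mul1r addrC.
  by rewrite lerD ?ler_wpM2l// gB.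
have q0 y : \int[P]_w q y (I v w) = 0.
  have mq := continuous_measurable_fun (cq y).
  have iq : L1 (normal_prob 0 `|v|) (q y).
    by apply: L1_normal => //; exact: (L1_normal_growth v0 mq (qB y)).
  have [_ ->] := @law_integral _ _ _ P (normal_prob 0 `|v|) _ _ (measurable_wiener v)
    (wiener_law W_fbm I_isom v0) mq iq.
  have v2 : `|v| ^+ 2 != 0 by rewrite expf_neq0.
  have BM0 : 0 <= C * B y ^+ M by rewrite mulr_ge0// exprn_ge0// (le_trans _ (B1 y)).
  have v2i : 0 <= `|v| ^- 2 by rewrite invr_ge0 sqr_ge0.
  pose K := C * B y ^+ M * (1 + `|v| ^- 2).
  have K0 : C * B y ^+ M <= K by rewrite /K ler_peMr// lerDl.
  have K1 : `|v| ^- 2 * (C * B y ^+ M) <= K.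
    by rewrite mulrC /K ler_wpM2l// lerDr.
  (* The direction in [fd] is [|v|^2 av], whence the factor [|v|^-2]; it cancels the variance
     [|v|^2] that [normal_ibp] produces. *)
  have dk (z : R) : is_derive z (1 : R) (fun z => f (z *: av + \row_i y i))
      (`|v| ^- 2 * f' (z *: av + \row_i y i)).
    have D := is_derive_scale_dir (`|v| ^- 2) (fd (\row_i y i + z *: av)).
    have avE : `|v| ^- 2 *: (\row_i hdot (phi i) v) = av.
      by apply/rowP => i; rewrite !mxE mulrC.
    rewrite avE in D; have := (is_derive_line f (\row_i y i) av z _).1 D.
    by rewrite [_ + z *: av]addrC; under eq_fun do rewrite addrC.
  have mf : measurable_fun setT (fun z : R => f (z *: av + \row_i y i)).
    exact: continuous_measurable_fun (cg _ y pf.1).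
  have mf' : measurable_fun setT (fun z : R => f' (z *: av + \row_i y i)).
    exact: continuous_measurable_fun (cg _ y pf'.1).
  have if' : L1 (normal_prob 0 `|v|) (fun z => f' (z *: av + \row_i y i)).
    apply: L1_normal => //; apply: (L1_normal_growth v0 mf') => z.
    exact: gB f'C.
  have mzf : measurable_fun setT (fun z : R => z * f (z *: av + \row_i y i)).
    exact: measurable_funM.
  have izf : L1 (normal_prob 0 `|v|) (fun z => z * f (z *: av + \row_i y i)).
    apply: L1_normal => //; apply: (@L1_normal_growth _ _ v0 _ (C * B y ^+ M) M.+1) => // z.
    rewrite normrM exprS mulrCA ler_pM//; first by rewrite lerDr.
    exact: gB fC.
  rewrite /q RintB// (@normal_ibp _ _ v0 _ _ K M dk).
  - by rewrite RintZ// mulrA divff// mul1r subrr.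
  - move=> z; apply: cvgM; first exact: cvg_cst.
    exact: (cg _ y pf'.1).
  - move=> z; apply: (le_trans (gB _ y z fC)).
    by rewrite ler_wpM2r// exprn_ge0// addr_ge0.
  - move=> z; rewrite normrM ger0_norm//.
    apply: (le_trans (ler_wpM2l v2i (gB _ y z f'C))).
    by rewrite mulrA ler_wpM2r// exprn_ge0// addr_ge0.
have iqI y : L1 P (fun w => q y (I v w)).
  apply: (@L1_le _ _ _ _ _ (fun w => C * B y ^+ M * (1 + `|I v w|) ^+ M.+1)).
  - exact: (measurableT_comp (continuous_measurable_fun (cq y))).
  - by move=> w; exact: qB.
  - by apply: L1Z; exact: (wiener_moment W_fbm I_isom).
apply: (@caratheodory_integral0 _ _ _ n Y Q mY _ _ P
  (fun w => C * 2 ^+ M * (1 + `|X w|) ^+ M.+1)).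
- by move=> y; exact: L1_measurable (iqI y).
- move=> w z zy.
  have cr : I v w *: av + \row_i z m i @[m --> \oo] --> I v w *: av + \row_i Y i w.
    by apply: cvgD; [exact: cvg_cst|exact: cvg_row].
  apply: cvgB; last by apply: (continuous_cvg _ _ cr); exact: pf'.1.
  by apply: cvgMr; apply: (continuous_cvg _ _ cr); exact: pf.1.
- exact: L1_gauss_norm.
- move=> w y yY.
  set x' := I v w *: av + \row_i y i.
  have x'X : `|x' - X w| <= 1.
    apply: row_norm_le => // i; rewrite !mxE (le_trans _ (yY i))//.
    by rewrite le_eqVlt; apply/orP; left; apply/eqP; congr `| _ |; rewrite /Y; ring.
  have x'2 : 1 + `|x'| <= 2 * (1 + `|X w|).
    have := ler_normD (x' - X w) (X w); rewrite subrK.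
    by have := normr_ge0 (X w); lra.
  have gX (g : 'rV[R]_n -> R) : (forall x, `|g x| <= C * (1 + `|x|) ^+ M) ->
      `|g x'| <= C * 2 ^+ M * (1 + `|X w|) ^+ M.
    move=> gC; rewrite (le_trans (gC _))// -mulrA ler_wpM2l// -exprMn.
    by apply: lerXn2r; rewrite ?nnegrE ?mulr_ge0 ?addr_ge0.
  have vX : `|I v w| <= `|X w|.
    by have := coord_norm_le (X w) j; rewrite mxE.
  rewrite /Q -/x' (le_trans (ler_normB _ _))// normrM exprS mulrCA mulrDl mul1r addrC.
  by rewrite lerD ?ler_pM// gX.
- move=> y al be.
  apply: (box_of_cos (iqI y) mY) => t b.
  by rewrite (@cos_growth_indep t b _ _ _ (cq y) (qB y)) q0 mul0r.
- exact: iqI.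
Qed.

End OrthogonalDecomposition.

Lemma gauss_ibp (j : 'I_n) (f f' : 'rV[R]_n -> R) :
  (forall x, is_derive x (\row_i hdot (phi i) (phi j)) f (f' x)) -> pc f -> pc f' ->
  \int[P]_w (X w 0 j * f (X w)) = \int[P]_w f' (X w).
Proof.
move=> fd pf pf'; under eq_Rintegral do rewrite mxE.
(* For a null vector [I (phi j)] vanishes almost surely and the direction of differentiation is 0,
   so both sides are 0. *)
have [v0|v0] := eqVneq `|phi j| 0; last exact: gauss_ibp_nondeg.
have p0 := normr0_eq0 v0.
transitivity (\int[P]_w (0 : R)).
  apply: Rint_ae => //.
    by apply: measurable_funM; [exact: measurable_wiener|apply: measurable_gauss; exact: pf.1].
  by have := wiener0 I_isom; rewrite p0; apply: filterS => w ->; rewrite mul0r.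
apply: eq_Rintegral => w _.
have := fd (X w); rewrite (_ : (\row_i _) = 0).
  by case=> _ <-; rewrite derive0.
by apply/rowP => i; rewrite !mxE p0 linear0r.
Qed.

End GaussianIntegrationByParts.

(** * Smooth functions of polynomial growth *)

Section MixedDirections.
Variables (R : realType) (V : normedModType R).
Implicit Types (f a b : V -> R) (x u w : V).

Lemma mvt_dir f b w : (forall x, is_derive x w f (b x)) ->
  forall x h, exists2 t, `|t| <= `|h| & f (x + h *: w) - f x = b (x + t *: w) * h.
Proof.
move=> fb x h.
have d (t : R) : is_derive t (1 : R) (fun t => f (x + t *: w)) (b (x + t *: w)).
  exact: (is_derive_line f x w t _).1 (fb _).
have [t] := mvt_ex d 0 h; rewrite !subr0 scale0r addr0 => th e.
by exists t.
Qed.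

Lemma continuous_near b x u w e : 0 < e -> continuous b ->
  \forall h \near (0 : R), forall s t, `|s| <= `|h| -> `|t| <= `|h| ->
    `|b (x + s *: u + t *: w) - b x| <= e.
Proof.
move=> e0 cb; have /cvgrPdist_le/(_ e e0) := cb x.
move=> /nbhs_ballP[r /= r0 rb].
have k0 : 0 < `|u| + `|w| + 1 by rewrite ltr_wpDl// addr_ge0.
near=> h => s t sh th; rewrite distrC; apply: rb.
rewrite -ball_normE /= -addrA opprD addrA subrr add0r normrN.
apply: le_lt_trans (ler_normD _ _) _; rewrite !normrZ.
apply: (@le_lt_trans _ _ (`|h| * (`|u| + `|w|))).
  by rewrite mulrDr lerD// ler_wpM2r.
apply: (@le_lt_trans _ _ (`|h| * (`|u| + `|w| + 1))).
  by rewrite ler_wpM2l// lerDl.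
rewrite -ltr_pdivlMr//; near: h.
apply/nbhs_ballP; exists (r / (`|u| + `|w| + 1)) => /=; first exact: divr_gt0.
by move=> z; rewrite /ball/= sub0r normrN.
Unshelve. all: by end_near. Qed.

(** The increment along [u + w] is one along [u] followed by one along [w] from the moved point. The
    mean value theorem and continuity of [b] bring the second quotient back to [b x]. *)
Lemma is_derive_add_dir f a b u w : (forall x, is_derive x u f (a x)) ->
  (forall x, is_derive x w f (b x)) -> continuous b ->
  forall x, is_derive x (u + w) f (a x + b x).
Proof.
move=> fa fb cb x.
pose q1 h := h^-1 *: ((f \o shift x) (h *: u) - f x).
pose q2 h := h^-1 *: (f (x + h *: u + h *: w) - f (x + h *: u)).
have c1 : q1 h @[h --> 0^'] --> a x.
  by have [d <-] := fa x; exact: d.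
have c2 : q2 h @[h --> 0^'] --> b x.
  apply/cvgrPdist_le => e e0.
  have := continuous_near x u w e0 cb; move/(@nbhs_dnbhs _ (0 : R)).
  move=> N; near=> h.
  have h0 : h != 0 by near: h; exact: nbhs_dnbhs_neq.
  have [t th E] := mvt_dir fb (x + h *: u) h.
  rewrite /q2 E [_ *: _]mulrCA mulVf// mulr1 distrC.
  have : forall s t, `|s| <= `|h| -> `|t| <= `|h| ->
    `|b (x + s *: u + t *: w) - b x| <= e by near: h.
  exact.
have c : h^-1 *: ((f \o shift x) (h *: (u + w)) - f x) @[h --> 0^'] --> a x + b x.
  rewrite (_ : (fun h => _) = q1 \+ q2); first exact: cvgD.
  apply/funext => h; rewrite /q1 /q2 /= -scalerDr; congr (_ *: _).
  rewrite scalerDr [h *: u + x]addrC [RHS]addrC addrA subrK.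
  by rewrite [_ + h *: w + x]addrC addrA.
split; first by apply/cvg_ex; exists (a x + b x).
exact: cvg_lim c.
Unshelve. all: by end_near. Qed.

(** The second difference of [f] over the parallelogram spanned by [h u] and [h w] is [h^2] times
    [aw] at one nearby point and [h^2] times [bu] at another, by two mean value theorems in either
    order. *)
Lemma schwarz f a b aw bu u w :
  (forall x, is_derive x u f (a x)) -> (forall x, is_derive x w f (b x)) ->
  (forall x, is_derive x w a (aw x)) -> (forall x, is_derive x u b (bu x)) ->
  continuous aw -> continuous bu -> forall x, aw x = bu x.
Proof.
move=> fa fb aaw bbu caw cbu x.
apply/eqP; rewrite -subr_eq0 -normr_le0; apply/ler_addgt0Pr => e e0.
rewrite add0r; have e2 : 0 < e / 2 by rewrite divr_gt0.
have N1 := continuous_near x u w e2 caw.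
have N2 := continuous_near x u w e2 cbu.
have [h [h0 [P1 P2]]] : exists h : R, h != 0 /\
   (forall s t, `|s| <= `|h| -> `|t| <= `|h| ->
     `|aw (x + s *: u + t *: w) - aw x| <= e / 2) /\
   (forall s t, `|s| <= `|h| -> `|t| <= `|h| ->
     `|bu (x + s *: u + t *: w) - bu x| <= e / 2).
  near (0 : R)^' => h; exists h; split; [|split].
  - by near: h; exact: nbhs_dnbhs_neq.
  - by near: h; exact: nbhs_dnbhs N1.
  - by near: h; exact: nbhs_dnbhs N2.
have d1 (s : V) : is_derive s u (fun y => f (y + h *: w) - f y) (a (s + h *: w) - a s).
  have : is_derive s u (fun y => f (y + h *: w)) (a (s + h *: w)).
    have [dd dv] := fa (s + h *: w).
    have E : (fun k => k^-1 *: (((fun y => f (y + h *: w)) \o shift s) (k *: u)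
        - f (s + h *: w))) =
      (fun k => k^-1 *: ((f \o shift (s + h *: w)) (k *: u) - f (s + h *: w))).
      by apply/funext => k /=; rewrite addrA.
    by split; [rewrite /derivable E|rewrite /derive E].
  by move=> d1; have := is_deriveB d1 (fa s).
have d2 (s : V) : is_derive s w (fun y => f (y + h *: u) - f y) (b (s + h *: u) - b s).
  have : is_derive s w (fun y => f (y + h *: u)) (b (s + h *: u)).
    have [dd dv] := fb (s + h *: u).
    have E : (fun k => k^-1 *: (((fun y => f (y + h *: u)) \o shift s) (k *: w)
        - f (s + h *: u))) =
      (fun k => k^-1 *: ((f \o shift (s + h *: u)) (k *: w) - f (s + h *: u))).
      by apply/funext => k /=; rewrite addrA.
    by split; [rewrite /derivable E|rewrite /derive E].
  by move=> d2; have := is_deriveB d2 (fb s).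
have [s sh E1] := mvt_dir d1 x h.
have [t th E2] := mvt_dir aaw (x + s *: u) h.
have [t' th' F1] := mvt_dir d2 x h.
have [s' sh' F2] := mvt_dir bbu (x + t' *: w) h.
have E : aw (x + s *: u + t *: w) = bu (x + s' *: u + t' *: w).
  apply: (mulIf h0); apply: (mulIf h0); rewrite -E2 -E1.
  rewrite [x + s' *: u + _]addrAC -F2 -F1 [x + h *: u + _]addrAC; ring.
rewrite (_ : aw x - bu x = (aw x - aw (x + s *: u + t *: w)) +
  (bu (x + s' *: u + t' *: w) - bu x)); last by rewrite E; ring.
rewrite (le_trans (ler_normD _ _))// [e]splitr lerD//; last exact: P2.
by rewrite distrC; exact: P1.
Unshelve. all: by end_near. Qed.

End MixedDirections.

Section ClassC1.
Variables (R : realType) (n : nat).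
Implicit Types (f g : 'rV[R]_n -> R) (p q : 'I_n -> 'rV[R]_n -> R).

(* [p i] is the i-th partial derivative of [f]. *)
Definition c1 f p := [/\ pc f, forall i, pc (p i) &
  forall x v, is_derive x v f (\sum_(i < n) v 0 i * p i x)].

(** Directions are added one basis vector at a time with [is_derive_add_dir], where continuity of
    the partial derivatives enters. Arbitrary directions are what integration by parts along the
    rows of a Gram matrix consumes. *)
Lemma c1_of_partials f p : pc f -> (forall i, pc (p i)) ->
  (forall i x, is_derive x (delta_mx 0 i) f (p i x)) -> c1 f p.
Proof.
move=> pf pp fp; split => // x v.
have S (s : seq 'I_n) : forall y : 'rV[R]_n,
    is_derive y (\sum_(i <- s) v 0 i *: delta_mx 0 i) f (\sum_(i <- s) v 0 i * p i y).
  elim: s => [|i s IH] y; first by rewrite !big_nil; exact: is_derive0.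
  rewrite !big_cons; apply: (@is_derive_add_dir _ _ _ (fun y => v 0 i * p i y)
    (fun y => \sum_(j <- s) v 0 j * p j y)) => //.
    by move=> z; apply: is_derive_scale_dir.
  by have [] := @pc_sum _ _ _ s xpredT (fun j y => v 0 j * p j y) (fun j _ => pcZ (v 0 j) (pp j)).
by rewrite [v in is_derive _ v]row_sum_delta; exact: S.
Qed.

Lemma c1_cst c : c1 (fun=> c) (fun _ _ => 0).
Proof.
split; [exact: pc_cst|by move=> i; exact: pc_cst|move=> x v].
rewrite big1; first exact: is_derive_cst.
by move=> i _; rewrite mulr0.
Qed.

Lemma c1_coord j : c1 (fun x => x 0 j) (fun i _ => (i == j)%:R).
Proof.
split; [exact: pc_coord|by move=> i; exact: pc_cst|move=> x v].
rewrite (bigD1 j)//= eqxx mulr1 big1 ?addr0; last first.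
  by move=> i /negbTE ->; rewrite mulr0.
have c : h^-1 *: (((fun x : 'rV[R]_n => x 0 j) \o shift x) (h *: v) - x 0 j)
    @[h --> 0^'] --> v 0 j.
  apply: cvg_near_cst; near=> h.
  have h0 : h != 0 by near: h; exact: nbhs_dnbhs_neq.
  by rewrite /= !mxE addrK [_ *: _]mulrA mulVf// mul1r.
by split; [apply/cvg_ex; exists (v 0 j)|exact: cvg_lim c].
Unshelve. all: by end_near. Qed.

Lemma c1D f g p q : c1 f p -> c1 g q ->
  c1 (fun x => f x + g x) (fun i x => p i x + q i x).
Proof.
move=> [pf pp fp] [pg pq gq]; split; first exact: pcD.
  by move=> i; exact: pcD.
move=> x v; rewrite (_ : \sum_(i < n) _ = \sum_(i < n) v 0 i * p i x +
    \sum_(i < n) v 0 i * q i x).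
  by have := is_deriveD (fp x v) (gq x v).
by rewrite -big_split; apply: eq_bigr => i _; rewrite mulrDr.
Qed.

Lemma c1M f g p q : c1 f p -> c1 g q ->
  c1 (fun x => f x * g x) (fun i x => p i x * g x + f x * q i x).
Proof.
move=> [pf pp fp] [pg pq gq]; split; first exact: pcM.
  by move=> i; apply: pcD; exact: pcM.
move=> x v; rewrite (_ : \sum_(i < n) _ = f x * (\sum_(i < n) v 0 i * q i x) +
    g x * (\sum_(i < n) v 0 i * p i x)).
  by have := is_deriveM (fp x v) (gq x v).
rewrite !mulr_sumr -big_split; apply: eq_bigr => i _ /=; ring.
Qed.

Lemma c1Z a f p : c1 f p -> c1 (fun x => a * f x) (fun i x => a * p i x).
Proof.
move=> fp; have := c1M (c1_cst a) fp.
by under [X in c1 _ X]eq_fun do under eq_fun do rewrite mul0r add0r.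
Qed.

Lemma c1B f g p q : c1 f p -> c1 g q ->
  c1 (fun x => f x - g x) (fun i x => p i x - q i x).
Proof.
move=> fp gq; have := c1D fp (c1Z (-1) gq).
under eq_fun do rewrite mulN1r.
by under [X in c1 _ X]eq_fun do under eq_fun do rewrite mulN1r.
Qed.

Lemma c1_sum I (r : seq I) (Q : pred I) (f : I -> 'rV[R]_n -> R)
    (p : I -> 'I_n -> 'rV[R]_n -> R) : (forall k, Q k -> c1 (f k) (p k)) ->
  c1 (fun x => \sum_(k <- r | Q k) f k x) (fun i x => \sum_(k <- r | Q k) p k i x).
Proof.
move=> fp; elim: r => [|k r IH].
  under eq_fun do rewrite big_nil.
  under [X in c1 _ X]eq_fun do under eq_fun do rewrite big_nil.
  exact: c1_cst.
under eq_fun do rewrite big_cons.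
under [X in c1 _ X]eq_fun do under eq_fun do rewrite big_cons.
by case: (boolP (Q k)) => // Qk; exact: (c1D (fp k Qk) IH).
Qed.

Lemma c1_comp (h h' : R -> R) M f p :
  (forall y : R, is_derive y (1 : R) h (h' y)) -> continuous h' ->
  (forall y : R, `|h y| <= M * (1 + `|y|)) ->
  (forall y : R, `|h' y| <= M * (1 + `|y|)) ->
  c1 f p -> c1 (fun x => h (f x)) (fun i x => h' (f x) * p i x).
Proof.
move=> hd ch' hM h'M [pf pp fp]; have ch := is_derive_continuous hd.
split; first exact: (pc_lin_comp ch hM pf).
  by move=> i; apply: pcM => //; exact: (pc_lin_comp ch' h'M pf).
move=> x v; rewrite (_ : \sum_(i < n) _ = h' (f x) * (\sum_(i < n) v 0 i * p i x)).
  exact: is_derive_comp.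
by rewrite mulr_sumr; apply: eq_bigr => i _; rewrite mulrCA.
Qed.

Lemma pc_iter_partial g s : smooth_poly_growth g -> pc (iter_partial s g).
Proof. by move=> /(_ s)[_ c b]. Qed.

Lemma c1_iter_partial g s : smooth_poly_growth g ->
  c1 (iter_partial s g) (fun i => iter_partial (i :: s) g).
Proof.
move=> gs; apply: c1_of_partials; first exact: pc_iter_partial.
  by move=> i; exact: pc_iter_partial.
by move=> i x; case: (gs s) => D _ _; exact: derivableP (D i x).
Qed.

Lemma partialC g s i j x : smooth_poly_growth g ->
  iter_partial [:: i, j & s] g x = iter_partial [:: j, i & s] g x.
Proof.
move=> gs; have D k t y : is_derive y (delta_mx 0 k) (iter_partial t g)
    (iter_partial (k :: t) g y).
  by case: (gs t) => E _ _; exact: derivableP (E k y).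
apply: (schwarz (D j s) (D i s) (D i _) (D j _));
  exact: (pc_iter_partial _ gs).1.
Qed.

End ClassC1.

(** * The estimate for smooth variables *)

Section SmoothEstimate.
Context (R : realType) (H T : R) d (Omega : measurableType d).
Variables (P : probability Omega R) (W : R -> {RV P >-> R}).
Variables (V : fbm_hilbert H T) (I : V -> {RV P >-> R}).
Hypotheses (W_fbm : is_fbm H T W) (I_isom : is_wiener_isometry W I).
Variable ten : forall V1 V2 : hilbertType R, hilbert_tensor V1 V2.
Variables (n : nat) (phi : 'I_n -> V).
Let X w := \row_(i < n) I (phi i) w.
Let EX (k : 'rV[R]_n -> R) := \int[P]_w k (X w).
(** The Gram matrix of the vectors, through which all scalar products of derivatives are written in
    coordinates. *)
Let G i j := hdot (phi i) (phi j).

Let iX k : pc k -> L1 P (fun w => k (X w)).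
Proof. exact: (L1_gauss W_fbm I_isom). Qed.

Let EXD k l : pc k -> pc l -> EX (fun x => k x + l x) = EX k + EX l.
Proof. by move=> pk pl; apply: RintD; exact: iX. Qed.

Let EXB k l : pc k -> pc l -> EX (fun x => k x - l x) = EX k - EX l.
Proof. by move=> pk pl; apply: RintB; exact: iX. Qed.

Let EXZ a k : pc k -> EX (fun x => a * k x) = a * EX k.
Proof. by move=> pk; apply: RintZ; exact: iX. Qed.

Let EX_sum J (r : seq J) (k : J -> 'rV[R]_n -> R) : (forall i, pc (k i)) ->
  EX (fun x => \sum_(i <- r) k i x) = \sum_(i <- r) EX (k i).
Proof. by move=> pk; apply: Rint_sum => i _; exact: (iX (pk i)). Qed.

Let EX_le k l : pc k -> pc l -> (forall x, k x <= l x) -> EX k <= EX l.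
Proof.
by move=> pk pl kl; apply: le_Rint => [||w]; [exact: (iX pk)|exact: (iX pl)|exact: kl].
Qed.

Let eqEX k l : (forall x, k x = l x) -> EX k = EX l.
Proof. by move=> kl; apply: eq_Rintegral => w _; exact: kl. Qed.

Let ibp j f p : c1 f p ->
  EX (fun x => x 0 j * f x) = EX (fun x => \sum_(i < n) G i j * p i x).
Proof.
move=> [pf pp fp]; apply: (gauss_ibp W_fbm I_isom).
- move=> x; have := fp x (\row_i hdot (phi i) (phi j)).
  by under eq_bigr do rewrite mxE.
- exact: pf.
- by apply: pc_sum => i _; apply: pcZ.
Qed.

Variables (g : 'rV[R]_n -> R) (g1 : 'I_n -> 'rV[R]_n -> R).
Variables (g2 : 'I_n -> 'I_n -> 'rV[R]_n -> R).
Variables (g3 : 'I_n -> 'I_n -> 'I_n -> 'rV[R]_n -> R).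
Hypothesis cg : c1 g g1.
Hypothesis cg1 : forall j, c1 (g1 j) (fun i => g2 i j).
Hypothesis cg2 : forall j k, c1 (g2 j k) (fun i => g3 i j k).
Hypothesis g2C : forall i j x, g2 i j x = g2 j i x.
Hypothesis g3C : forall i j k x, g3 i j k x = g3 j i k x.
Let pg1 i : pc (g1 i). Proof. by case: (cg1 i) => h _ _; exact: h. Qed.
Let pg2 i j : pc (g2 i j). Proof. by case: (cg2 i j) => h _ _; exact: h. Qed.
Let pg3 i j k : pc (g3 i j k). Proof. by case: (cg2 j k) => _ h _; exact: (h i). Qed.
(* The divergence (Skorokhod integral) of the derivative of [g (X)]. *)
Let delta (x : 'rV[R]_n) : R := \sum_(j < n) (x 0 j * g1 j x - \sum_(i < n) G i j * g2 i j x).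
Let delta' i (x : 'rV[R]_n) : R := \sum_(k < n) ((i == k)%:R * g1 k x + x 0 k * g2 i k x
   - \sum_(l < n) G l k * g3 i l k x).
(** In coordinates, [N] is the square norm of the first derivative of [g (X)], and [Q] below that of
    the second; see [NE] and [QE]. Sums of this form stay visibly in the class [pc]. *)
Let N (x : 'rV[R]_n) : R := \sum_(i < n) \sum_(j < n) G i j * (g1 i x * g1 j x).
Let Q (x : 'rV[R]_n) : R := \sum_(i < n) \sum_(j < n) \sum_(k < n) \sum_(l < n)
  G i j * G l k * (g2 l j x * g2 i k x).

Let cdelta : c1 delta delta'.
Proof.
apply: (@c1_sum _ _ _ (index_enum 'I_n) xpredT
  (fun k x => x 0 k * g1 k x - \sum_(l < n) G l k * g2 l k x)
  (fun k i x => (i == k)%:R * g1 k x + x 0 k * g2 i k x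
    - \sum_(l < n) G l k * g3 i l k x)) => k _.
apply: c1B; first exact: (c1M (c1_coord R k) (cg1 k)).
by apply: (@c1_sum _ _ _ (index_enum 'I_n) xpredT (fun l x => G l k * g2 l k x)
  (fun l i x => G l k * g3 i l k x)) => l _; exact: c1Z.
Qed.

Let pN : pc N.
Proof. by apply: pc_sum => i _; apply: pc_sum => j _; apply: pcZ; apply: pcM. Qed.

Let pQ : pc Q.
Proof.
apply: pc_sum => i _; apply: pc_sum => j _; apply: pc_sum => k _.
by apply: pc_sum => l _; apply: pcZ; apply: pcM.
Qed.

Let pdelta : pc delta. Proof. by case: cdelta => h _ _; exact: h. Qed.
Let pdelta' i : pc (delta' i). Proof. by case: cdelta => _ h _; exact: (h i). Qed.

(* Duality between the derivative and the divergence. *)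
Let dual u p : c1 u p -> EX (fun x => u x * delta x) =
  EX (fun x => \sum_(j < n) \sum_(i < n) G i j * (g1 j x * p i x)).
Proof.
move=> up; have [pu pp _] := up.
have pS j : pc (fun x => \sum_(i < n) G i j * g2 i j x).
  by apply: pc_sum => i _; apply: pcZ.
have pj j : pc (fun x => x 0 j * (u x * g1 j x)).
  by apply: pcM; [exact: pc_coord|exact: pcM].
have pG j : pc (fun x => \sum_(i < n) G i j * (p i x * g1 j x + u x * g2 i j x)).
  by apply: pc_sum => i _; apply: pcZ; apply: pcD; exact: pcM.
transitivity (EX (fun x => \sum_(j < n) (x 0 j * (u x * g1 j x) -
    u x * \sum_(i < n) G i j * g2 i j x))).
  apply: eqEX => x; rewrite /delta mulr_sumr; apply: eq_bigr => j _.
  by rewrite mulrBr mulrCA.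
rewrite EX_sum; last by move=> j; apply: pcB => //; exact: pcM.
rewrite EX_sum; last first.
  by move=> j; apply: pc_sum => i _; apply: pcZ; exact: pcM.
apply: eq_bigr => j _; rewrite EXB//; last exact: pcM.
rewrite (ibp j (c1M up (cg1 j))) -EXB//; last exact: pcM.
apply: eqEX => x; rewrite mulr_sumr -sumrB; apply: eq_bigr => i _; ring.
Qed.

(** Duality with [u = delta] leaves the derivative of [delta]. Its term [g1] yields [N]; the terms
    with a coordinate [x 0 k] are integrated by parts once more, and the third derivatives this
    creates cancel those of [delta'] by symmetry, leaving products of second derivatives. *)
Let second_moment_delta : EX (fun x => delta x * delta x) = EX N + EX Q.
Proof.
rewrite (dual cdelta) -EXD//.
pose A j k (x : 'rV[R]_n) : R := \sum_(i < n) G i j * (x 0 k * (g1 j x * g2 i k x)).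
pose B j k (x : 'rV[R]_n) : R := \sum_(i < n) \sum_(l < n) G i j * (G l k * (g1 j x * g3 i l k x)).
have pA j k : pc (A j k).
  by apply: pc_sum => i _; apply: pcZ; apply: pcM; [exact: pc_coord|exact: pcM].
have pB j k : pc (B j k).
  by apply: pc_sum => i _; apply: pc_sum => l _; do 2 apply: pcZ; apply: pcM.
have AB j k : EX (A j k) - EX (B j k) =
    EX (fun x => \sum_(i < n) \sum_(l < n) G i j * G l k * (g2 l j x * g2 i k x)).
  rewrite {1}/A EX_sum; last first.
    by move=> i; apply: pcZ; apply: pcM; [exact: pc_coord|exact: pcM].
  rewrite {1}/B EX_sum; last first.
    by move=> i; apply: pc_sum => l _; do 2 apply: pcZ; apply: pcM.
  rewrite EX_sum; last first.
    by move=> i; apply: pc_sum => l _; apply: pcZ; apply: pcM.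
  rewrite -sumrB; apply: eq_bigr => i _.
  have pp1 : pc (fun x => \sum_(l < n) G l k * (g2 l j x * g2 i k x + g1 j x * g3 l i k x)).
    by apply: pc_sum => l _; apply: pcZ; apply: pcD; exact: pcM.
  rewrite EXZ; last by apply: pcM; [exact: pc_coord|exact: pcM].
  rewrite (ibp k (c1M (cg1 j) (cg2 i k))) -EXZ// -EXB.
  - apply: eqEX => x; rewrite mulr_sumr -sumrB; apply: eq_bigr => l _.
    by rewrite [g3 l i k x]g3C; ring.
  - exact: pcZ.
  - by apply: pc_sum => l _; do 2 apply: pcZ; apply: pcM.
transitivity (EX (fun x => N x + (\sum_(j < n) \sum_(k < n) (A j k x - B j k x)))).
  apply: eqEX => x.
  have -> : N x = \sum_(j < n) \sum_(i < n) G i j * (g1 i x * g1 j x).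
    exact: exchange_big.
  rewrite -big_split/=; apply: eq_bigr => j _.
  rewrite /A /B.
  transitivity (\sum_(i < n) (G i j * (g1 i x * g1 j x) +
     \sum_(k < n) (G i j * (x 0 k * (g1 j x * g2 i k x)) -
       \sum_(l < n) G i j * (G l k * (g1 j x * g3 i l k x))))).
    apply: eq_bigr => i _; rewrite /delta' mulr_sumr mulr_sumr.
    transitivity (\sum_(k < n) (G i j * (g1 j x * ((i == k)%:R * g1 k x)) +
       (G i j * (x 0 k * (g1 j x * g2 i k x)) -
         \sum_(l < n) G i j * (G l k * (g1 j x * g3 i l k x))))).
      apply: eq_bigr => k _.
      have -> : \sum_(l < n) G i j * (G l k * (g1 j x * g3 i l k x)) =
          G i j * (g1 j x * \sum_(l < n) G l k * g3 i l k x).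
        by rewrite !mulr_sumr; apply: eq_bigr => l _; ring.
      by ring.
    rewrite big_split/=; congr (_ + _); rewrite (bigD1 i)//= big1 ?addr0.
      by rewrite eqxx mul1r [g1 j x * _]mulrC.
    by move=> k; rewrite eq_sym => /negbTE ->; rewrite mul0r !mulr0.
  rewrite big_split/=; congr (_ + _).
  rewrite exchange_big/=; apply: eq_bigr => k _.
  by rewrite -sumrB.
have pAB : pc (fun x => \sum_(j < n) \sum_(k < n) (A j k x - B j k x)).
  by apply: pc_sum => j _; apply: pc_sum => k _; apply: pcB.
rewrite EXD// [RHS]EXD//; congr (_ + _).
rewrite EX_sum; last by move=> j; apply: pc_sum => k _; apply: pcB.
transitivity (EX (fun x => \sum_(j < n) \sum_(k < n) \sum_(i < n) \sum_(l < n)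
    G i j * G l k * (g2 l j x * g2 i k x))).
  rewrite EX_sum; last first.
    move=> j; apply: pc_sum => k _; apply: pc_sum => i _; apply: pc_sum => l _.
    by apply: pcZ; apply: pcM.
  apply: eq_bigr => j _; rewrite EX_sum; last by move=> k; apply: pcB.
  rewrite EX_sum; last first.
    move=> k; apply: pc_sum => i _; apply: pc_sum => l _.
    by apply: pcZ; apply: pcM.
  by apply: eq_bigr => k _; rewrite EXB.
apply: eqEX => x; rewrite /Q.
under eq_bigr do rewrite exchange_big/=.
by rewrite exchange_big.
Qed.

Let hdot_comb (a b : 'I_n -> R) :
  hdot (\sum_(i < n) a i *: phi i) (\sum_(j < n) b j *: phi j) =
  \sum_(i < n) \sum_(j < n) G i j * (a i * b j).
Proof.
rewrite hdot_suml; apply: eq_bigr => i _; rewrite hdot_sumr; apply: eq_bigr => j _.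
by rewrite hdotZl hdotZr /G; ring.
Qed.

Let hdotBl (u v w : V) : hdot (u - v) w = hdot u w - hdot v w.
Proof. by rewrite hdotDl -scaleN1r hdotZl mulN1r. Qed.

Let DG x := \sum_(i < n) g1 i x *: phi i.
Let D2 x := \sum_(i < n) tensor (ten V V) (\sum_(k < n) g2 i k x *: phi k) (phi i).

Let NE x : N x = `|DG x| ^+ 2.
Proof. by rewrite -hdot_norm hdot_comb. Qed.

Let QE x : Q x = `|D2 x| ^+ 2.
Proof.
rewrite -hdot_norm hdot_suml; apply: eq_bigr => i _.
rewrite hdot_sumr; apply: eq_bigr => j _.
rewrite tensor_dot hdot_comb mulr_suml; apply: eq_bigr => k _.
rewrite mulr_suml; apply: eq_bigr => l _.
by rewrite [g2 l j x]g2C -/(G i j) /G [hdot (phi l) _]hdotC; ring.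
Qed.

Let N' i (x : 'rV[R]_n) : R :=
  \sum_(j < n) \sum_(k < n) G j k * (g2 i j x * g1 k x + g1 j x * g2 i k x).

Let cN : c1 N N'.
Proof.
apply: (@c1_sum _ _ _ (index_enum 'I_n) xpredT
  (fun j x => \sum_(k < n) G j k * (g1 j x * g1 k x))
  (fun j i x => \sum_(k < n) G j k * (g2 i j x * g1 k x + g1 j x * g2 i k x))) => j _.
apply: (@c1_sum _ _ _ (index_enum 'I_n) xpredT
  (fun k x => G j k * (g1 j x * g1 k x))
  (fun k i x => G j k * (g2 i j x * g1 k x + g1 j x * g2 i k x))) => k _.
by apply: c1Z; exact: (c1M (cg1 j) (cg1 k)).
Qed.

(** The scalar product of the derivatives of [N] and of [g (X)], that is, of [|DG|^2] and [G]; it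
    appears when the derivative falls on the cutoff. *)
Let M (x : 'rV[R]_n) : R := \sum_(j < n) \sum_(i < n) G i j * (g1 j x * N' i x).

Let ME x : M x = 2 * hdot (D2 x) (tensor (ten V V) (DG x) (DG x)).
Proof.
rewrite hdot_suml mulr_sumr /M exchange_big/=; apply: eq_bigr => i _.
rewrite tensor_dot hdot_comb hdot_sumr mulrA mulr_sumr; apply: eq_bigr => j _.
rewrite hdotZr -/(G i j).
have -> : N' i x = 2 * \sum_(k < n) \sum_(l < n) G k l * (g2 i k x * g1 l x).
  set S1 := \sum_(k < n) _.
  have e : \sum_(k < n) \sum_(l < n) G k l * (g1 k x * g2 i l x) = S1.
    rewrite exchange_big/=; apply: eq_bigr => k _; apply: eq_bigr => l _.
    by rewrite [G l k]hdotC -/(G k l); ring.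
  rewrite mulr_natl mulr2n -{2}e /N' -big_split/=; apply: eq_bigr => k _.
  by rewrite -big_split/=; apply: eq_bigr => l _; ring.
by ring.
Qed.

(** Cauchy-Schwarz in the tensor product applied to [ME], where [DG] tensored with itself has norm
    [|DG|^2]. *)
Let M_le x : `|M x| <= 2 * (`|D2 x| * N x).
Proof.
rewrite ME normrM ger0_norm// ler_wpM2l// NE.
apply: (le_trans (cauchy_schwarz _ _)); rewrite ler_wpM2l//.
rewrite -ler_sqr ?nnegrE ?sqr_ge0// -hdot_norm tensor_dot hdot_norm.
by rewrite -expr2.
Qed.

Variables (f : 'rV[R]_n -> R) (p : 'I_n -> 'rV[R]_n -> R).
Hypothesis cf : c1 f p.
Let DF x := \sum_(i < n) p i x *: phi i.
Variables (h : R -> R) (c lam : R).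
Hypotheses (ch : continuous h) (h01 : forall y, 0 <= h y <= 1).
Hypotheses (c0 : 0 < c) (lam0 : 0 < lam).

Let young (y z : R) : `|y * z| <= 2^-1 * (lam * y ^+ 2 + lam^-1 * z ^+ 2).
Proof.
have -> : `|y * z| = `|y| * `|z| by exact: normrM.
rewrite -[y ^+ 2]real_normK ?num_real// -[z ^+ 2]real_normK ?num_real//.
rewrite -subr_ge0 (_ : _ - _ = 2^-1 * (lam^-1 * (lam * `|y| - `|z|) ^+ 2)).
  by rewrite mulr_ge0 ?invr_ge0// mulr_ge0 ?sqr_ge0 ?invr_ge0 ?(ltW lam0).
by field; rewrite gt_eqF.
Qed.

Let sqr_sum_le (y z : R) : (y + z) ^+ 2 <= 2 * (y ^+ 2 + z ^+ 2).
Proof. by have := sqr_ge0 (y - z); rewrite !expr2; nra. Qed.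

Let dist2 (x : 'rV[R]_n) : R := (f x - g x) ^+ 2 + `|DF x - DG x| ^+ 2.

Let dist2E x : dist2 x = (f x - g x) * (f x - g x) +
  \sum_(i < n) \sum_(j < n) G i j * ((p i x - g1 i x) * (p j x - g1 j x)).
Proof.
rewrite /dist2 expr2; congr (_ + _).
have -> : DF x - DG x = \sum_(i < n) (p i x - g1 i x) *: phi i.
  by rewrite /DF /DG -sumrB; apply: eq_bigr => i _; rewrite scalerBl.
by rewrite -hdot_norm hdot_comb.
Qed.

(** The variable [B] on the left and [Z] differ by [S - u delta], where [u] is the test function,
    and this has mean 0 by duality. Unlike [B], [Z] is small with [F - G]: Young's inequality bounds
    it pointwise by [U], and [second_moment_delta] evaluates the mean of [U]. *)
Lemma smooth_estimate :
  `|\int[P]_w ((h (f (X w)) - h (g (X w))) * cutweight c `|DG (X w)|)| <=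
  2^-1 * (lam * \int[P]_w ((f (X w) - g (X w)) ^+ 2 + `|DF (X w) - DG (X w)| ^+ 2)
    + lam^-1 * (8 / c ^+ 4 * (\int[P]_w (`|DG (X w)| ^+ 2)
      + 2 * \int[P]_w (`|D2 (X w)| ^+ 2)) + 4 / c ^+ 2)).
Proof.
have [r rd] := primitive_ex ch.
have hn y : `|h y| <= 1 by have /andP[h0 h1] := h01 y; rewrite ger0_norm.
have rl x y := derive_bounded_lipschitz rd hn x y.
pose K := `|r 0| + 1.
have rK y : `|r y| <= K * (1 + `|y|).
  have := rl 0 y; rewrite subr0 mul1r => ry.
  have := ler_normD (r y - r 0) (r 0); rewrite subrK /K.
  by have := normr_ge0 (r 0); have := normr_ge0 y; nra.
have hK y : `|h y| <= K * (1 + `|y|).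
  rewrite (le_trans (hn y))// /K.
  by have := normr_ge0 (r 0); have := normr_ge0 y; nra.
have cTh : c1 (fun x => cutinv c (N x)) (fun i x => cutinv' c (N x) * N' i x).
  exact: (c1_comp (is_derive_cutinv c0) (continuous_cutinv' c0)
    (cutinv_growth c0) (cutinv'_growth c0) cN).
(* [cPsi] times [cTh] is the test function for the duality with [delta]. *)
have cPsi : c1 (fun x => r (f x) - r (g x)) (fun i x => h (f x) * p i x - h (g x) * g1 i x).
  by apply: c1B; [exact: (c1_comp rd ch rK hK cf)|exact: (c1_comp rd ch rK hK cg)].
have cu := c1M cPsi cTh.
have [pf _ _] := cf; have [pg _ _] := cg.
have [pTh _ _] := cTh; have [pPsi _ _] := cPsi; have [pu pu' _] := cu.
pose hfg x := \sum_(i < n) \sum_(j < n) G i j * (p i x * g1 j x).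
have hfgE x : hfg x = hdot (DF x) (DG x) by rewrite hdot_comb.
pose B x := (h (f x) - h (g x)) * (N x * cutinv c (N x)).
(* The divergence of [cutinv (|DG|^2) DG]: the factor times [delta], minus the scalar product of the
   derivatives of the factor and of [g (X)]. *)
pose Rm x := cutinv c (N x) * delta x - cutinv' c (N x) * M x.
pose Z x := (r (f x) - r (g x)) * Rm x -
  h (f x) * (cutinv c (N x) * hdot (DF x - DG x) (DG x)).
pose U x := 2^-1 * (lam * dist2 x + lam^-1 * (8 / c ^+ 4 * (delta x * delta x + Q x)
   + 4 / c ^+ 2)).
have pB : pc B.
  apply: pcM; last exact: pcM.
  by apply: pcB; [exact: (pc_bounded_comp ch hn pf)|exact: (pc_bounded_comp ch hn pg)].
have pd2 : pc dist2.
  rewrite (funext dist2E); apply: pcD; first by apply: pcM; exact: pcB.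
  have [_ pp _] := cf.
  by apply: pc_sum => i _; apply: pc_sum => j _; apply: pcZ; apply: pcM; apply: pcB.
have pU : pc U.
  apply: pcZ; apply: pcD; first exact: pcZ.
  by apply: pcZ; apply: pcD; [apply: pcZ; apply: pcD => //; exact: pcM|exact: pc_cst].
(* The integrand that duality with [delta] assigns to the test function
   [(r(F) - r(G)) cutinv (|DG|^2)]. *)
pose S x := \sum_(j < n) \sum_(i < n) G i j * (g1 j x *
  ((h (f x) * p i x - h (g x) * g1 i x) * cutinv c (N x) +
   (r (f x) - r (g x)) * (cutinv' c (N x) * N' i x))).
have pS : pc S.
  apply: pc_sum => j _; apply: pc_sum => i _; apply: pcZ; apply: pcM => //; exact: pu'.
have SE x : S x = cutinv c (N x) * (h (f x) * hfg x - h (g x) * N x) +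
    (r (f x) - r (g x)) * (cutinv' c (N x) * M x).
  have -> : M x = \sum_(i < n) \sum_(j < n) G i j * (g1 j x * N' i x).
    by rewrite /M exchange_big.
  rewrite /S /hfg exchange_big/=.
  have E (n' : 'I_n -> R) (t t' D : R) : \sum_(i < n) \sum_(j < n) G i j * (g1 j x *
      ((h (f x) * p i x - h (g x) * g1 i x) * t + D * (t' * n' i))) =
    t * (h (f x) * (\sum_(i < n) \sum_(j < n) G i j * (p i x * g1 j x)) - h (g x) * N x) +
    D * (t' * \sum_(i < n) \sum_(j < n) G i j * (g1 j x * n' i)).
    rewrite /N !mulr_sumr -sumrB mulr_sumr -big_split/=; apply: eq_bigr => i _.
    rewrite !mulr_sumr -sumrB mulr_sumr -big_split/=; apply: eq_bigr => j _; ring.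
  exact: E.
have ZE x : Z x = B x - S x + (r (f x) - r (g x)) * cutinv c (N x) * delta x.
  rewrite SE /Z /B /Rm hdotBl -hfgE hdot_norm -NE; ring.
have EZ : EX B = EX Z.
  have pud : pc (fun x => (r (f x) - r (g x)) * cutinv c (N x) * delta x) by exact: pcM.
  rewrite (eqEX ZE) EXD//; last exact: pcB.
  by rewrite EXB// (dual cu) subrK.
have pZ : pc Z.
  rewrite (funext ZE); apply: pcD; first exact: pcB.
  exact: pcM.
have ZU x : `|Z x| <= U x.
  have N0 : 0 <= N x by rewrite NE sqr_ge0.
  have c2 : 0 < c ^+ 2 by rewrite exprn_gt0.
  have t1 : `|(r (f x) - r (g x)) * Rm x| <=
      2^-1 * (lam * (f x - g x) ^+ 2 + lam^-1 * Rm x ^+ 2).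
    apply: (le_trans (young _ _)); rewrite ler_wpM2l ?invr_ge0// lerD2r.
    rewrite ler_wpM2l ?(ltW lam0)//.
    rewrite -[leLHS]real_normK ?num_real// -[leRHS]real_normK ?num_real//.
    by apply: lerXn2r; rewrite ?nnegrE// (le_trans (rl _ _))// mul1r.
  have t2 : `|h (f x) * (cutinv c (N x) * hdot (DF x - DG x) (DG x))| <=
      2^-1 * (lam * `|DF x - DG x| ^+ 2 + lam^-1 * (4 / c ^+ 2)).
    apply: (le_trans (y := `| (`|DF x - DG x| * (2 / c))%R |)); last first.
      apply: (le_trans (young _ _)); rewrite le_eqVlt; apply/orP; left; apply/eqP.
      by field; rewrite !gt_eqF.
    rewrite normrM [leRHS]ger0_norm; last first.
      by rewrite mulr_ge0// divr_ge0// ltW.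
    rewrite -[leRHS]mul1r ler_pM// normrM (ger0_norm (cutinv_ge0 c N0)).
    apply: (le_trans (ler_wpM2l (cutinv_ge0 c N0) (cauchy_schwarz _ _))).
    rewrite mulrCA ler_wpM2l// mulrC NE.
    exact: norm_mul_cutinv_le.
  have t3 : Rm x ^+ 2 <= 8 / c ^+ 4 * (delta x * delta x + Q x).
    apply: (le_trans (sqr_sum_le _ _)).
    (* Both terms of [Rm] carry a factor [2 / c^2]: the first from [cutinv_le], the second from
       [M_le] combined with [mul_cutinv'_le]. The outer 2 comes from squaring a sum. *)
    have -> : 8 / c ^+ 4 = 2 * (2 / c ^+ 2) ^+ 2 by field; rewrite gt_eqF.
    rewrite -[2 * _ * _]mulrA ler_wpM2l// mulrDr; apply: lerD.
      rewrite exprMn -expr2 ler_wpM2r ?sqr_ge0//.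
      apply: lerXn2r; rewrite ?nnegrE ?divr_ge0 ?(ltW c2) ?cutinv_ge0//.
      exact: cutinv_le.
    rewrite sqrrN -[leLHS]real_normK ?num_real// QE -exprMn.
    apply: lerXn2r; first by rewrite nnegrE.
      by rewrite nnegrE; apply: mulr_ge0 => //; rewrite divr_ge0// ltW.
    rewrite normrM.
    apply: (le_trans (ler_wpM2l (normr_ge0 _) (M_le x))).
    rewrite [leLHS](_ : _ = 2 * (N x * `|cutinv' c (N x)|) * `|D2 x|); last by ring.
    rewrite ler_wpM2r// ler_wpM2l//.
    exact: mul_cutinv'_le.
  rewrite /Z (le_trans (ler_normB _ _))// (le_trans (lerD t1 t2))//.
  rewrite /U /dist2 -mulrDr ler_wpM2l ?invr_ge0//.
  rewrite addrACA -mulrDr -mulrDr lerD2l ler_wpM2l ?invr_ge0 ?(ltW lam0)//.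
  by rewrite lerD2r.
have -> : \int[P]_w ((h (f (X w)) - h (g (X w))) * cutweight c `|DG (X w)|) = EX B.
  by apply: eq_Rintegral => w _; rewrite /B NE.
rewrite EZ; apply: (le_trans (y := EX U)).
  rewrite ler_norml; apply/andP; split.
    rewrite lerNl -mulN1r -EXZ//; apply: EX_le => // [|x]; first exact: pcZ.
    by rewrite mulN1r; have := ZU x; rewrite ler_norml => /andP[+ _]; rewrite lerNl.
  by apply: EX_le => // x; have := ZU x; rewrite ler_norml => /andP[].
have pdd : pc (fun x => delta x * delta x) by exact: pcM.
have pddQ : pc (fun x => delta x * delta x + Q x) by exact: pcD.
rewrite /U EXZ; last first.
  apply: pcD; first exact: pcZ.
  by apply: pcZ; apply: pcD; [exact: pcZ|exact: pc_cst].
rewrite ler_wpM2l ?invr_ge0// EXD; last 2 first.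
- exact: pcZ.
- by apply: pcZ; apply: pcD; [exact: pcZ|exact: pc_cst].
rewrite EXZ// lerD2l EXZ; last by apply: pcD; [exact: pcZ|exact: pc_cst].
rewrite ler_wpM2l ?invr_ge0 ?(ltW lam0)// EXD; last 2 first.
- exact: pcZ.
- exact: pc_cst.
have EC a : EX (fun=> a) = a by exact: Rint_cst.
rewrite EXZ// EXD// second_moment_delta EC lerD2r.
rewrite -addrA -[EX Q + EX Q]mulr2n -[EX Q *+ 2]mulr_natl.
by rewrite (eqEX NE) (eqEX QE).
Qed.

End SmoothEstimate.

(** * Total variation and Lipschitz test functions *)

Lemma max_max_lipschitz (R : realType) (a b h k : R) :
  `|Num.max a b - Num.max h k| <= `|a - h| + `|b - k|.
Proof.
rewrite (_ : _ - _ = (Num.max a b - Num.max h b) + (Num.max h b - Num.max h k)); last by ring.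
apply: (le_trans (ler_normD _ _)); apply: lerD.
  by rewrite -[leRHS]mul1r; exact: max_lipschitz.
by rewrite ![Num.max h _]maxC -[leRHS]mul1r; exact: max_lipschitz.
Qed.

Section TotalVariation.
Context d (Omega : measurableType d) (R : realType) (P : probability Omega R).
Variables (X Y : Omega -> R).
Hypotheses (mX : measurable_fun setT X) (mY : measurable_fun setT Y).

Definition lipschitz01 (h : R -> R) := (forall x, 0 <= h x <= 1) /\
  exists L, forall x y, `|h x - h y| <= L * `|x - y|.

Let err (Z : Omega -> R) (u v : R -> R) := \int[P]_w `|u (Z w) - v (Z w)|.

Let m01 (u : R -> R) := measurable_fun setT u /\ forall x, 0 <= u x <= 1.

Let m01_lip h : lipschitz01 h -> m01 h.
Proof.
move=> [h01 [L hL]]; split => //; apply: continuous_measurable_fun.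
exact: lipschitz_bound_continuous hL.
Qed.

Let m01_indic (A : set R) : measurable A -> m01 (\1_A).
Proof.
move=> mA; split; first exact: measurable_indic.
by move=> x; rewrite indicE; case: (_ \in _); rewrite ?lexx ?ler01.
Qed.

Let mdiff (Z : Omega -> R) u v : measurable_fun setT Z -> m01 u -> m01 v ->
  measurable_fun setT (fun w => `|u (Z w) - v (Z w)|) /\
  forall w, `| (`|u (Z w) - v (Z w)|) | <= 1.
Proof.
move=> mZ [mu u01] [mv v01]; split.
  apply: measurableT_comp => //; apply: measurable_funB.
    exact: (measurableT_comp mu mZ).
  exact: (measurableT_comp mv mZ).
move=> w; rewrite normr_id ler_norml.
by have /andP[? ?] := u01 (Z w); have /andP[? ?] := v01 (Z w); apply/andP; split; lra.
Qed.

Let idiff (Z : Omega -> R) u v : measurable_fun setT Z -> m01 u -> m01 v ->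
  L1 P (fun w => `|u (Z w) - v (Z w)|).
Proof. by move=> mZ mu mv; have [a b] := mdiff mZ mu mv; exact: L1_bounded a b. Qed.

Let err_tri Z u v t : measurable_fun setT Z -> m01 u -> m01 v -> m01 t ->
  err Z u t <= err Z u v + err Z v t.
Proof.
move=> mZ mu mv mt; rewrite /err -RintD; [|exact: idiff|exact: idiff].
apply: le_Rint => [||w]; [exact: idiff|apply: L1D; exact: idiff|].
exact: ler_distD.
Qed.

Let err_lim Z (u_ : nat -> R -> R) u : measurable_fun setT Z -> (forall n, m01 (u_ n)) ->
  m01 u -> (forall x, u_ n x @[n --> \oo] --> u x) -> err Z u (u_ n) @[n --> \oo] --> 0.
Proof.
move=> mZ mu_ mu cu.
have [] := @cvg_Rint _ _ _ P (fun n w => `|u (Z w) - u_ n (Z w)|) (fun=> 0) (fun=> 1).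
- by move=> n; have [] := mdiff mZ mu (mu_ n).
- move=> w; rewrite -(normr0 R) -(subrr (u (Z w))); apply: cvg_norm.
  by apply: cvgB; [exact: cvg_cst|exact: cu].
- exact: L1_cst.
- by move=> n w; have [_] := mdiff mZ mu (mu_ n); apply.
by move=> _; rewrite Rint0.
Qed.

(** One Lipschitz function must serve both laws at once, since it is tested on the difference of
    expectations. The sets with this property are shown to form a sigma-algebra containing the
    rays. *)
Let approx (A : set R) := measurable A /\ forall e, 0 < e ->
  exists2 h, lipschitz01 h & err X (\1_A) h <= e /\ err Y (\1_A) h <= e.

Let approx_lim (u_ : nat -> R -> R) A : measurable A ->
  (forall n, m01 (u_ n)) -> (forall x, u_ n x @[n --> \oo] --> (\1_A x : R)) ->
  (forall n e, 0 < e -> exists2 h, lipschitz01 h & err X (u_ n) h <= e /\ err Y (u_ n) h <= e) ->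
  approx A.
Proof.
move=> mA mu cu au; split => // e e0; have e2 : 0 < e / 2 by rewrite divr_gt0.
have mi := m01_indic mA.
have cX := err_lim mX mu mi cu; have cY := err_lim mY mu mi cu.
have /cvgr0_norm_le/(_ _ e2) NX := cX; have /cvgr0_norm_le/(_ _ e2) NY := cY.
have [n [nX nY]] : exists n, err X (\1_A) (u_ n) <= e / 2 /\ err Y (\1_A) (u_ n) <= e / 2.
  near \oo => n; exists n; split.
    by rewrite (le_trans (ler_norm _))//; near: n.
  by rewrite (le_trans (ler_norm _))//; near: n.
have [h lh [hX hY]] := au n _ e2; exists h => //; have mh := m01_lip lh.
by split; rewrite [e]splitr; [apply: (le_trans (err_tri mX mi (mu n) mh))|
  apply: (le_trans (err_tri mY mi (mu n) mh))]; exact: lerD.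
Unshelve. all: by end_near. Qed.

(** Ramps of slope [n + 1] ending at [a]: they vanish from [a] on and, at each point to the left of
    [a], are eventually 1. *)
Let approx_ray a : approx `]-oo, a[%classic.
Proof.
pose u n x : R := Num.min (Num.max (n.+1%:R * (a - x)) 0) 1.
have lu n : lipschitz01 (u n).
  split.
    by move=> x; rewrite /u le_min le_max lexx orbT ler01/= ge_min lexx orbT.
  exists n.+1%:R => x y; apply: (le_trans (min_lipschitz _ _ _)); rewrite mul1r.
  apply: (le_trans (max_lipschitz _ _ _)); rewrite mul1r -mulrBr normrM ger0_norm//.
  by rewrite ler_wpM2l// [leRHS]distrC (_ : a - x - (a - y) = y - x)//; ring.
apply: (@approx_lim u) => //.
- by move=> n; exact: m01_lip.
- move=> x; apply: cvg_near_cst; rewrite indicE.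
  have [xa|ax] := ltP x a; last first.
    rewrite (_ : (x \in `]-oo, a[%classic) = false); last first.
      by apply/negbTE; rewrite notin_setE/= in_itv/= => h; move: (lt_le_trans h ax); rewrite ltxx.
    near=> n; rewrite /u max_r ?min_l//.
    by rewrite mulr_ge0_le0// subr_le0.
  rewrite (_ : (x \in `]-oo, a[%classic) = true); last by apply/mem_set; rewrite /= in_itv.
  near=> n; have ax0 : 0 < a - x by rewrite subr_gt0.
  rewrite /u max_l ?mulr_ge0 ?(ltW ax0)// min_r// -ler_pdivrMr// div1r.
  near: n; have := nbhs_infty_ger (a - x)^-1; apply: filterS => n /= /le_trans; apply.
  by rewrite ler_nat.
- move=> n e e0; exists (u n); first exact: lu.
  have z Z : err Z (u n) (u n) = 0.
    by rewrite -[RHS](Rint0 P); apply: eq_Rintegral => w _; rewrite subrr normr0.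
  by rewrite !z; split; exact: ltW.
Unshelve. all: by end_near. Qed.

Let err_le1 Z A h B k C l : measurable_fun setT Z -> m01 A -> m01 h -> m01 B -> m01 k ->
  m01 C -> m01 l ->
  (forall x, `|C x - l x| <= `|A x - h x| + `|B x - k x|) ->
  err Z C l <= err Z A h + err Z B k.
Proof.
move=> mZ mA mh mB mk mC ml hl; rewrite /err -RintD; [|exact: idiff|exact: idiff].
apply: le_Rint => [||w]; [exact: idiff|apply: L1D; exact: idiff|].
exact: hl.
Qed.

Let approxU A B : approx A -> approx B -> approx (A `|` B).
Proof.
move=> [mA aA] [mB aB]; have mAB := measurableU _ _ mA mB.
split => // e e0; have e2 : 0 < e / 2 by rewrite divr_gt0.
have [h lh [hX hY]] := aA _ e2; have [k lk [kX kY]] := aB _ e2.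
have mh := m01_lip lh; have mk := m01_lip lk.
pose l x := Num.max (h x) (k x).
have ll : lipschitz01 l.
  have [h01 [L hL]] := lh; have [k01 [M kM]] := lk; split.
    by move=> x; rewrite /l le_max ge_max; case/andP: (h01 x) => -> ->; case/andP: (k01 x) => _ ->.
  exists (L + M) => x y; rewrite mulrDl /l.
  by apply: (le_trans (max_max_lipschitz _ _ _ _)); exact: lerD.
have ml := m01_lip ll.
have D x : `|(\1_(A `|` B) x : R) - l x| <= `|(\1_A x : R) - h x| + `|(\1_B x : R) - k x|.
  have -> : \1_(A `|` B) x = Num.max (\1_A x) (\1_B x) :> R; last exact: max_max_lipschitz.
  rewrite !indicE in_setU; case: (x \in A); case: (x \in B) => /=.
  - by rewrite maxxx.
  - by rewrite max_l.
  - by rewrite max_r.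
  - by rewrite maxxx.
exists l => //; split; rewrite [e]splitr.
  by apply: (le_trans (err_le1 mX (m01_indic mA) mh (m01_indic mB) mk (m01_indic mAB) ml D)); exact: lerD.
by apply: (le_trans (err_le1 mY (m01_indic mA) mh (m01_indic mB) mk (m01_indic mAB) ml D)); exact: lerD.
Qed.

Let approx0 : approx set0.
Proof.
split; first exact: measurable0.
move=> e e0; exists (fun=> 0).
  split; first by move=> x; rewrite lexx ler01.
  by exists 0 => x y; rewrite subrr normr0 mul0r.
have z Z : err Z (\1_set0) (fun=> 0) = 0.
  by rewrite -[RHS](Rint0 P); apply: eq_Rintegral => w _; rewrite indicE in_set0 subrr normr0.
by rewrite !z; split; exact: ltW.
Qed.

Let approxC A : approx A -> approx (~` A).
Proof.
move=> [mA aA]; split; first exact: measurableC.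
move=> e e0; have [h lh [hX hY]] := aA e e0; exists (fun x => 1 - h x).
  have [h01 [L hL]] := lh; split.
    by move=> x; have /andP[? ?] := h01 x; apply/andP; split; lra.
  exists L => x y; rewrite (_ : _ - _ = h y - h x) 1?distrC//; ring.
have z Z : err Z (\1_(~` A)) (fun x => 1 - h x) = err Z (\1_A) h.
  apply: eq_Rintegral => w _; rewrite !indicE in_setC.
  by case: (_ \in _) => /=; rewrite distrC; congr `| _ |; ring.
by rewrite !z.
Qed.

(** Indicators of the finite unions are eventually constant at every point, so [approx_lim] applies;
    finite unions come from maxima of Lipschitz functions. *)
Let approx_bigcup (F : nat -> set R) : (forall k, approx (F k)) -> approx (\bigcup_k F k).
Proof.
move=> aF; pose B n := \big[setU/set0]_(k < n) F k.
have aB n : approx (B n).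
  elim: n => [|n IH]; first by rewrite /B big_ord0; exact: approx0.
  by rewrite /B big_ord_recr/=; exact: approxU.
apply: (@approx_lim (fun n => \1_(B n))).
- by apply: bigcup_measurable => k _; case: (aF k).
- by move=> n; apply: m01_indic; case: (aB n).
- move=> x; apply: cvg_near_cst; rewrite !indicE.
  have [[k _ Fk]|nF] := pselect ((\bigcup_k F k) x).
    rewrite (_ : x \in \bigcup_k F k); last by rewrite inE; exists k.
    near=> n; rewrite indicE (_ : x \in B n)// inE /B -bigcup_mkord.
    by exists k => //=; near: n; exact: nbhs_infty_gt.
  rewrite (_ : (x \in \bigcup_k F k) = false); last by apply/negbTE; rewrite notin_setE.
  near=> n; rewrite indicE (_ : (x \in B n) = false)//; apply/negbTE; rewrite notin_setE.
  by rewrite /B -bigcup_mkord => -[k _ Fk]; apply: nF; exists k.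
- by move=> n e e0; exact: (aB n).2.
Unshelve. all: by end_near. Qed.

Let approx_measurable A : measurable A -> approx A.
Proof.
have : (@RGenInftyO.G R).-sigma.-measurable `<=` approx.
  apply: smallest_sub; last by move=> _ [a ->]; exact: approx_ray.
  split; [exact: approx0| |exact: approx_bigcup].
  by move=> B aB; rewrite setTD; exact: approxC.
rewrite -RGenInftyO.measurableE => h mA; exact: h.
Qed.

(** The bound [K] does not involve the Lipschitz constant, so approximating the indicator of each
    Borel set in L^1 of both laws loses nothing in the limit. *)
Lemma tv_of_lipschitz K :
  (forall h, lipschitz01 h -> `|\int[P]_w h (X w) - \int[P]_w h (Y w)| <= K) ->
  (dTV P X Y <= K%:E)%E.
Proof.
move=> hK; apply: ub_ereal_sup => _ [A mA <-].
have mi := m01_indic mA.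
have PE (Z : Omega -> R) : measurable_fun setT Z ->
    P (Z @^-1` A) = (\int[P]_w (\1_A (Z w)))%:E.
  move=> mZ; have mZA : measurable (Z @^-1` A) by rewrite -[_ @^-1` _]setTI; exact: mZ.
  transitivity (\int[P]_w (\1_(Z @^-1` A) w)%:E)%E; first by rewrite integral_indic// setIT.
  rewrite L1_Efin//; apply: (@L1_bounded _ _ _ _ _ 1) => //.
  by move=> w; rewrite indicE; case: (_ \in _); rewrite ?normr1 ?normr0.
rewrite !PE// -EFinB /= lee_fin; apply/ler_addgt0Pr => e e0.
have e2 : 0 < e / 2 by rewrite divr_gt0.
have [_ /(_ _ e2)[h lh [hX hY]]] := approx_measurable mA.
have mh := m01_lip lh.
have i1 (Z : Omega -> R) u : measurable_fun setT Z -> m01 u -> L1 P (fun w => u (Z w)).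
  move=> mZ [mu u01]; apply: (@L1_bounded _ _ _ _ _ 1); first exact: (measurableT_comp mu).
  by move=> w; have /andP[? ?] := u01 (Z w); rewrite ger0_norm.
have D (Z : Omega -> R) : measurable_fun setT Z ->
    `|\int[P]_w (\1_A (Z w)) - \int[P]_w h (Z w)| <= err Z (\1_A) h.
  move=> mZ; rewrite -RintB; [|exact: (i1 _ _ mZ mi)|exact: i1].
  apply: le_norm_Rint; apply: L1B; [exact: (i1 _ _ mZ mi)|exact: i1].
have := D X mX; have := D Y mY; have := hK h lh.
rewrite !ler_norml => /andP[? ?] /andP[? ?] /andP[? ?]; apply/andP; split; lra.
Qed.

End TotalVariation.

(** * Cylindrical variables *)

Section Pullback.
Context (R : realType) (m n : nat) (e : 'I_m -> 'I_n).
Implicit Types x v : 'rV[R]_n.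

Definition pull x : 'rV[R]_m := \row_k x 0 (e k).

Lemma pull_norm_le x : `|pull x| <= `|x|.
Proof. by apply: row_norm_le => // k; rewrite mxE coord_norm_le. Qed.

Lemma pullZD h v x : pull (h *: v + x) = h *: pull v + pull x.
Proof. by apply/rowP => k; rewrite !mxE. Qed.

Lemma pull_continuous : continuous pull.
Proof.
move=> x; apply/(@cvgrPdist_le _ _ _ (nbhs x) (nbhs_filter x)) => r r0; apply/nbhs_ballP; exists r => //= y.
rewrite -ball_normE /= => /ltW xy.
have -> : pull x - pull y = pull (x - y) by apply/rowP => k; rewrite !mxE.
exact: le_trans (pull_norm_le _) xy.
Qed.

Lemma pc_pull (f : 'rV[R]_m -> R) : pc f -> pc (fun x => f (pull x)).
Proof.
move=> [cf /poly_growth_ge0[C [N [C0 fC]]]]; split.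
  by move=> x; apply: continuous_comp; [exact: pull_continuous|exact: cf].
exists C, N => x; apply: (le_trans (fC _)); rewrite ler_wpM2l// lerXn2r ?nnegrE ?addr_ge0//.
by rewrite lerD2l pull_norm_le.
Qed.

(** A coordinate of the large vector may feed several coordinates of the small one; by the chain
    rule its partial derivative adds up over the fibre of [e]. *)
Lemma c1_pull (f : 'rV[R]_m -> R) p : c1 f p ->
  c1 (fun x => f (pull x)) (fun i x => \sum_(k < m | e k == i) p k (pull x)).
Proof.
move=> [pf pp fp]; split; first exact: pc_pull.
  by move=> i; apply: pc_sum => k _; exact: pc_pull.
move=> x v; have [D dE] := fp (pull x) (pull v).
have E : (fun h => h^-1 *: (((fun x => f (pull x)) \o shift x) (h *: v) - f (pull x))) =
    (fun h => h^-1 *: ((f \o shift (pull x)) (h *: pull v) - f (pull x))).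
  by apply/funext => h /=; rewrite pullZD.
rewrite (_ : \sum_(i < n) _ = \sum_(k < m) pull v 0 k * p k (pull x)).
  by split; [rewrite /derivable E|rewrite /derive E].
rewrite (partition_big e xpredT)//=; apply: eq_bigr => i _; rewrite mulr_sumr.
by apply: eq_bigr => k /eqP <-; rewrite mxE.
Qed.

End Pullback.

Section SmoothVariables.
Context (R : realType).

(* [g1], [g2], [g3] are the arrays of partial derivatives of [g] of orders 1, 2
   and 3, the first index being the last one differentiated. *)
Definition c3 n (g : 'rV[R]_n -> R) g1 (g2 : 'I_n -> 'I_n -> 'rV[R]_n -> R)
    (g3 : 'I_n -> 'I_n -> 'I_n -> 'rV[R]_n -> R) :=
  [/\ c1 g g1, forall j, c1 (g1 j) (fun i => g2 i j),
      forall j k, c1 (g2 j k) (fun i => g3 i j k),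
      forall i j x, g2 i j x = g2 j i x &
      forall i j k x, g3 i j k x = g3 j i k x].

Lemma c3_pull m n (e : 'I_m -> 'I_n) g g1 g2 g3 : c3 g g1 g2 g3 ->
  c3 (fun x => g (pull e x)) (fun i x => \sum_(k < m | e k == i) g1 k (pull e x))
    (fun i j x => \sum_(l < m | e l == j) \sum_(k < m | e k == i) g2 k l (pull e x))
    (fun i j k x => \sum_(c < m | e c == k) \sum_(b < m | e b == j)
       \sum_(a < m | e a == i) g3 a b c (pull e x)).
Proof.
move=> [cg cg1 cg2 g2C g3C]; split.
- exact: c1_pull.
- move=> j; apply: (@c1_sum _ _ _ (index_enum 'I_m) (fun l => e l == j)
    (fun l x => g1 l (pull e x)) (fun l i x => \sum_(k < m | e k == i) g2 k l (pull e x))) => l _.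
  exact: (c1_pull e (cg1 l)).
- move=> j k; apply: (@c1_sum _ _ _ (index_enum 'I_m) (fun l => e l == k)
    (fun l x => \sum_(b < m | e b == j) g2 b l (pull e x)) (fun l i x =>
      \sum_(b < m | e b == j) \sum_(a < m | e a == i) g3 a b l (pull e x))) => l _.
  apply: (@c1_sum _ _ _ (index_enum 'I_m) (fun b => e b == j)
    (fun b x => g2 b l (pull e x)) (fun b i x =>
      \sum_(a < m | e a == i) g3 a b l (pull e x))) => b _.
  exact: (c1_pull e (cg2 b l)).
- move=> i j x; rewrite exchange_big; apply: eq_bigr => k _; apply: eq_bigr => l _.
  exact: g2C.
- move=> i j k x; apply: eq_bigr => c _; rewrite exchange_big.
  by apply: eq_bigr => a _; apply: eq_bigr => b _; exact: g3C.
Qed.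

Variable ten : forall V1 V2 : hilbertType R, hilbert_tensor V1 V2.
Context (V : hilbertType R) d (Omega : measurableType d) (P : probability Omega R).
Variable (I : V -> {RV P >-> R}).

Definition grad n (phi : 'I_n -> V) (g1 : 'I_n -> 'rV[R]_n -> R) x :=
  \sum_(i < n) g1 i x *: phi i.

Definition hess n (phi : 'I_n -> V) (g2 : 'I_n -> 'I_n -> 'rV[R]_n -> R) x :=
  \sum_(i < n) tensor (ten V V) (\sum_(k < n) g2 i k x *: phi k) (phi i).

(* A cylindrical variable over the vectors [phi], with its first two
   derivatives. *)
Definition cyl n (phi : 'I_n -> V) (x : Omega -> R) (dx : Omega -> V)
    (ddx : Omega -> ten V V) := exists g g1 g2 g3,
  let X w := \row_(i < n) I (phi i) w in
  [/\ c3 g g1 g2 g3, forall w, x w = g (X w), forall w, dx w = grad phi g1 (X w) &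
      forall w, ddx w = hess phi g2 (X w)].

(** Derivatives of the pull-back add up over the fibres of [e], and the vector [psi k = phi (e k)]
    is constant on a fibre, so the vector-valued derivatives are unchanged. *)
Lemma cyl_pull m n (e : 'I_m -> 'I_n) (psi : 'I_m -> V) (phi : 'I_n -> V) x dx ddx :
  (forall k, psi k = phi (e k)) -> cyl psi x dx ddx -> cyl phi x dx ddx.
Proof.
move=> pe [g [g1 [g2 [g3 [cg gx g1x g2x]]]]].
have cp := c3_pull e cg; do 4 eexists; split; first exact: cp.
- move=> w; rewrite gx; congr g; apply/rowP => k; rewrite !mxE pe //.
- move=> w; rewrite g1x /grad (partition_big e xpredT)//=; apply: eq_bigr => i _.
  rewrite scaler_suml; apply: eq_bigr => k /eqP ki; rewrite pe ki; congr (g1 k _ *: _).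
  by apply/rowP => l; rewrite !mxE pe.
- move=> w; rewrite g2x /hess.
  have -> : pull e (\row_i I (phi i) w) = \row_k I (psi k) w.
    by apply/rowP => l; rewrite !mxE pe.
  rewrite (partition_big e xpredT)//=; apply: eq_bigr => i _.
  transitivity (\sum_(a < m | e a == i)
      tensor (ten V V) (\sum_(b < m) g2 a b (\row_k I (psi k) w) *: psi b) (phi i)).
    by apply: eq_bigr => a /eqP <-; rewrite pe.
  rewrite -linear_sumlz; congr (tensor (ten V V) _ _).
  rewrite exchange_big (partition_big e xpredT)//=; apply: eq_bigr => j _.
  rewrite scaler_suml; apply: eq_bigr => b /eqP bj; rewrite scaler_suml.
  by apply: eq_bigr => a _; rewrite pe bj.
Qed.

(** The two families are concatenated and each variable is pulled back along its inclusion. The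
    smooth estimate needs both variables over the same vectors. *)
Lemma cyl_common m n (psi : 'I_m -> V) (phi : 'I_n -> V) x dx ddx y dy ddy :
  cyl psi x dx ddx -> cyl phi y dy ddy ->
  exists chi : 'I_(m + n) -> V, cyl chi x dx ddx /\ cyl chi y dy ddy.
Proof.
move=> cx cy; exists (fun i => match fintype.split i with inl k => psi k | inr k => phi k end).
split; [apply: (cyl_pull (e := @lshift m n)) cx|apply: (cyl_pull (e := @rshift m n)) cy] => k.
  by rewrite (unsplitK (inl k)).
by rewrite (unsplitK (inr k)).
Qed.

Lemma partial_sum_scale n (phi : 'I_n -> V) (a : 'I_n -> 'rV[R]_n -> R) i x :
  (forall k, derivable (a k) x (delta_mx 0 i)) ->
  partial i (fun y => \sum_(k < n) a k y *: phi k) x =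
  \sum_(k < n) partial i (a k) x *: phi k.
Proof.
move=> da; rewrite /partial.
have D k : is_derive x (delta_mx 0 i) (fun y => a k y *: phi k)
    ('D_(delta_mx 0 i) (a k) x *: phi k).
  have c : h^-1 *: (((fun y => a k y *: phi k) \o shift x) (h *: delta_mx 0 i)
      - a k x *: phi k) @[h --> 0^'] --> 'D_(delta_mx 0 i) (a k) x *: phi k.
    under eq_fun do rewrite /= -scalerBl scalerA.
    by apply: cvgZr_tmp; exact: (da k).
  by split; [apply/cvg_ex; eexists; exact: c|exact: cvg_lim c].
rewrite (_ : (fun y => _) = \sum_(k < n) (fun y => a k y *: phi k)).
  by have [_ ->] := is_derive_sum D.
by apply/funext => y; rewrite fct_sumE.
Qed.

Lemma cyl_smooth_jet (S : jet ten V Omega) : smooth_jet I S ->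
  exists n (phi : 'I_n -> V), cyl phi (jval S) (jder S 0) (jder S 1).
Proof.
move=> [n [g [phi [_ gs Sg dS]]]]; exists n, phi.
exists g, (fun i => iter_partial [:: i] g), (fun i j => iter_partial [:: i; j] g),
  (fun i j k => iter_partial [:: i; j; k] g); split.
- split.
  + exact: (c1_iter_partial [::] gs).
  + by move=> j; exact: (c1_iter_partial [:: j] gs).
  + by move=> j k; exact: (c1_iter_partial [:: j; k] gs).
  + by move=> i j x; exact: (partialC [::] i j x gs).
  + by move=> i j k x; exact: (partialC [:: k] i j x gs).
- exact: Sg.
- exact: (dS 0%N).
- move=> w; rewrite (dS 1%N) /hess /=; apply: eq_bigr => i _; congr (tensor _ _ _).
  by apply: partial_sum_scale => k; case: (gs [:: k]) => /(_ i) + _ _; exact.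
Qed.

End SmoothVariables.

Section CylindricalVariables.
Context (R : realType) (H T : R) d (Omega : measurableType d).
Variables (P : probability Omega R) (W : R -> {RV P >-> R}).
Variables (V : fbm_hilbert H T) (I : V -> {RV P >-> R}).
Hypotheses (W_fbm : is_fbm H T W) (I_isom : is_wiener_isometry W I).
Variable ten : forall V1 V2 : hilbertType R, hilbert_tensor V1 V2.
Variables (n : nat) (phi : 'I_n -> V).
Let X w := \row_(i < n) I (phi i) w.
Implicit Types (dx dy : Omega -> V) (ddx ddy : Omega -> ten V V).

Lemma measurable_dist (E : normedModType R) (D : Omega -> E) v :
  (forall A, open A -> measurable (D @^-1` A)) -> measurable_fun setT (fun w => `|D w - v|).
Proof.
move=> mD; apply: (measurability _ (RGenOpens.measurableE R)) => _ [_ [a [b ->] <-]].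
rewrite setTI; apply: (mD ((fun z => `|z - v|) @^-1` `]a, b[%classic)).
apply: open_comp; last exact: interval_open.
by move=> z _; apply: cvg_norm; apply: cvgB; [exact: cvg_id|exact: cvg_cst].
Qed.

Lemma measurable_dist_gauss (E : normedModType R) (D : Omega -> E) (Phi : 'rV[R]_n -> E) :
  (forall A, open A -> measurable (D @^-1` A)) -> continuous Phi ->
  measurable_fun setT (fun w => `|D w - Phi (X w)|).
Proof.
move=> mD cP; apply: (@measurable_caratheodory _ _ _ _ (fun i => I (phi i))
   (fun w z => `|D w - Phi (\row_i z i)|)).
- by move=> i; exact: measurable_wiener.
- by move=> y; exact: measurable_dist.
- move=> w z zy; apply: cvg_norm; apply: cvgB; first exact: cvg_cst.
  apply: (continuous_cvg _ (cP _)); exact: cvg_row.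
Qed.

Lemma continuous_sum_scale (E : normedModType R) k (a : 'I_k -> 'rV[R]_n -> R) (e : 'I_k -> E) :
  (forall i, continuous (a i)) -> continuous (fun x => \sum_(i < k) a i x *: e i).
Proof.
move=> ca x; apply: (@cvg_big _ _ _ _ _ add_continuous _ _ _ _ _ (nbhs_filter x)) => i _.
by apply: (@cvgZr_tmp _ _ _ _ (nbhs_filter x)); exact: ca.
Qed.

Lemma grad_continuous g1 : (forall i, pc (g1 i)) -> continuous (grad phi g1).
Proof. by move=> pg; apply: continuous_sum_scale => i; case: (pg i). Qed.

Lemma hess_continuous g2 : (forall i j, pc (g2 i j)) -> continuous (hess ten phi g2).
Proof.
move=> pg; rewrite (_ : hess ten phi g2 = fun x =>
    \sum_(i < n) \sum_(k < n) g2 i k x *: tensor (ten V V) (phi k) (phi i)).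
  move=> x; apply: (@cvg_big _ _ _ _ _ add_continuous _ _ _ _ _ (nbhs_filter x)) => i _.
  by apply: continuous_sum_scale => k; case: (pg i k).
apply/funext => x; apply: eq_bigr => i _; rewrite linear_sumlz.
by apply: eq_bigr => k _; rewrite linearZl_LR.
Qed.

Lemma pc_grad g1 : (forall i, pc (g1 i)) -> pc (fun x => `|grad phi g1 x| ^+ 2).
Proof.
move=> pg; rewrite (_ : (fun x => _) = fun x => \sum_(i < n) \sum_(j < n)
    hdot (phi i) (phi j) * (g1 i x * g1 j x)).
  by apply: pc_sum => i _; apply: pc_sum => j _; apply: pcZ; exact: pcM.
apply/funext => x; rewrite -hdot_norm hdot_suml; apply: eq_bigr => i _.
rewrite hdot_sumr; apply: eq_bigr => j _; rewrite hdotZl hdotZr; ring.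
Qed.

Lemma pc_hess g2 : (forall i j, pc (g2 i j)) -> pc (fun x => `|hess ten phi g2 x| ^+ 2).
Proof.
move=> pg; rewrite (_ : (fun x => _) = fun x => \sum_(i < n) \sum_(j < n)
    hdot (phi i) (phi j) * (\sum_(k < n) \sum_(l < n) hdot (phi k) (phi l) * (g2 i k x * g2 j l x))).
  apply: pc_sum => i _; apply: pc_sum => j _; apply: pcZ.
  by apply: pc_sum => k _; apply: pc_sum => l _; apply: pcZ; exact: pcM.
apply/funext => x; rewrite -hdot_norm hdot_suml; apply: eq_bigr => i _.
rewrite hdot_sumr; apply: eq_bigr => j _; rewrite tensor_dot mulrC; congr (_ * _).
rewrite hdot_suml; apply: eq_bigr => k _.
rewrite hdot_sumr; apply: eq_bigr => l _; rewrite hdotZl hdotZr; ring.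
Qed.
Lemma cyl_measurable x dx ddx : cyl I phi x dx ddx -> measurable_fun setT x.
Proof.
move=> [g [g1 [g2 [g3 [[[[cg _] _ _] _ _ _ _] gx _ _]]]]].
by rewrite (_ : x = fun w => g (X w)); [exact: (measurable_gauss I phi cg)|exact/funext].
Qed.

Lemma cyl_measurable_dist x dx ddx (D : Omega -> V) : cyl I phi x dx ddx ->
  (forall A, open A -> measurable (D @^-1` A)) -> measurable_fun setT (fun w => `|D w - dx w|).
Proof.
move=> [g [g1 [g2 [g3 [[[_ pg1 _] _ _ _ _] _ gx _]]]]] mD.
rewrite (_ : dx = fun w => grad phi g1 (X w)); last exact/funext.
by apply: measurable_dist_gauss => //; exact: grad_continuous.
Qed.

Lemma cyl_measurable_dist2 x dx ddx (D : Omega -> ten V V) : cyl I phi x dx ddx ->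
  (forall A, open A -> measurable (D @^-1` A)) -> measurable_fun setT (fun w => `|D w - ddx w|).
Proof.
move=> [g [g1 [g2 [g3 [[_ cg1 _ _ _] _ _ gx]]]]] mD.
rewrite (_ : ddx = fun w => hess ten phi g2 (X w)); last exact/funext.
apply: measurable_dist_gauss => //; apply: hess_continuous => i j.
by case: (cg1 j).
Qed.

Lemma cyl_measurableB x dx ddx y dy ddy : cyl I phi x dx ddx -> cyl I phi y dy ddy ->
  measurable_fun setT (fun w => `|dx w - dy w|).
Proof.
move=> [f [f1 [f2 [f3 [[[_ pf1 _] _ _ _ _] _ f1x _]]]]].
move=> [g [g1 [g2 [g3 [[[_ pg1 _] _ _ _ _] _ g1x _]]]]].
have cfg : continuous (fun x => `|grad phi f1 x - grad phi g1 x|).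
  move=> z; apply: (@cvg_norm _ _ _ _ (nbhs_filter z)).
  by apply: (@cvgB _ _ _ _ (nbhs_filter z)); exact: grad_continuous.
rewrite (_ : dx = fun w => grad phi f1 (X w)); last exact/funext.
rewrite (_ : dy = fun w => grad phi g1 (X w)); last exact/funext.
exact: (measurable_gauss I phi cfg).
Qed.

Lemma cyl_L1 x dx ddx : cyl I phi x dx ddx -> L1 P (fun w => `|dx w| ^+ 2).
Proof.
move=> [g [g1 [g2 [g3 [[[_ pg1 _] _ _ _ _] _ gx _]]]]].
rewrite (_ : dx = fun w => grad phi g1 (X w)); last exact/funext.
exact: (L1_gauss W_fbm I_isom phi (pc_grad pg1)).
Qed.

Lemma cyl_L12 x dx ddx : cyl I phi x dx ddx -> L1 P (fun w => `|ddx w| ^+ 2).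
Proof.
move=> [g [g1 [g2 [g3 [[_ cg1 _ _ _] _ _ gx]]]]].
rewrite (_ : ddx = fun w => hess ten phi g2 (X w)); last exact/funext.
have pg i j : pc (g2 i j) by case: (cg1 j).
exact: (L1_gauss W_fbm I_isom phi (pc_hess pg)).
Qed.

Lemma cyl_L1B x dx ddx y dy ddy : cyl I phi x dx ddx -> cyl I phi y dy ddy ->
  L1 P (fun w => (x w - y w) ^+ 2 + `|dx w - dy w| ^+ 2).
Proof.
move=> [f [f1 [f2 [f3 [[[pf pf1 _] _ _ _ _] fx f1x _]]]]].
move=> [g [g1 [g2 [g3 [[[pg pg1 _] _ _ _ _] gx g1x _]]]]].
rewrite (_ : (fun w => _) = fun w => (f (X w) - g (X w)) ^+ 2 +
    `|grad phi (fun i x => f1 i x - g1 i x) (X w)| ^+ 2).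
  apply: (L1_gauss W_fbm I_isom phi (f := fun x => (f x - g x) ^+ 2 +
    `|grad phi (fun i x => f1 i x - g1 i x) x| ^+ 2)).
  apply: pcD; first by apply: pcM; exact: pcB.
  by apply: pc_grad => i; exact: pcB.
apply/funext => w; rewrite fx gx f1x g1x; congr (_ + `| _ | ^+ 2).
by rewrite /grad -sumrB; apply: eq_bigr => i _; rewrite scalerBl.
Qed.

Lemma cyl_estimate x dx ddx y dy ddy (h : R -> R) c lam : cyl I phi x dx ddx -> cyl I phi y dy ddy ->
  continuous h -> (forall t : R, 0 <= h t <= 1) -> 0 < c -> 0 < lam ->
  `|\int[P]_w ((h (x w) - h (y w)) * cutweight c `|dy w|)| <=
  2^-1 * (lam * \int[P]_w ((x w - y w) ^+ 2 + `|dx w - dy w| ^+ 2) +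
    lam^-1 * (8 / c ^+ 4 * (\int[P]_w (`|dy w| ^+ 2) + 2 * \int[P]_w (`|ddy w| ^+ 2)) + 4 / c ^+ 2)).
Proof.
move=> [f [f1 [f2 [f3 [[cf _ _ _ _] fx f1x _]]]]].
move=> [g [g1 [g2 [g3 [[cg cg1 cg2 g2C g3C] gx g1x g2x]]]]] ch h01 c0 lam0.
have := smooth_estimate W_fbm I_isom ten phi cg cg1 cg2 g2C g3C cf ch h01 c0 lam0.
rewrite (_ : x = fun w => f (X w)); last exact/funext.
rewrite (_ : y = fun w => g (X w)); last exact/funext.
rewrite (_ : dx = fun w => grad phi f1 (X w)); last exact/funext.
rewrite (_ : dy = fun w => grad phi g1 (X w)); last exact/funext.
by rewrite (_ : ddy = fun w => hess ten phi g2 (X w)); last exact/funext.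
Qed.

End CylindricalVariables.

(** * Approximation in Sobolev spaces *)

Section SobolevApproximation.
Context (R : realType) (H T : R) d (Omega : measurableType d).
Variables (P : probability Omega R) (V : fbm_hilbert H T) (I : V -> {RV P >-> R}).
Variable ten : forall V1 V2 : hilbertType R, hilbert_tensor V1 V2.
Implicit Types (F S : jet ten V Omega).

Lemma sobolev_approx k p F e : 0 < p -> sobolev I k p F -> 0 < e ->
  exists S, smooth_jet I S /\
  (\int[P]_w (`|jval F w - jval S w| `^ p +
     \sum_(j < k) `|jder F j w - jder S j w| `^ p)%:E <= e%:E)%E.
Proof.
move=> p0 [_ _ [S [Ss cS]]] e0.
have q0 : 0 < e `^ p^-1 by rewrite powR_gt0.
have [m Sm] : exists m, (sobolev_norm P k p (jet_sub F (S m)) < (e `^ p^-1)%:E)%E.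
  have : \forall m \near \oo, (sobolev_norm P k p (jet_sub F (S m)) < (e `^ p^-1)%:E)%E.
    apply: (cS [set x | (x < (e `^ p^-1)%:E)%E]); apply: open_nbhs_nbhs.
    by split; [exact: open_ereal_lt_ereal|rewrite /= lte_fin].
  by case=> m _ /(_ m (leqnn m)) ?; exists m.
exists (S m); split => //; rewrite leNgt; apply/negP => eS.
move: Sm; apply/negP; rewrite -leNgt /sobolev_norm -poweR_EFin.
apply: gt0_ler_poweR; rewrite ?invr_ge0 ?(ltW p0)//.
- by rewrite in_itv/= leey lee_fin (ltW e0).
- rewrite in_itv/= leey andbT; apply: integral_ge0 => w _; rewrite lee_fin.
  by rewrite addr_ge0 ?powR_ge0// sumr_ge0// => j _; exact: powR_ge0.
- exact: ltW.
Qed.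

Lemma sobolev12_approx F e : sobolev I 1 2 F -> 0 < e ->
  exists S, [/\ smooth_jet I S, L1 P (fun w => (jval F w - jval S w) ^+ 2),
    L1 P (fun w => `|jder F 0 w - jder S 0 w| ^+ 2) &
    \int[P]_w ((jval F w - jval S w) ^+ 2 + `|jder F 0 w - jder S 0 w| ^+ 2) <= e].
Proof.
move=> sF e0; have [S [Ss Se]] := sobolev_approx (ltr0n _ 2) sF e0.
have [mF mD _] := sF; have {}mD := mD 0%N isT.
have [n [phi cS]] := cyl_smooth_jet Ss.
set Z := fun w => (jval F w - jval S w) ^+ 2 + `|jder F 0 w - jder S 0 w| ^+ 2.
have m1 : measurable_fun setT (fun w => (jval F w - jval S w) ^+ 2).
  apply: measurable_funX; apply: measurable_funB => //; exact: cyl_measurable cS.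
have m2 : measurable_fun setT (fun w => `|jder F 0 w - jder S 0 w| ^+ 2).
  by apply: measurable_funX; exact: (cyl_measurable_dist cS mD).
have mZ : measurable_fun setT Z by exact: measurable_funD.
have ZE : (\int[P]_w (Z w)%:E <= e%:E)%E.
  apply: le_trans Se; rewrite le_eqVlt; apply/orP; left; apply/eqP.
  apply: eq_integral => w _; rewrite big_ord_recl big_ord0 addr0 !powR_mulrn//.
  by rewrite real_normK ?num_real.
have iZ : L1 P Z.
  apply: L1_ge0 => //; first by move=> w; rewrite addr_ge0 ?sqr_ge0.
  exact: le_lt_trans ZE (ltry _).
exists S; split => //.
- by apply: L1_le iZ => // w; rewrite ger0_norm ?sqr_ge0// lerDl sqr_ge0.
- by apply: L1_le iZ => // w; rewrite ger0_norm ?sqr_ge0// lerDr sqr_ge0.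
- by rewrite -lee_fin -L1_Efin.
Qed.

Lemma sqr_le_expr4 (x r : R) : 0 < r -> x ^+ 2 <= 2^-1 * (r + r^-1 * x ^+ 4).
Proof.
move=> r0; rewrite -subr_ge0.
rewrite (_ : _ - _ = 2^-1 * r^-1 * (r - x ^+ 2) ^+ 2); last first.
  by field; rewrite gt_eqF.
by rewrite mulr_ge0 ?sqr_ge0// mulr_ge0 ?invr_ge0// ltW.
Qed.

(** Squares are controlled by [x^2 <= (r + x^4 / r) / 2]. The fourth powers are approximated to
    within [e r] with [r = e / 3], so the three squares integrate to at most [(3 r + e) / 2 = e]. *)
Lemma sobolev24_approx F e : sobolev I 2 4 F -> 0 < e ->
  exists S, smooth_jet I S /\
  [/\ L1 P (fun w => (jval F w - jval S w) ^+ 2),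
    L1 P (fun w => `|jder F 0 w - jder S 0 w| ^+ 2),
    L1 P (fun w => `|jder F 1 w - jder S 1 w| ^+ 2) &
    \int[P]_w ((jval F w - jval S w) ^+ 2 + `|jder F 0 w - jder S 0 w| ^+ 2 +
      `|jder F 1 w - jder S 1 w| ^+ 2) <= e].
Proof.
move=> sF e0; pose r := e / 3; have r0 : 0 < r by rewrite divr_gt0.
have q0 : 0 < e * r by rewrite mulr_gt0.
have [S [Ss Se]] := sobolev_approx (ltr0n _ 4) sF q0.
have [mF mD _] := sF; have mD1 := mD 0%N isT; have mD2 := mD 1%N isT.
have [n [phi cS]] := cyl_smooth_jet Ss.
have m1 : measurable_fun setT (fun w => jval F w - jval S w).
  apply: measurable_funB => //; exact: cyl_measurable cS.
have m2 : measurable_fun setT (fun w => `|jder F 0 w - jder S 0 w|).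
  exact: (cyl_measurable_dist cS mD1).
have m3 : measurable_fun setT (fun w => `|jder F 1 w - jder S 1 w|).
  exact: (cyl_measurable_dist2 cS mD2).
set a := fun w => jval F w - jval S w in m1 *.
set b := fun w => `|jder F 0 w - jder S 0 w| in m2 *.
set c := fun w => `|jder F 1 w - jder S 1 w| in m3 *.
pose Z w := a w ^+ 4 + b w ^+ 4 + c w ^+ 4.
have mZ : measurable_fun setT Z.
  by do 2 (apply: measurable_funD; last exact: measurable_funX); exact: measurable_funX.
have x40 (x : R) : 0 <= x ^+ 4 by rewrite exprn_even_ge0.
have ZE : (\int[P]_w (Z w)%:E <= (e * r)%:E)%E.
  apply: le_trans Se; rewrite le_eqVlt; apply/orP; left; apply/eqP.
  apply: eq_integral => w _; rewrite !big_ord_recl big_ord0 addr0 !powR_mulrn//.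
  by rewrite addrA -normrX ger0_norm// exprn_even_ge0.
have iZ : L1 P Z.
  apply: L1_ge0 => //; first by move=> w; rewrite !addr_ge0.
  exact: le_lt_trans ZE (ltry _).
have sq w : a w ^+ 2 + b w ^+ 2 + c w ^+ 2 <= 2^-1 * (3 * r + r^-1 * Z w).
  have := sqr_le_expr4 (a w) r0; have := sqr_le_expr4 (b w) r0.
  have := sqr_le_expr4 (c w) r0; rewrite /Z; lra.
have iU : L1 P (fun w => 2^-1 * (3 * r + r^-1 * Z w)).
  by apply: L1Z; apply: L1D; [exact: L1_cst|exact: L1Z].
have i1 : L1 P (fun w => a w ^+ 2).
  apply: L1_le iU => [|w]; first exact: measurable_funX.
  by rewrite ger0_norm ?sqr_ge0//; apply: le_trans (sq w); rewrite -addrA lerDl addr_ge0 ?sqr_ge0.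
have i2 : L1 P (fun w => b w ^+ 2).
  apply: L1_le iU => [|w]; first exact: measurable_funX.
  by rewrite ger0_norm ?sqr_ge0//; apply: le_trans (sq w); rewrite addrAC lerDr addr_ge0 ?sqr_ge0.
have i3 : L1 P (fun w => c w ^+ 2).
  apply: L1_le iU => [|w]; first exact: measurable_funX.
  by rewrite ger0_norm ?sqr_ge0//; apply: le_trans (sq w); rewrite lerDr addr_ge0 ?sqr_ge0.
exists S; split => //; split => //.
have i12 : L1 P (fun w => a w ^+ 2 + b w ^+ 2) by exact: L1D.
apply: (le_trans (y := \int[P]_w (2^-1 * (3 * r + r^-1 * Z w)))).
  by apply: le_Rint => //; exact: L1D.
have irZ : L1 P (fun w => r^-1 * Z w) by exact: L1Z.
have ic : L1 P (fun w => 3 * r) by exact: L1_cst.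
have iD : L1 P (fun w => 3 * r + r^-1 * Z w) by exact: L1D.
rewrite RintZ// RintD// Rint_cst RintZ//.
have : \int[P]_w Z w <= e * r by rewrite -lee_fin -L1_Efin.
rewrite [e * r]mulrC -(ler_pdivrMl _ _ r0) => h.
have -> : 3 * r = e by rewrite /r mulrC divfK.
lra.
Qed.

End SobolevApproximation.

(** * The estimate for Sobolev variables *)

Section Measure.
Context d (T : measurableType d) (R : realType) (P : probability T R).

(** The integral of a nonnegative function is a supremum over simple functions below it, which is
    monotone whether or not [g] is measurable. This is needed for [g] built from [|DF - DG|]. *)
Lemma le_integral_ge0 (f g : T -> \bar R) : (forall x, (0 <= f x)%E) ->
  (forall x, (f x <= g x)%E) -> (\int[P]_x f x <= \int[P]_x g x)%E.
Proof.
move=> f0 fg; have g0 x : (0 <= g x)%E by exact: le_trans (f0 x) (fg x).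
rewrite !ge0_integralTE//; apply: le_ereal_sup => _ [h /= hf <-].
by exists h => //= x; exact: le_trans (hf x) (fg x).
Qed.

(** Integrate [|t| <= (r + t^2 / r) / 2] with [r] the desired bound. *)
Lemma L1_abs_le (t : T -> R) r : measurable_fun setT t -> L1 P (fun w => t w ^+ 2) ->
  0 < r -> \int[P]_w (t w ^+ 2) <= r ^+ 2 ->
  L1 P (fun w => `|t w|) /\ \int[P]_w `|t w| <= r.
Proof.
move=> mt it r0 tr; have ri : 0 <= r^-1 by rewrite invr_ge0 ltW.
have tU w : `|t w| <= 2^-1 * (r + r^-1 * t w ^+ 2).
  rewrite -(real_normK (num_real (t w))) -subr_ge0.
  rewrite (_ : _ - _ = 2^-1 * r^-1 * (r - `|t w|) ^+ 2); last by field; rewrite gt_eqF.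
  by rewrite mulr_ge0 ?sqr_ge0// mulr_ge0.
have irt : L1 P (fun w => r^-1 * t w ^+ 2) by exact: L1Z.
have ir : L1 P (fun w => r) by exact: L1_cst.
have iU : L1 P (fun w => 2^-1 * (r + r^-1 * t w ^+ 2)) by apply: L1Z; exact: L1D.
have i1 : L1 P (fun w => `|t w|).
  apply: L1_le iU => [|w]; first exact: measurableT_comp.
  by rewrite normr_id.
split => //; apply: (le_trans (le_Rint i1 iU tU)).
rewrite RintZ; last exact: L1D.
rewrite RintD// Rint_cst RintZ//.
have : r^-1 * \int[P]_w (t w ^+ 2) <= r by rewrite ler_pdivrMl// -expr2.
lra.
Qed.

End Measure.

Lemma sqr_add3_le (R : realDomainType) (a b c : R) :
  (a + b + c) ^+ 2 <= 3 * (a ^+ 2 + b ^+ 2 + c ^+ 2).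
Proof.
have := sqr_ge0 (a - b); have := sqr_ge0 (b - c); have := sqr_ge0 (a - c).
rewrite !expr2; lra.
Qed.

Lemma sqr_norm3_le (R : realType) (E : normedModType R) (u v w : E) :
  `|v| ^+ 2 <= 3 * (`|u - v| ^+ 2 + `|u - w| ^+ 2 + `|w| ^+ 2).
Proof.
apply: le_trans (sqr_add3_le _ _ _); apply: lerXn2r; rewrite ?nnegrE ?addr_ge0//.
apply: (le_trans (y := `|u - v| + `|u|)).
  by have := ler_normB u (u - v); rewrite opprB addrC subrK addrC.
rewrite -addrA lerD2l.
by have := ler_normD (u - w) w; rewrite subrK.
Qed.

Section MainEstimate.
Context (R : realType) (H T : R) d (Omega : measurableType d).
Variables (P : probability Omega R) (W : R -> {RV P >-> R}).
Variables (V : fbm_hilbert H T) (I : V -> {RV P >-> R}).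
Hypotheses (W_fbm : is_fbm H T W) (I_isom : is_wiener_isometry W I).
Variable ten : forall V1 V2 : hilbertType R, hilbert_tensor V1 V2.
Implicit Types (F G S : jet ten V Omega).

(* The smooth approximations of [G] at distance at most 1 have bounded second
   derivatives in L^2, uniformly in the approximation. *)
Lemma moment_bound G : sobolev I 2 4 G -> exists2 K, 0 <= K & forall S,
  smooth_jet I S -> L1 P (fun w => `|jder G 0 w - jder S 0 w| ^+ 2) ->
  L1 P (fun w => `|jder G 1 w - jder S 1 w| ^+ 2) ->
  \int[P]_w (`|jder G 0 w - jder S 0 w| ^+ 2) <= 1 ->
  \int[P]_w (`|jder G 1 w - jder S 1 w| ^+ 2) <= 1 ->
  \int[P]_w (`|jder S 0 w| ^+ 2) + 2 * \int[P]_w (`|jder S 1 w| ^+ 2) <= K.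
Proof.
move=> sG; have [S0 [sS0 [_ i1 i2 _]]] := sobolev24_approx sG ltr01.
have [n0 [phi0 cS0]] := cyl_smooth_jet sS0.
have l1 := cyl_L1 W_fbm I_isom cS0; have l2 := cyl_L12 W_fbm I_isom cS0.
have nn (f : Omega -> R) : (forall w, 0 <= f w) -> 0 <= \int[P]_w f w.
  by move=> f0; apply: Rintegral_ge0.
have B (E : normedModType R) (D C C0 : Omega -> E) : L1 P (fun w => `|C w| ^+ 2) ->
    L1 P (fun w => `|D w - C w| ^+ 2) ->
    L1 P (fun w => `|D w - C0 w| ^+ 2) -> L1 P (fun w => `|C0 w| ^+ 2) ->
    \int[P]_w (`|D w - C w| ^+ 2) <= 1 ->
    \int[P]_w (`|C w| ^+ 2) <=
      3 * (1 + \int[P]_w (`|D w - C0 w| ^+ 2) + \int[P]_w (`|C0 w| ^+ 2)).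
  move=> iC iD iD0 iC0 D1.
  have iDD : L1 P (fun w => `|D w - C w| ^+ 2 + `|D w - C0 w| ^+ 2) by exact: L1D.
  have iDDC : L1 P (fun w => `|D w - C w| ^+ 2 + `|D w - C0 w| ^+ 2 + `|C0 w| ^+ 2) by exact: L1D.
  apply: (le_trans (y := \int[P]_w (3 * (`|D w - C w| ^+ 2 + `|D w - C0 w| ^+ 2 + `|C0 w| ^+ 2)))).
    by apply: le_Rint => //; [exact: L1Z|move=> w; exact: sqr_norm3_le].
  by rewrite RintZ// ler_wpM2l// RintD// RintD// lerD2r lerD2r.
exists (3 * (1 + \int[P]_w (`|jder G 0 w - jder S0 0 w| ^+ 2) +
    \int[P]_w (`|jder S0 0 w| ^+ 2)) + 2 * (3 * (1 +
    \int[P]_w (`|jder G 1 w - jder S0 1 w| ^+ 2) + \int[P]_w (`|jder S0 1 w| ^+ 2)))).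
  by rewrite !(addr_ge0, mulr_ge0, nn)// => w; exact: sqr_ge0.
move=> S sS j1 j2 e1 e2; have [n [phi cS]] := cyl_smooth_jet sS.
have k1 := cyl_L1 W_fbm I_isom cS; have k2 := cyl_L12 W_fbm I_isom cS.
apply: lerD; first exact: B.
by rewrite ler_wpM2l//; exact: B.
Qed.

(** The gap between the approximations is a sum of three gaps, whence the factor 3: the one between
    [F] and [G], controlled by [a], and one for each approximation, controlled by [e]. *)
Lemma distance_approx F G S1 S2 a e : sobolev I 1 2 F -> sobolev I 2 4 G ->
  smooth_jet I S1 -> smooth_jet I S2 ->
  (\int[P]_w (((jval F w - jval G w) ^+ 2 + `|jder F 0 w - jder G 0 w| ^+ 2)%:E) <= a%:E)%E ->
  L1 P (fun w => (jval F w - jval S1 w) ^+ 2) ->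
  L1 P (fun w => `|jder F 0 w - jder S1 0 w| ^+ 2) ->
  L1 P (fun w => (jval G w - jval S2 w) ^+ 2) ->
  L1 P (fun w => `|jder G 0 w - jder S2 0 w| ^+ 2) ->
  \int[P]_w ((jval F w - jval S1 w) ^+ 2 + `|jder F 0 w - jder S1 0 w| ^+ 2) <= e ->
  \int[P]_w ((jval G w - jval S2 w) ^+ 2 + `|jder G 0 w - jder S2 0 w| ^+ 2) <= e ->
  \int[P]_w ((jval S1 w - jval S2 w) ^+ 2 + `|jder S1 0 w - jder S2 0 w| ^+ 2) <=
    3 * (a + 2 * e).
Proof.
move=> [mF /(_ 0%N isT) mDF _] [mG /(_ 0%N isT) mDG _] sS1 sS2 aFG iF iDF iG iDG eF eG.
have [n1 [phi1 c1]] := cyl_smooth_jet sS1; have [n2 [phi2 c2]] := cyl_smooth_jet sS2.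
have [chi [cx cy]] := cyl_common c1 c2.
have m1 := cyl_measurable_dist cx mDF; have m2 := cyl_measurable_dist cy mDG.
have m12 := cyl_measurableB cx cy.
set dF := fun w => `|jder F 0 w - jder S1 0 w| in m1 *.
set dG := fun w => `|jder G 0 w - jder S2 0 w| in m2 *.
set dS := fun w => `|jder S1 0 w - jder S2 0 w| in m12 *.
(* [|DF - DG|] need not be measurable, but it dominates the measurable [r]. *)
pose r w := Num.max (dS w - dF w - dG w) 0.
have mr : measurable_fun setT r.
  by apply: measurable_maxr => //; apply: measurable_funB => //; exact: measurable_funB.
have r0 w : 0 <= r w by rewrite le_max lexx orbT.
have rD w : r w <= `|jder F 0 w - jder G 0 w|.
  rewrite ge_max normr_ge0 andbT !lerBlDr /dS /dF /dG.
  rewrite (_ : jder S1 0 w - jder S2 0 w = (jder F 0 w - jder G 0 w) +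
    (jder G 0 w - jder S2 0 w) - (jder F 0 w - jder S1 0 w)).
    by rewrite (le_trans (ler_normB _ _))// lerD2r ler_normD.
  by rewrite subrKA opprB [RHS]addrC subrKA.
set u := fun w => jval F w - jval G w.
set uF := fun w => jval F w - jval S1 w in iF eF *.
set uG := fun w => jval G w - jval S2 w in iG eG *.
have mu : measurable_fun setT u by exact: measurable_funB.
have aR : (\int[P]_w ((u w ^+ 2 + r w ^+ 2)%:E) <= a%:E)%E.
  apply: le_trans aFG; apply: le_integral_ge0 => w.
    by rewrite lee_fin addr_ge0 ?sqr_ge0.
  by rewrite lee_fin lerD2l lerXn2r ?nnegrE.
have iU : L1 P (fun w => u w ^+ 2 + r w ^+ 2).
  apply: L1_ge0 => [||].
  - by apply: measurable_funD; exact: measurable_funX.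
  - by move=> w; rewrite addr_ge0 ?sqr_ge0.
  - exact: le_lt_trans aR (ltry _).
have {}aR : \int[P]_w (u w ^+ 2 + r w ^+ 2) <= a by rewrite -lee_fin -L1_Efin.
have iFF : L1 P (fun w => uF w ^+ 2 + dF w ^+ 2) by exact: L1D.
have iGG : L1 P (fun w => uG w ^+ 2 + dG w ^+ 2) by exact: L1D.
have iUF : L1 P (fun w => (u w ^+ 2 + r w ^+ 2) + (uF w ^+ 2 + dF w ^+ 2)) by exact: L1D.
have iUFG : L1 P (fun w => (u w ^+ 2 + r w ^+ 2) + (uF w ^+ 2 + dF w ^+ 2) +
  (uG w ^+ 2 + dG w ^+ 2)) by exact: L1D.
apply: (le_trans (y := \int[P]_w (3 * ((u w ^+ 2 + r w ^+ 2) + (uF w ^+ 2 + dF w ^+ 2) +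
  (uG w ^+ 2 + dG w ^+ 2))))).
  apply: le_Rint => [||w]; [exact: (cyl_L1B W_fbm I_isom cx cy)|exact: L1Z|].
  have h1 : (jval S1 w - jval S2 w) ^+ 2 <= 3 * (u w ^+ 2 + uF w ^+ 2 + uG w ^+ 2).
    rewrite (_ : _ - _ = u w + (- uF w) + uG w); last by rewrite /u /uF /uG; ring.
    by rewrite -(sqrrN (uF w)); exact: sqr_add3_le.
  have h2 : dS w ^+ 2 <= 3 * (r w ^+ 2 + dF w ^+ 2 + dG w ^+ 2).
    apply: le_trans (sqr_add3_le _ _ _); apply: lerXn2r; rewrite ?nnegrE ?addr_ge0 ?normr_ge0//.
    have : dS w - dF w - dG w <= r w by rewrite le_max lexx.
    lra.
  apply: (le_trans (lerD h1 h2)); lra.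
rewrite RintZ// RintD// RintD//; lra.
Qed.

Lemma measurable_cutweight (c : R) (f : Omega -> R) : 0 < c -> (forall w, 0 <= f w) ->
  measurable_fun setT f -> measurable_fun setT (fun w => cutweight c (f w)).
Proof.
move=> c0 f0 mf.
(* The Lipschitz bound for [cutweight] holds on the half-line only, so its argument is clipped at 0
   first. *)
rewrite (_ : (fun w => _) = (fun z => cutweight c (Num.max z 0)) \o f).
  apply: measurableT_comp mf; apply: continuous_measurable_fun.
  apply: (@lipschitz_bound_continuous _ _ (4 / c)) => x y.
  have m0 (z : R) : 0 <= Num.max z 0 by rewrite le_max lexx orbT.
  apply: (le_trans (cutweight_lipschitz c0 (m0 x) (m0 y))).
  rewrite ler_wpM2l ?divr_ge0 ?(ltW c0)// -[leRHS]mul1r; exact: max_lipschitz.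
by apply/funext => w /=; rewrite max_l.
Qed.

(** The cutoff is inserted for free, being almost surely 1 at [DG]. Replacing the three variables by
    smooth ones then costs their L^1 distances, weighted by the Lipschitz constants of [h] and of
    [cutweight]. *)
Lemma expectation_approx F G S1 S2 (h : R -> R) L c r :
  measurable_fun setT (jval F) -> measurable_fun setT (jval G) ->
  (forall A : set V, open A -> measurable (jder G 0 @^-1` A)) ->
  smooth_jet I S1 -> smooth_jet I S2 ->
  0 < c -> {ae P, forall w, c <= `|jder G 0 w|} ->
  (forall x, 0 <= h x <= 1) -> (forall x y, `|h x - h y| <= L * `|x - y|) -> 0 < r ->
  L1 P (fun w => (jval F w - jval S1 w) ^+ 2) ->
  L1 P (fun w => (jval G w - jval S2 w) ^+ 2) ->
  L1 P (fun w => `|jder G 0 w - jder S2 0 w| ^+ 2) ->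
  \int[P]_w ((jval F w - jval S1 w) ^+ 2) <= r ^+ 2 ->
  \int[P]_w ((jval G w - jval S2 w) ^+ 2) <= r ^+ 2 ->
  \int[P]_w (`|jder G 0 w - jder S2 0 w| ^+ 2) <= r ^+ 2 ->
  `|\int[P]_w h (jval F w) - \int[P]_w h (jval G w)| <=
  `|\int[P]_w ((h (jval S1 w) - h (jval S2 w)) * cutweight c `|jder S2 0 w|)| +
    (2 * `|L| + 4 / c) * r.
Proof.
move=> mF mG mDG sS1 sS2 c0 nd h01 hL r0 iF iG iD eF eG eD.
have ch : continuous h by exact: lipschitz_bound_continuous hL.
have mh (f : Omega -> R) : measurable_fun setT f -> measurable_fun setT (fun w => h (f w)).
  by move=> mf; exact: measurableT_comp (continuous_measurable_fun ch) mf.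
have [n1 [phi1 c1]] := cyl_smooth_jet sS1; have [n2 [phi2 c2]] := cyl_smooth_jet sS2.
have mx := cyl_measurable c1; have my := cyl_measurable c2.
have mdy : measurable_fun setT (fun w => `|jder S2 0 w|).
  rewrite (_ : (fun w => _) = fun w => `|(0 : V) - jder S2 0 w|).
    by apply: (cyl_measurable_dist (D := fun=> 0) c2) => A _; rewrite preimage_cst; case: ifP.
  by apply/funext => w; rewrite sub0r normrN.
have mDG0 : measurable_fun setT (fun w => `|jder G 0 w|).
  rewrite (_ : (fun w => _) = fun w => `|jder G 0 w - 0|); first exact: measurable_dist.
  by apply/funext => w; rewrite subr0.
have mDy := cyl_measurable_dist c2 mDG.
have mt := measurable_cutweight c0 (fun w => normr_ge0 (jder S2 0 w)) mdy.
have ms := measurable_cutweight c0 (fun w => normr_ge0 (jder G 0 w)) mDG0.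
set t := fun w => cutweight c `|jder S2 0 w| in mt *.
set s := fun w => cutweight c `|jder G 0 w| in ms *.
have t1 w : `|t w| <= 1 by exact: cutweight_norm_le1.
have s1 w : `|s w| <= 1 by exact: cutweight_norm_le1.
have L0 : 0 <= `|L| by [].
have hLn x y : `|h x - h y| <= `|L| * `|x - y|.
  by apply: (le_trans (hL x y)); rewrite ler_wpM2r// ler_norm.
have h1 x y : `|h x - h y| <= 1.
  by have /andP[? ?] := h01 x; have /andP[? ?] := h01 y; rewrite ler_norml; apply/andP; split; lra.
have ih (f : Omega -> R) : measurable_fun setT f -> L1 P (fun w => h (f w)).
  move=> mf; apply: (@L1_bounded _ _ _ _ _ 1); first exact: mh.
  by move=> w; have /andP[? ?] := h01 (f w); rewrite ger0_norm.
have mhB (f g : Omega -> R) : measurable_fun setT f -> measurable_fun setT g ->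
    measurable_fun setT (fun w => h (f w) - h (g w)).
  by move=> mf mg; apply: measurable_funB; exact: mh.
have ihs (f g k : Omega -> R) : measurable_fun setT f -> measurable_fun setT g ->
    measurable_fun setT k -> (forall w, `|k w| <= 1) ->
    L1 P (fun w => (h (f w) - h (g w)) * k w).
  move=> mf mg mk k1; apply: (@L1_bounded _ _ _ _ _ 1).
    by apply: measurable_funM => //; exact: mhB.
  by move=> w; rewrite normrM -[leRHS]mulr1 ler_pM.
rewrite -RintB; [|exact: ih|exact: ih].
have -> : \int[P]_w (h (jval F w) - h (jval G w)) =
    \int[P]_w ((h (jval F w) - h (jval G w)) * s w).
  apply: Rint_ae; first exact: mhB.
    by apply: measurable_funM => //; exact: mhB.
  by apply: filterS nd => w cw; rewrite /s cutweight1// mulr1.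
have i1 := ihs _ _ _ mF mG ms s1; have i2 := ihs _ _ _ mx my mt t1.
rewrite -lerBlDl; apply: (le_trans (lerB_dist _ _)); rewrite -RintB//.
apply: (le_trans (le_norm_Rint (L1B i1 i2))).
have mFx : measurable_fun setT (fun w => jval F w - jval S1 w) by exact: measurable_funB.
have mGy : measurable_fun setT (fun w => jval G w - jval S2 w) by exact: measurable_funB.
have [jF bF] := L1_abs_le mFx iF r0 eF.
have [jG bG] := L1_abs_le mGy iG r0 eG.
have [jD] := L1_abs_le mDy iD r0 eD.
have -> : (fun w => `|(`|jder G 0 w - jder S2 0 w|)|) = (fun w => `|jder G 0 w - jder S2 0 w|).
  by apply/funext => w; rewrite normr_id.
move=> bD.
have {}jD : L1 P (fun w => `|jder G 0 w - jder S2 0 w|).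
  by apply: L1_le jD => // w; rewrite !normr_id.
have kF := L1Z `|L| jF; have kG := L1Z `|L| jG; have kD := L1Z (4 / c) jD.
have kFG := L1D kF kG; have kFGD := L1D kFG kD.
apply: (le_trans (y := \int[P]_w (`|L| * `|jval F w - jval S1 w| + `|L| * `|jval G w - jval S2 w| +
   4 / c * `|jder G 0 w - jder S2 0 w|))).
  apply: le_Rint => //; first by apply: L1_norm; exact: L1B.
  move=> w.
  (* First the values of [h] change at a fixed weight, then the weight changes at fixed values of
     [h]; in each product the unchanged factor is at most 1. *)
  rewrite (_ : _ - _ = ((h (jval F w) - h (jval S1 w)) - (h (jval G w) - h (jval S2 w))) * s w +
    (h (jval S1 w) - h (jval S2 w)) * (s w - t w)); last by ring.
  apply: (le_trans (ler_normD _ _)); apply: lerD; rewrite normrM.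
    rewrite -[leRHS]mulr1; apply: ler_pM => //.
    by apply: (le_trans (ler_normB _ _)); exact: lerD.
  rewrite -[leRHS]mul1r; apply: ler_pM => //.
  apply: (le_trans (cutweight_lipschitz c0 (normr_ge0 _) (normr_ge0 _))).
  rewrite ler_wpM2l ?divr_ge0 ?(ltW c0)//; exact: ler_dist_dist.
rewrite RintD// RintD// RintZ// RintZ// RintZ//.
have c4 : 0 <= 4 / c by rewrite divr_ge0// ltW.
have := ler_wpM2l L0 bF; have := ler_wpM2l L0 bG; have := ler_wpM2l c4 bD.
lra.
Qed.

(** The constant is fixed before [F], [a] and [h]. The Lipschitz constant of [h] enters only through
    the accuracy [r] of the approximations, which is chosen afterwards and sent to 0 through [e]. *)
Lemma lipschitz_estimate G c : sobolev I 2 4 G -> 0 < c ->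
  {ae P, forall w, c <= `|jder G 0 w|} ->
  exists2 C, 0 < C & forall F a h, sobolev I 1 2 F -> 0 < a ->
  (\int[P]_w (((jval F w - jval G w) ^+ 2 + `|jder F 0 w - jder G 0 w| ^+ 2)%:E)
     <= (a ^+ 2)%:E)%E -> lipschitz01 h ->
  `|\int[P]_w h (jval F w) - \int[P]_w h (jval G w)| <= C * a.
Proof.
move=> sG c0 nd; have [K K0 hK] := moment_bound sG.
pose B := 8 / c ^+ 4 * K + 4 / c ^+ 2.
have c80 : 0 <= 8 / c ^+ 4 by rewrite divr_ge0// exprn_ge0// ltW.
have B0 : 0 <= B by rewrite addr_ge0 ?mulr_ge0// invr_ge0 exprn_ge0// ltW.
(* With [lam = 1 / a] the squared distance, at most [3 a^2] up to approximation, contributes [3 a],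
   and the moments of [G], bounded by [B], contribute [B a]; the factor 1/2 is that of Young's
   inequality. *)
exists ((3 + B) / 2); first by rewrite divr_gt0// ltr_wpDr.
move=> F a h sF a0 FG [h01 [L hL]]; apply/ler_addgt0Pr => e e0.
(* [cyl_estimate] is applied with [lam := a^-1], which balances its two terms. *)
have ai0 : 0 < a^-1 by rewrite invr_gt0.
(* [D] collects all multiples of [r] in the error: [3 / a] from [distance_approx], the rest from
   [expectation_approx]. Taking [r <= 1] keeps the approximation within the range of
   [moment_bound]. *)
pose D := 3 * a^-1 + (2 * `|L| + 4 / c).
have D0 : 0 < D by rewrite ltr_wpDr ?mulr_gt0// addr_ge0 ?mulr_ge0 ?invr_ge0 ?(ltW c0).
pose r := Num.min 1 (e / D).
have r0 : 0 < r by rewrite lt_min ltr01 divr_gt0.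
have r1 : r <= 1 by rewrite ge_min lexx.
have rD : D * r <= e by rewrite -ler_pdivlMl// mulrC ge_min lexx orbT.
have rr : r ^+ 2 <= r by rewrite expr2 ler_piMr// ltW.
have r20 : 0 < r ^+ 2 by rewrite exprn_gt0.
have [S1 [sS1 iF iDF eF]] := sobolev12_approx sF r20.
have [S2 [sS2 [iG iDG iD2 eG]]] := sobolev24_approx sG r20.
have sq (f : Omega -> R) w : 0 <= f w ^+ 2 by exact: sqr_ge0.
have nn (f : Omega -> R) : 0 <= \int[P]_w (f w ^+ 2).
  by apply: Rintegral_ge0 => w _; exact: sqr_ge0.
have eF' : \int[P]_w ((jval F w - jval S1 w) ^+ 2) <= r ^+ 2.
  by apply: le_trans eF; rewrite RintD// lerDl.
have iGD : L1 P (fun w => (jval G w - jval S2 w) ^+ 2 + `|jder G 0 w - jder S2 0 w| ^+ 2).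
  exact: L1D.
move: eG; rewrite RintD// => eG.
have n2 := nn (fun w => `|jder G 1 w - jder S2 1 w|).
have eG2 : \int[P]_w (`|jder G 1 w - jder S2 1 w| ^+ 2) <= 1.
  apply: le_trans r1; apply: le_trans rr; apply: le_trans eG.
  by rewrite lerDr; apply: Rintegral_ge0 => w _; rewrite addr_ge0 ?sqr_ge0.
have eG1 : \int[P]_w ((jval G w - jval S2 w) ^+ 2 + `|jder G 0 w - jder S2 0 w| ^+ 2) <= r ^+ 2.
  by apply: le_trans eG; rewrite lerDl.
have [eGv eGd] : \int[P]_w ((jval G w - jval S2 w) ^+ 2) <= r ^+ 2 /\
    \int[P]_w (`|jder G 0 w - jder S2 0 w| ^+ 2) <= r ^+ 2.
  split; apply: le_trans eG1; rewrite RintD//.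
    by rewrite lerDl; exact: (nn (fun w => `|_|)).
  by rewrite lerDr; exact: nn.
have MK := hK _ sS2 iDG iD2 (le_trans eGd (le_trans rr r1)) eG2.
have q := distance_approx sF sG sS1 sS2 FG iF iDF iG iDG eF eG1.
have [mF _ _] := sF; have [mG /(_ 0%N isT) mDG _] := sG.
have A := expectation_approx mF mG mDG sS1 sS2 c0 nd h01 hL r0 iF iG iDG eF' eGv eGd.
have [n1 [phi1 c1]] := cyl_smooth_jet sS1; have [n2' [phi2 c2]] := cyl_smooth_jet sS2.
have [chi [cx cy]] := cyl_common c1 c2.
have ch : continuous h by exact: lipschitz_bound_continuous hL.
have E := cyl_estimate W_fbm I_isom cx cy ch h01 c0 ai0.
move: q MK A E; rewrite invrK.
set q := \int[P]_w _; set M := \int[P]_w _ + 2 * _; set Z := `|\int[P]_w (_ * _)|; move=> qa MK A E.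
have q1 : a^-1 * q <= 3 * a + 6 * (a^-1 * r).
  apply: (le_trans (ler_wpM2l (ltW ai0) qa)).
  rewrite [leLHS](_ : _ = 3 * a + 6 * (a^-1 * r ^+ 2)); last by field; rewrite gt_eqF.
  by rewrite lerD2l ler_wpM2l// ler_wpM2l// ltW.
have q2 : a * (8 / c ^+ 4 * M + 4 / c ^+ 2) <= a * B.
  by rewrite ler_wpM2l ?(ltW a0)// lerD2r ler_wpM2l.
have DE : D * r = 3 * (a^-1 * r) + (2 * `|L| + 4 / c) * r by rewrite /D; ring.
have -> : (3 + B) / 2 * a = 2^-1 * (3 * a + a * B) by ring.
lra.
Qed.

End MainEstimate.

Lemma le_of_sqrt_le (R : realType) (J : \bar R) (a : R) : (0 <= J)%E -> 0 < a ->
  (J `^ 2^-1 < a%:E)%E -> (J <= (a ^+ 2)%:E)%E.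
Proof.
move=> J0 a0 Ja; rewrite leNgt; apply/negP => aJ; move: Ja; apply/negP; rewrite -leNgt.
rewrite (_ : a = (a ^+ 2) `^ 2^-1).
  rewrite -poweR_EFin; apply: gt0_ler_poweR; rewrite ?invr_ge0//.
  - by rewrite in_itv/= leey lee_fin sqr_ge0.
  - by rewrite in_itv/= leey andbT.
  - exact: ltW.
by rewrite powR12_sqrt ?sqr_ge0// sqrtr_sqr ger0_norm// ltW.
Qed.

Theorem proposition2p1 (R : realType) (H T : R)
  (H_gt : 1 / 2 < H) (H_lt : H < 1) (T_gt0 : 0 < T)
  (d : measure_display) (Omega : measurableType d) (P : probability Omega R)
  (Fil : R -> set (set Omega)) (Fil_usual : usual_conditions P T Fil)
  (W : R -> {RV P >-> R}) (W_fbm : is_fbm H T W)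
  (V : fbm_hilbert H T)
  (I : V -> {RV P >-> R}) (I_isom : is_wiener_isometry W I)
  (ten : forall V1 V2 : hilbertType R, hilbert_tensor V1 V2)
  (F : nat -> jet ten V Omega) (Foo : jet ten V Omega)
  (F_D12 : forall n : nat, (1 <= n)%N -> sobolev I 1 2 (F n))
  (Foo_D24 : sobolev I 2 4 Foo)
  (c : R) (c_gt0 : 0 < c)
  (Foo_nondeg : {ae P, forall w, c <= `|jder Foo 0 w|})
  (F_ac : forall n : nat, (1 <= n)%N ->
     pushforward P (jval (F n)) `<< @lebesgue_measure R)
  (Foo_ac : pushforward P (jval Foo) `<< @lebesgue_measure R) :
  exists2 C : R, 0 < C & forall n : nat, (1 <= n)%N ->
    (dTV P (jval (F n)) (jval Foo)
       <= C%:E * sobolev_norm P 1 2 (jet_sub (F n) Foo))%E.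
Proof.
have [C C0 hC] := lipschitz_estimate W_fbm I_isom Foo_D24 c_gt0 Foo_nondeg.
exists C => // n n1; have sF := F_D12 n n1.
have [mF _ _] := sF; have [mG _ _] := Foo_D24.
have J0 : (0 <= sobolev_norm P 1 2 (jet_sub (F n) Foo))%E by exact: poweR_ge0.
(* An infinite norm makes the bound trivial because [C > 0], so the norm may be taken to be a real
   number [s]. *)
case sE : (sobolev_norm P 1 2 (jet_sub (F n) Foo)) J0 => [s| |] // s0; last first.
  by rewrite gt0_muley ?lte_fin// leey.
rewrite lee_fin in s0; apply/lee_addgt0Pr => e e0.
(* The norm [s] may be 0, whereas [lipschitz_estimate] divides by [a]. With [a = s + e / C] the
   bound is [C s + e] for arbitrary [e > 0]. *)
have b0 : 0 < s + e / C by rewrite ltr_wpDl// divr_gt0.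
have E : (\int[P]_w (((jval (F n) w - jval Foo w) ^+ 2 +
    `|jder (F n) 0 w - jder Foo 0 w| ^+ 2)%:E) <= ((s + e / C) ^+ 2)%:E)%E.
  apply: le_of_sqrt_le => //.
    by apply: integral_ge0 => w _; rewrite lee_fin addr_ge0 ?sqr_ge0.
  apply: (@le_lt_trans _ _ s%:E); last by rewrite lte_fin ltrDl divr_gt0.
  rewrite -sE /sobolev_norm le_eqVlt; apply/orP; left; apply/eqP; congr (_ `^ _)%E.
  apply: eq_integral => w _; rewrite big_ord_recl big_ord0 addr0 !powR_mulrn//=.
  by rewrite real_normK ?num_real.
apply: (@le_trans _ _ (C * (s + e / C))%:E).
  by apply: tv_of_lipschitz => // h hh; exact: hC.
by rewrite mulrDr mulrCA divff ?gt_eqF// mulr1.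
Qed.
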